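(* Let $(T_t)_{t\ge 0}$ be a $C_0$-semigroup on a separable complex Banach space $X$ and let $A$ be its infinitesimal generator, with domain $D(A)$. Assume that there exists a family $(f_j)_{j\in \Gamma}$ of locally bounded measurable maps $f_j:I_j \rightarrow X$ such that each $I_j$ is a nondegenerate interval in $\mathbb{R}$, $f_j(I_j)\subset D(A)$, $Af_j(t)=itf_j(t)$ for every $t \in I_j$, $j\in \Gamma$, and $\operatorname{span} \{f_j (t) : j\in \Gamma,\ t\in I_j\}$ is dense in $X$. If either (a) $f_j \in C^2(I_j, X)$ for all $j\in \Gamma$, or (b) $X$ does not contain $c_0$ and $\langle \varphi,f_j\rangle \in C^{1}(I_j)$ for all $\varphi\in X'$, $j\in\Gamma$, then the semigroup $(T_t)_{t\geq 0}$ has the specification property for semigroups (SgSP).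
   Context: A $C_0$-semigroup on a Banach space $X$ is a family $(T_t)_{t\ge 0}$ of bounded linear operators on $X$ with $T_0=\mathrm{Id}$, $T_tT_s=T_{t+s}$ for all $t,s\ge 0$, and $\lim_{t\to s}T_tx=T_sx$ for all $x\in X$, $s\ge 0$. Its generator is $Ax=\lim_{t\to0^+}\frac1t(T_tx-x)$, defined on the subspace $D(A)$ of those $x$ for which the limit exists. $X'$ denotes the topological dual of $X$. ''$X$ does not contain $c_0$'' means that no closed subspace of $X$ is isomorphic to $c_0$. SgSP: A $C_0$-semigroup $(T_t)_{t\ge 0}$ on a separable Banach space $X$ has the SgSP if there exist an increasing sequence $(K_n)_{n\in\mathbb{N}}$ of subsets of $X$ with $0\in K_1$ and $\overline{\bigcup_{n} K_n}=X$, and a $t_0>0$, such that for each $n\in\mathbb{N}$ the set $K_n$ is $T_{t_0}$-invariant (i.e. $T_{t_0}(K_n)\subset K_n$), and for every $\delta>0$ there is $M_{\delta,n}>t_0$ such that for any integer $s\ge 2$, any set $\{y_1,\dots,y_s\}\subset K_n$ and any real numbers $0=a_1\le b_1<a_2\le b_2<\dots<a_s\le b_s$ satisfying $a_{r+1}-b_r\ge M_{\delta,n}$ for $r=1,\dots,s-1$, there is a point $x\in K_n$ such that - $\|T_t(x)-T_t(y_r)\|<\delta$ for each $t\in[a_r,b_r]$, $r=1,\dots,s$; - $T_{t'}(x)=x$, where $t'$ is the (unique) element of $[M_{\delta,n}+b_s,\,M_{\delta,n}+b_s+t_0)\cap \mathbb{N}\cdot t_0$, with $\mathbb{N}\cdot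 t_0=\{kt_0 : k\in\mathbb{N}\}$. *)

(* Defs.v *)
(* Times live in an arbitrary [R : realType] and scalars in [R[i]]; norms are
   elements of [R[i]] with null imaginary part, hence the casts [_%:C] in
   norm estimates. *)
From mathcomp Require Export all_boot all_order all_algebra.
From mathcomp Require Export complex.
From mathcomp Require Export all_classical all_reals all_analysis.
Set Implicit Arguments.
Unset Strict Implicit.
Unset Printing Implicit Defensive.
Export Order.TTheory GRing.Theory Num.Theory.
Export numFieldNormedType.Exports.
Local Open Scope classical_set_scope.
Local Open Scope ring_scope.
Local Open Scope complex_scope.

Definition separable (X : topologicalType) : Prop :=
  exists D : set X, countable D /\ dense D.

Definition linear_span (K : pzRingType) (X : lmodType K) (S : set X) : set X :=
  [set x | exists n (c : 'I_n -> K) (v : 'I_n -> X),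
    (forall i, S (v i)) /\ x = \sum_(i < n) c i *: v i].

(* Semigroups are families indexed by all of [R]; only the operators [T t] with
   [0 <= t] are meaningful. *)
Record C0_semigroup (R : realType) (X : normedModType R[i])
    (T : R -> X -> X) : Prop := {
  semigroup_linear : forall t : R, 0 <= t -> linear (T t) ;
  semigroup_bounded : forall t : R, 0 <= t ->
    exists M : R, forall x, `|T t x| <= M%:C * `|x| ;
  semigroup0 : forall x, T 0 x = x ;
  semigroupD : forall (t s : R) (x : X), 0 <= t -> 0 <= s -> T t (T s x) = T (t + s) x ;
  semigroup_continuous : forall (x : X) (s : R), 0 <= s ->
    T t x @[t --> within [set t : R | 0 <= t] (nbhs s)] --> T s x
}.

Definition generator_quotient (R : realType) (X : normedModType R[i])
    (T : R -> X -> X) (x : X) : R -> X :=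
  fun t => (t^-1)%:C *: (T t x - x).

Definition generator_domain (R : realType) (X : normedModType R[i])
    (T : R -> X -> X) : set X :=
  [set x | cvg (generator_quotient T x t @[t --> 0^'+])].

Definition generator (R : realType) (X : normedModType R[i])
    (T : R -> X -> X) (x : X) : X :=
  lim (generator_quotient T x t @[t --> 0^'+]).

(* [g] is the derivative of [f] relatively to [I], hence one-sided at the
   endpoints that belong to [I]. *)
Definition derivative_on (R : realType) (V : normedModType R[i])
    (I : set R) (f g : R -> V) : Prop :=
  forall t, I t ->
    ((s - t)^-1)%:C *: (f s - f t) @[s --> within I t^'] --> g t.

Fixpoint C_on (k : nat) (R : realType) (V : normedModType R[i])
    (I : set R) (f : R -> V) : Prop :=
  match k with
  | 0%N => {within I, continuous f}
  | k'.+1 => exists g, derivative_on I f g /\ C_on k' I g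
  end.

Definition nondegenerate_interval (R : realType) (I : set R) : Prop :=
  is_interval I /\ exists a b, [/\ I a, I b & a < b].

Definition locally_bounded_on (R : realType) (V : normedModType R[i])
    (I : set R) (f : R -> V) : Prop :=
  forall t, I t -> bounded_near f (within I (nbhs t)).

(* Lebesgue (Caratheodory) measurable sets of [R] on the source side and the
   Borel sigma-algebra of the norm topology on the target side. *)
Definition Lebesgue_measurable_on (R : realType) (V : normedModType R[i])
    (I : set R) (f : R -> V) : Prop :=
  @measurable_fun _ _ (caratheodory_type ((@wlength R idfun)^*)%mu)
    (g_sigma_algebraType (@open V)) I f.

Definition c0 (R : realType) : set (nat -> R[i]) :=
  [set u | u n @[n --> \oo] --> (0 : R[i]^o)].

Definition c0_norm (R : realType) (u : nat -> R[i]) : R :=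
  sup (range (fun n => complex.Re `|u n|)).

(* A bounded linear bijection with bounded inverse from [c0] onto a closed
   subspace [Y]. *)
Definition contains_c0 (R : realType) (X : normedModType R[i]) : Prop :=
  exists (Y : set X) (J : (nat -> R[i]) -> X),
    [/\ closed Y,
        set_bij (@c0 R) Y J,
        forall (a : R[i]) u v, @c0 R u -> @c0 R v ->
          J (fun n => a * u n + v n) = a *: J u + J v
      & exists M : R, forall u, @c0 R u ->
          `|J u| <= (M * c0_norm u)%:C /\ (c0_norm u)%:C <= M%:C * `|J u|].

(* Sets are indexed from [0], so that [K 0] is the first set of the sequence;
   [y], [a], [b] are also indexed from [0] and only their first [s] terms are
   constrained. *)
Definition SgSP (R : realType) (X : normedModType R[i])
    (T : R -> X -> X) : Prop :=
  exists (K : nat -> set X) (t0 : R),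
    [/\ forall n, K n `<=` K n.+1,
        K 0%N 0,
        closure (\bigcup_n K n) = setT,
        0 < t0
      & forall n,
          T t0 @` K n `<=` K n /\
          forall delta : R, 0 < delta ->
          exists2 M : R, t0 < M &
          forall (s : nat) (y : nat -> X) (a b : nat -> R),
            (2 <= s)%N ->
            (forall r, (r < s)%N -> K n (y r)) ->
            a 0%N = 0 ->
            (forall r, (r < s)%N -> a r <= b r) ->
            (forall r, (r.+1 < s)%N -> b r < a r.+1) ->
            (forall r, (r.+1 < s)%N -> M <= a r.+1 - b r) ->
          exists x : X,
            [/\ K n x,
                forall r t, (r < s)%N -> a r <= t <= b r ->
                  `|T t x - T t (y r)| < delta%:C
              & exists2 k : nat,
                  M + b s.-1 <= k%:R * t0 < M + b s.-1 + t0 &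
                  T (k%:R * t0) x = x]].

(* Main.v *)
(** Put tau = 2 pi.  Since [T t] multiplies [f_j s] by [e^(its)], the Fourier
coefficients [u k] (the integral of [e^(2 i pi k s) q(s) f_j(s)] over a short
interval, for a bump [q]) form a two-sided orbit of [T tau].  In case (a), second
differences of [q f_j] are O(h^2), so [u k] is O(k^-2).  In case (b), [f_j] is
Lipschitz by uniform boundedness, so by Bernstein's argument (Bessel's
inequality on dyadic blocks) the series [sum_k phi(u k)] converges absolutely,
uniformly for [|phi| <= 1], and as X does not contain c_0 the theorem of Bessaga
and Pelczynski makes [sum_k u k] unconditionally convergent.  The values [u 0]
approximate multiples of [f_j s], so there are orbits [v_m] of this kind with
[v_m 0] dense.  The set [K_n] consists of the sums [sum_k v_(w k) k] over
two-sided words [w] with letters at most [n]; [T tau] shifts words, and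
specification follows by gluing pieces of words and repeating the result
periodically, the tails of all these series being uniformly small. *)
Require Import Defs.
From HB Require Import structures.
From mathcomp Require Import ring lra zify.
Set Implicit Arguments.
Unset Strict Implicit.
Unset Printing Implicit Defensive.
Local Open Scope classical_set_scope.
Local Open Scope ring_scope.
Local Open Scope complex_scope.

(** No vector-valued integral is used: a Fourier coefficient is a limit of Riemann sums on the grids
    [c + m / 2^N]. Shifts by [2^-(j+2)], the orbit relation and Bessel's inequality hold exactly for
    these finite sums once the grid is fine enough, and for Lipschitz integrands successive sums
    differ by [O(2^-N)], so only limits of sequences occur.

    Unconditional convergence is what the words require: a word assigns to each letter an arbitrary
    set of positions, and the sum of an orbit over such a set must have a small tail whatever the
    set is. Bounding the letters by [n] makes the tails small uniformly over all words, so that one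
    gap [M] serves every point of [K_n]; density is only reached by the union over [n].

    In case (b) nothing is known about [f_j] in norm beyond its Lipschitz constant on short
    intervals, so the bound for [phi (u k)] may depend on that constant alone. Individual
    coefficients then decay too slowly for absolute convergence in norm, which is where the absence
    of c_0 enters. Its use is contrapositive: if unconditional convergence fails, Rosenthal's lemma
    applied to norming functionals of disjoint blocks yields a copy of c_0. *)

Definition nrm (R : realType) (V : normedZmodType R[i]) (x : V) : R :=
  complex.Re `|x|.

(** * Norms as real numbers, where the order is total *)

Section Norm.
Variable R : realType.
Implicit Types V : normedZmodType R[i].

Lemma nrmE V (x : V) : `|x| = (nrm x)%:C.
Proof.
have := normr_ge0 x; rewrite /nrm; case: (`|x|) => a b.
by rewrite lecE /= => /andP[/eqP-> _].
Qed.

Lemma nrm_ge0 V (x : V) : 0 <= nrm x.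
Proof. by rewrite -ler0c -nrmE. Qed.

Lemma nrm0 V : nrm (0 : V) = 0.
Proof. by rewrite /nrm normr0. Qed.

Lemma nrm_eq0 V (x : V) : (nrm x == 0) = (x == 0).
Proof. by rewrite -(normr_eq0 x) nrmE -(inj_eq (@complexI R)). Qed.

Lemma nrmD V (x y : V) : nrm (x + y) <= nrm x + nrm y.
Proof. by rewrite -lecR rmorphD /= -!nrmE ler_normD. Qed.

Lemma nrmN V (x : V) : nrm (- x) = nrm x.
Proof. by rewrite /nrm normrN. Qed.

Lemma nrmB V (x y : V) : nrm (x - y) <= nrm x + nrm y.
Proof. by rewrite -(nrmN y) nrmD. Qed.

Lemma nrmBC V (x y : V) : nrm (x - y) = nrm (y - x).
Proof. by rewrite -opprB nrmN. Qed.

Lemma nrm_tri V (z x y : V) : nrm (x - y) <= nrm (x - z) + nrm (z - y).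
Proof. by rewrite -(subrKA z x (- y)) nrmD. Qed.

Lemma nrm_ge_sub V (x y : V) : nrm x <= nrm y + nrm (x - y).
Proof. by rewrite -{1}(subrK y x) addrC nrmD. Qed.

Lemma nrm_sum V (J : Type) (l : seq J) (P : pred J) (x : J -> V) :
  nrm (\sum_(k <- l | P k) x k) <= \sum_(k <- l | P k) nrm (x k).
Proof.
elim/big_rec2: _ => [|k a b _ ab]; first by rewrite nrm0.
by rewrite (le_trans (nrmD _ _))// lerD2l.
Qed.

Lemma nrmZ (V : normedModType R[i]) (a : R[i]) (x : V) :
  nrm (a *: x) = nrm a * nrm x.
Proof. by apply: complexI; rewrite rmorphM /= -!nrmE normrZ. Qed.

Lemma nrmM (a b : R[i]) : nrm (a * b) = nrm a * nrm b.
Proof. by apply: complexI; rewrite rmorphM /= -!nrmE normrM. Qed.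

Lemma nrm_real (r : R) : nrm r%:C = `|r|.
Proof. by apply: complexI; rewrite -nrmE normc_def /= expr0n addr0 sqrtr_sqr. Qed.

Lemma nrm_sqr (z : R[i]) : nrm z ^+ 2 = complex.Re z ^+ 2 + complex.Im z ^+ 2.
Proof.
by case: z => a b; rewrite /nrm normc_def /= sqr_sqrtr// addr_ge0// sqr_ge0.
Qed.

Lemma nrm_Re (z : R[i]) : `|complex.Re z| <= nrm z.
Proof.
rewrite -(ler_pXn2r (n := 2)) ?nnegrE ?nrm_ge0// nrm_sqr.
by rewrite -normrX ger0_norm ?sqr_ge0// lerDl sqr_ge0.
Qed.

Lemma nrm_Im (z : R[i]) : `|complex.Im z| <= nrm z.
Proof.
rewrite -(ler_pXn2r (n := 2)) ?nnegrE ?nrm_ge0// nrm_sqr.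
by rewrite -normrX ger0_norm ?sqr_ge0// lerDr sqr_ge0.
Qed.

Lemma nrm_ReIm (z : R[i]) : nrm z <= `|complex.Re z| + `|complex.Im z|.
Proof.
rewrite -(ler_pXn2r (n := 2)) ?nnegrE ?nrm_ge0 ?addr_ge0// nrm_sqr.
rewrite sqrrD -!normrX !(ger0_norm (sqr_ge0 _)) lerD2r lerDl.
by rewrite mulrn_wge0// mulr_ge0.
Qed.

End Norm.

(** * Convergence of sequences with real error bounds *)

Section Convergence.
Variables (R : realType) (V : normedModType R[i]).

Lemma cvg_nrm (S : Type) (F : set_system S) (FF : Filter F) (f : S -> V) (l : V) :
  f @ F --> l <-> forall e : R, 0 < e -> F [set t | nrm (f t - l) < e].
Proof.
split=> [fl e e0|h].
  have /cvgrPdist_lt/(_ e%:C) := fl; rewrite (ltcR 0) => /(_ e0).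
  apply: filterS => t; rewrite nrmE ltcR /=.
  by rewrite -opprB nrmN.
apply/cvgrPdist_lt => e e0.
have -> : e = (complex.Re e)%:C.
  by move: e0; case: e => a b; rewrite ltcE /= => /andP[/eqP-> _].
have : 0 < complex.Re e by move: e0; rewrite ltcE => /andP[].
move=> /h; apply: filterS => t /= ht.
by rewrite nrmE ltcR nrmBC.
Qed.

Definition tends (x : nat -> V) (l : V) := forall e : R, 0 < e ->
  exists N, forall n, (N <= n)%N -> nrm (x n - l) <= e.

Lemma tends_cvg x l : tends x l -> x n @[n --> \oo] --> l.
Proof.
move=> h; apply/cvg_nrm => e e0; have [N hN] := h _ (divr_gt0 e0 (ltr0n _ 2)).
exists N => // n /= Nn; rewrite (le_lt_trans (hN _ Nn))//; lra.
Qed.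

Lemma cvg_tends x l : x n @[n --> \oo] --> l -> tends x l.
Proof.
move=> /cvg_nrm h e e0; have [N _ hN] := h _ e0.
by exists N => n Nn; exact/ltW/hN.
Qed.

Lemma nrm_small_eq0 (x : V) : (forall e, 0 < e -> nrm x <= e) -> x = 0.
Proof.
move=> h; apply/eqP; rewrite -nrm_eq0 eq_le nrm_ge0 andbT.
by apply/ler_addgt0Pl => e e0; rewrite addr0 h.
Qed.

Lemma tends_uniq x l l' : tends x l -> tends x l' -> l = l'.
Proof.
move=> xl xl'; apply/eqP; rewrite -subr_eq0; apply/eqP/nrm_small_eq0 => e e0.
have e2 : 0 < e / 2 by lra.
have [N hN] := xl _ e2; have [N' hN'] := xl' _ e2.
rewrite (le_trans (nrm_tri (x (N + N')%N) _ _))// nrmBC.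
have := hN (N + N')%N (leq_addr _ _); have := hN' (N + N')%N (leq_addl _ _); lra.
Qed.

Lemma tends_nrm_le x l C : tends x l ->
  (exists N, forall n, (N <= n)%N -> nrm (x n) <= C) -> nrm l <= C.
Proof.
move=> xl [N hC]; apply/ler_addgt0Pl => e e0; have [N' hN'] := xl _ e0.
have := hN' (N + N')%N (leq_addl _ _); have := hC (N + N')%N (leq_addr _ _).
by have := nrm_ge_sub l (x (N + N')%N); rewrite nrmBC; lra.
Qed.

Lemma tends_cst l : tends (fun=> l) l.
Proof. by move=> e e0; exists 0%N => n _; rewrite subrr nrm0 ltW. Qed.

Lemma tendsD x y l l' : tends x l -> tends y l' ->
  tends (fun n => x n + y n) (l + l').
Proof. by move=> /tends_cvg a /tends_cvg b; apply: cvg_tends; exact: cvgD. Qed.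

Lemma tendsB x y l l' : tends x l -> tends y l' ->
  tends (fun n => x n - y n) (l - l').
Proof. by move=> /tends_cvg a /tends_cvg b; apply: cvg_tends; exact: cvgB. Qed.

Lemma tendsZ a x l : tends x l -> tends (fun n => a *: x n) (a *: l).
Proof. by move=> /tends_cvg h; apply: cvg_tends; exact: cvgZr. Qed.

Lemma tends_shift x l p : tends x l -> tends (fun n => x (n + p)%N) l.
Proof.
move=> h e /h[N hN]; exists N => n Nn; apply: hN.
by rewrite (leq_trans Nn)// leq_addr.
Qed.

Lemma tends_ext x y l : (exists N, forall n, (N <= n)%N -> x n = y n) ->
  tends x l -> tends y l.
Proof.
move=> [N xy] xl e /xl[N' h]; exists (N + N')%N => n Nn.
by rewrite -xy ?h// (leq_trans _ Nn)// ?leq_addr ?leq_addl.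
Qed.

End Convergence.

Lemma tends_lip (R : realType) (V W : normedModType R[i]) (g : V -> W) (C : R) x l :
  (forall u v, nrm (g u - g v) <= C * nrm (u - v)) ->
  tends x l -> tends (fun n => g (x n)) (g l).
Proof.
move=> gC xl e e0.
have C0 : 0 < `|C| + 1 by rewrite ltr_wpDl.
have [N hN] := xl _ (divr_gt0 e0 C0); exists N => n /hN h.
rewrite (le_trans (gC _ _))// (@le_trans _ _ ((`|C| + 1) * nrm (x n - l)))//.
  by rewrite ler_wpM2r ?nrm_ge0// (le_trans (ler_norm _))// lerDl.
by rewrite mulrC -ler_pdivlMr.
Qed.

(** Passes a bound on finite sums of norms to the limit; this carries the Bernstein bound from
    Riemann sums to Fourier coefficients. *)
Lemma tends_nrm_sum (R : realType) (J : Type) (V : normedModType R[i]) (l : seq J)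
    (x : J -> nat -> V) (y : J -> V) (C : R) :
  (forall k, tends (x k) (y k)) ->
  (exists N, forall n, (N <= n)%N -> \sum_(k <- l) nrm (x k n) <= C) ->
  \sum_(k <- l) nrm (y k) <= C.
Proof.
move=> xy [N hC]; apply/ler_addgt0Pl => e e0.
suff [M hM] : exists M, forall n, (M <= n)%N ->
    \sum_(k <- l) nrm (y k) <= e + \sum_(k <- l) nrm (x k n).
  rewrite (le_trans (hM (N + M)%N (leq_addl _ _)))// lerD2l.
  by rewrite hC// leq_addr.
move: {hC N} e e0; elim: l => [|k l IH] e e0.
  by exists 0%N => n _; rewrite !big_nil addr0 ltW.
have e2 : 0 < e / 2 by lra.
have [M hM] := IH _ e2; have [N hN] := xy k _ e2.
exists (N + M)%N => n NMn; rewrite !big_cons.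
have := hM _ (leq_trans (leq_addl _ _) NMn).
have := hN _ (leq_trans (leq_addr _ _) NMn).
have := nrm_ge_sub (y k) (x k n); rewrite nrmBC; lra.
Qed.

Lemma cauchy_tends (R : realType) (X : completeNormedModType R[i]) (x : nat -> X) :
  (forall e : R, 0 < e -> exists N, forall n m, (N <= n)%N -> (N <= m)%N ->
     nrm (x n - x m) <= e) ->
  exists l, tends x l.
Proof.
move=> h.
suff /cauchy_cvgP xc : cauchy (x n @[n --> \oo]).
  by exists (lim (x n @[n --> \oo])); exact: cvg_tends.
apply/cauchy_ballP => e e0.
have e1 : 0 < complex.Re e by move: e0; rewrite ltcE => /andP[].
have ee : e = (complex.Re e)%:C.
  by move: e0; case: (e) => a b; rewrite ltcE /= => /andP[/eqP-> _].
have e2 : 0 < complex.Re e / 2 by lra.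
have [N hN] := h _ e2.
exists ([set x n | n in [set n | (N <= n)%N]], [set x n | n in [set n | (N <= n)%N]]).
  split; exists N => // n /= Nn; exists n => //.
move=> [u v] /= [[n Nn <-] [m Nm <-]]; rewrite -ball_normE /= ee.
by rewrite nrmE ltcR (le_lt_trans (hN _ _ Nn Nm))//; lra.
Qed.

(** * The Hahn-Banach theorem, real and complex *)

Section HahnBanach.
Variables (R : realType) (V : normedModType R[i]).
Implicit Types (p q g : V -> R) (x y : V).

(** Only nonnegative real scalars occur: [V] is treated as a real space until [complexify].
    Homogeneity is stated as an inequality; the converse follows by rescaling with [r^-1]. *)
Definition sublinear q := (forall x y, q (x + y) <= q x + q y) /\
  (forall (r : R) x, 0 <= r -> q (r%:C *: x) <= r * q x).

Lemma sublinear_ge q : sublinear q -> forall (r : R) x, 0 <= r ->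
  r * q x <= q (r%:C *: x).
Proof.
move=> [qD qZ] r x; rewrite le_eqVlt => /predU1P[<-|r0].
  by rewrite mul0r scale0r; have := qD 0 0; rewrite addr0; lra.
rewrite mulrC -ler_pdivlMr// mulrC.
have := qZ r^-1 (r%:C *: x); rewrite invr_ge0 => /(_ (ltW r0)).
by rewrite scalerA -rmorphM /= mulVf ?gt_eqF// scale1r.
Qed.

Lemma sublinear_at0 q : sublinear q -> q 0 = 0.
Proof.
move=> qs; apply/eqP; rewrite eq_le.
have := sublinear_ge qs 0 (lexx 0); rewrite mul0r scale0r => ->.
by have := qs.2 0 0 (lexx 0); rewrite mul0r scale0r => ->.
Qed.

Let along q y x : set R :=
  [set q (x + t%:C *: y) - t * q y | t in [set t : R | 0 <= t]].

(** The standard lowering of [q] along the ray of [y]: it is sublinear, below [q], and at most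
    [- q y] at [- y]. A minimal sublinear functional equals its own reductions, hence is odd, hence
    additive. *)
Definition reduce q y x : R := inf (along q y x).

Section Reduce.
Variables (q : V -> R) (qs : sublinear q) (y : V).

Let lbd x : lbound (along q y x) (- q (- x)).
Proof.
move=> _ [t /= t0 <-]; have := sublinear_ge qs y t0.
by have := qs.1 (x + t%:C *: y) (- x); rewrite addrAC subrr add0r; lra.
Qed.

Let reduce_le x (t : R) : 0 <= t -> reduce q y x <= q (x + t%:C *: y) - t * q y.
Proof. by move=> t0; apply: ge_inf; [exists (- q (- x)); exact: lbd|exists t]. Qed.

Let reduce_ge x c : (forall t : R, 0 <= t -> c <= q (x + t%:C *: y) - t * q y) ->
  c <= reduce q y x.
Proof.
move=> h; apply: lb_le_inf; first by exists (q (x + 0%:C *: y) - 0 * q y), 0 => /=.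
by move=> _ [t /= t0 <-]; exact: h.
Qed.

Lemma reduce_le_id x : reduce q y x <= q x.
Proof. by have := reduce_le x (lexx 0); rewrite scale0r addr0 mul0r subr0. Qed.

Lemma reduce_oppr : reduce q y (- y) <= - q y.
Proof.
have := reduce_le (- y) ler01.
by rewrite scale1r addNr (sublinear_at0 qs) mul1r sub0r.
Qed.

Lemma reduce_sublinear : sublinear (reduce q y).
Proof.
split=> [x z|r x].
  rewrite -lerBlDr; apply: reduce_ge => t t0; rewrite lerBlDl -lerBlDr.
  apply: reduce_ge => s s0; rewrite lerBlDr.
  have := reduce_le (x + z) (addr_ge0 t0 s0).
  have := qs.1 (x + t%:C *: y) (z + s%:C *: y).
  by rewrite rmorphD /= scalerDl addrACA; lra.
rewrite le_eqVlt => /predU1P[<-|r0].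
  by rewrite mul0r scale0r (le_trans (reduce_le_id _))// (sublinear_at0 qs).
rewrite mulrC -ler_pdivrMr//; apply: reduce_ge => t t0.
rewrite ler_pdivrMr// (le_trans (reduce_le _ (mulr_ge0 (ltW r0) t0)))//.
have := qs.2 r (x + t%:C *: y) (ltW r0).
by rewrite scalerDr scalerA -rmorphM /=; lra.
Qed.

End Reduce.

Section Infimum.
Variables (p : V -> R) (ps : sublinear p) (A : set (V -> R)).
Hypothesis A0 : A !=set0.
Hypothesis As : forall q, A q -> sublinear q /\ (forall x, q x <= p x).
Hypothesis Atotal : forall q q', A q -> A q' ->
  (forall x, q x <= q' x) \/ (forall x, q' x <= q x).

Let q0 x : R := inf [set q x | q in A].

Let q0_le q x : A q -> q0 x <= q x.
Proof.
move=> Aq; apply: ge_inf; last by exists q.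
exists (- p (- x)) => _ [q' Aq' <-]; have [qs qp] := As Aq'.
have := qs.1 x (- x); rewrite subrr (sublinear_at0 qs); have := qp (- x); lra.
Qed.

Let q0_ge x c : (forall q, A q -> c <= q x) -> c <= q0 x.
Proof.
move=> h; apply: lb_le_inf; first by have [q Aq] := A0; exists (q x), q.
by move=> _ [q Aq <-]; exact: h.
Qed.

(** An infimum of sublinear functionals is not subadditive in general; in a chain, the smaller of
    two members bounds both terms at once. The common bound [- p (- x)] from below keeps the infimum
    finite. *)
Lemma sublinear_inf : exists q, [/\ sublinear q, (forall x, q x <= p x) &
  forall q', A q' -> forall x, q x <= q' x].
Proof.
exists q0; split => [|x|q Aq x]; last exact: q0_le.
- split=> [x y|r x].
    rewrite -lerBlDr; apply: q0_ge => q Aq; rewrite lerBlDl -lerBlDr.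
    apply: q0_ge => q' Aq'; rewrite lerBlDr.
    have [qq'|q'q] := Atotal Aq Aq'.
      have := (As Aq).1.1 x y; have := q0_le (x + y) Aq; have := qq' y; lra.
    have := (As Aq').1.1 x y; have := q0_le (x + y) Aq'; have := q'q x; lra.
  rewrite le_eqVlt => /predU1P[<-|r0].
    have [q Aq] := A0; rewrite mul0r scale0r (le_trans (q0_le _ Aq))//.
    by rewrite (sublinear_at0 (As Aq).1).
  rewrite mulrC -ler_pdivrMr//; apply: q0_ge => q Aq.
  rewrite ler_pdivrMr// (le_trans (q0_le _ Aq))// mulrC.
  exact: (As Aq).1.2 (ltW r0).
- by have [q Aq] := A0; rewrite (le_trans (q0_le _ Aq))// (As Aq).2.
Qed.

End Infimum.

Lemma sublinear_minimal p : sublinear p -> exists q, [/\ sublinear q,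
  (forall x, q x <= p x) &
  forall q', sublinear q' -> (forall x, q' x <= q x) -> q' = q].
Proof.
move=> ps; pose Q := {q | sublinear q /\ (forall x, q x <= p x)}.
(* The order is reversed, so that a maximal element in the sense of Zorn's lemma is a pointwise
   minimal functional. *)
pose le (q q' : Q) := `[< forall x, sval q' x <= sval q x >].
have [||q q' q'' /asboolP h /asboolP h'|A Atot|[q [qs qp]] qmin] := @ZL_preorder Q _ le.
- by exists p.
- by move=> q; apply/asboolP.
- by apply/asboolP => x; exact: le_trans (h' x) (h x).
- have [->|/set0P[q1 Aq1]] := eqVneq A set0.
    by exists (exist _ p (conj ps (fun x => lexx _))) => q [].
  have [|_ [q _ <-]|_ _ [q Aq <-] [q' Aq' <-]|q [qs qp qA]] :=
      @sublinear_inf p [set sval q | q in A].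
  + by exists (sval q1), q1.
  + by case: q => q [].
  + by case: (Atot _ _ Aq Aq') => /asboolP h; [right|left].
  + exists (exist _ q (conj qs qp)) => q' Aq'; apply/asboolP => x /=.
    by apply: qA; exists q'.
- exists q; split=> // q' q's q'q; apply/funext => x; apply/eqP.
  have q'p z : q' z <= p z by apply: le_trans (qp z).
  pose Q' : Q := exist _ q' (conj q's q'p).
  have /asboolP/(_ x) /= : le Q' (exist _ q (conj qs qp)).
    by apply: qmin; apply/asboolP.
  by rewrite eq_le q'q => ->.
Qed.

(* A minimal sublinear functional is linear, and a minimal one below
   [reduce p x0] attains [p] at [x0]. *)
Lemma hahn_banach_real p x0 : sublinear p -> exists g : V -> R,
  [/\ forall x y, g (x + y) = g x + g y,
      forall (r : R) x, g (r%:C *: x) = r * g x,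
      forall x, g x <= p x & g x0 = p x0].
Proof.
move=> ps; have [g [gs gp gmin]] := sublinear_minimal (reduce_sublinear ps x0).
have gN x : g (- x) = - g x.
  apply/eqP; rewrite eq_le; apply/andP; split; last first.
    by have := gs.1 x (- x); rewrite subrr (sublinear_at0 gs); lra.
  rewrite -{1}(gmin (reduce g x)) ?reduce_oppr//; first exact: reduce_sublinear.
  exact: reduce_le_id.
have {}gp' x : g x <= p x by rewrite (le_trans (gp x))// reduce_le_id.
exists g; split=> //.
- move=> x y; apply/eqP; rewrite eq_le gs.1 /=.
  by have := gs.1 (x + y) (- y); rewrite addrK gN; lra.
- have gZ (r : R) x : 0 <= r -> g (r%:C *: x) = r * g x.
    by move=> r0; apply/eqP; rewrite eq_le gs.2//= sublinear_ge.
  move=> r x; have [/gZ//|r0] := leP 0 r.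
  rewrite -[r in LHS]opprK rmorphN /= scaleNr gN gZ ?oppr_ge0 ?ltW//.
  by rewrite mulNr opprK.
- apply/eqP; rewrite eq_le gp'/=.
  by have := gp (- x0); have := reduce_oppr ps x0; rewrite gN; lra.
Qed.

(** [g x - i g (i x)] is the only complex linear functional with real part [g]. Evaluating [g] at
    [conj (f x) *: x], where the functional has the real value [|f x|^2], shows that the constant
    [C] is kept. *)
Lemma complexify g C : (forall x y, g (x + y) = g x + g y) ->
  (forall (r : R) x, g (r%:C *: x) = r * g x) -> (forall x, g x <= C * nrm x) ->
  exists phi : {linear V -> R[i]^o},
    (forall x, nrm (phi x) <= C * nrm x) /\ (forall x, complex.Re (phi x) = g x).
Proof.
move=> gD gZ gn; pose f x : R[i]^o := g x +i* - g ('i *: x).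
have gN x : g (- x) = - g x.
  by rewrite -scaleN1r -(rmorphN1 (@real_complex R)) gZ mulN1r.
have fD x y : f (x + y) = f x + f y by rewrite /f scalerDr !gD opprD.
have fR (r : R) x : f (r%:C *: x) = r%:C * f x.
  rewrite /f scalerA mulrC -scalerA !gZ -mulrN; apply/eqP.
  by rewrite eq_complex /= !mul0r subr0 addr0 !eqxx.
have fI x : f ('i *: x) = 'i * f x.
  rewrite /f scalerA -expr2 sqr_i scaleN1r gN opprK; apply/eqP.
  by rewrite eq_complex /= !mul0r !mul1r sub0r add0r opprK !eqxx.
have fZ (a : R[i]) x : f (a *: x) = a * f x.
  rewrite [a]complexE scalerDl mulrDl fD fR -scalerA fI fR.
  by rewrite mulrA.
have flin : linear f by move=> a x y; rewrite fD fZ.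
pose phi : {linear V -> R[i]^o} := HB.pack f (GRing.isLinear.Build _ _ _ _ f flin).
exists phi; split=> // x.
have C0 y : 0 <= C * nrm y.
  have := gn y; have := gn (- y); rewrite nrmN gN; lra.
have [->|fx0] := eqVneq (phi x) 0; first by rewrite nrm0.
have n0 : 0 < nrm (f x) by rewrite lt_def nrm_ge0 nrm_eq0 fx0.
rewrite -(ler_pM2l n0) -expr2.
have /(congr1 (@complex.Re R)) := fZ (Num.conj (f x)) x.
have nJ : nrm (Num.conj (f x)) = nrm (f x) by rewrite /nrm norm_conjC.
rewrite mulrCA -[X in _ <= _ * (X * _)]nJ -nrmZ -normCKC nrmE -rmorphXn /= => <-.
exact: gn.
Qed.

Lemma complex_norming x0 : exists phi : {linear V -> R[i]^o},
  (forall x, nrm (phi x) <= nrm x) /\ phi x0 = (nrm x0)%:C.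
Proof.
have [|g [gD gZ gn gx0]] := @hahn_banach_real (@nrm R V) x0.
  by split=> [x y|r x r0]; rewrite ?nrmD// nrmZ nrm_real ger0_norm.
have [|phi [phin phig]] := @complexify g 1 gD gZ.
  by move=> x; rewrite mul1r.
have {}phin x : nrm (phi x) <= nrm x by rewrite -[nrm x]mul1r.
exists phi; split=> //.
(* The real part alone already has modulus [nrm x0], the bound on [phi x0], so nothing is left for
   the imaginary part. *)
have Im0 : complex.Im (phi x0) = 0.
  apply/eqP; rewrite -sqrf_eq0 eq_le sqr_ge0 andbT.
  have : nrm (phi x0) ^+ 2 <= nrm x0 ^+ 2 by rewrite ler_pXn2r ?nnegrE ?nrm_ge0.
  by rewrite nrm_sqr phig gx0; lra.
by rewrite -gx0 -phig; move: Im0; case: (phi x0) => a b /= ->.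
Qed.

End HahnBanach.

(** * Geometric rates of convergence and the gliding hump *)

Lemma pow_le_eps (R : realType) (r : R) : 0 <= r < 1 -> forall e, 0 < e ->
  exists N, forall n, (N <= n)%N -> r ^+ n <= e.
Proof.
move=> /andP[r0 r1] e e0.
have h : (fun n => r ^+ n) @ \oo --> (0 : R) by apply: cvg_expr; rewrite ger0_norm.
have /cvgrPdist_le/(_ _ e0)[N _ hN] := h.
exists N => n /hN /=; rewrite sub0r normrN ger0_norm//.
by rewrite exprn_ge0.
Qed.

Lemma le_geom (R : realType) (r C a b : R) : 0 <= r < 1 ->
  (forall n : nat, a <= b + C * r ^+ n) -> a <= b.
Proof.
move=> r01 h; apply/ler_addgt0Pr => e e0.
have C0 : 0 < `|C| + 1 by rewrite ltr_wpDl.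
have [N /(_ N (leqnn _)) hN] := pow_le_eps r01 (divr_gt0 e0 C0).
rewrite (le_trans (h N))// lerD2l.
have rN : 0 <= r ^+ N by rewrite exprn_ge0//; case/andP: r01.
rewrite (@le_trans _ _ ((`|C| + 1) * r ^+ N))//.
  by rewrite ler_wpM2r// (le_trans (ler_norm _))// lerDl.
by rewrite mulrC -ler_pdivlMr.
Qed.

Section Geometric.
Variables (R : realType) (r : R) (r01 : 0 <= r < 1).

Let K : R := (1 - r)^-1.

Let Kr n : K * r ^+ n - K * r ^+ n.+1 = r ^+ n.
Proof.
rewrite /K exprS; have : 1 - r != 0 by rewrite subr_eq0 gt_eqF//; case/andP: r01.
by move=> ?; field.
Qed.

Let rn_ge0 n : 0 <= r ^+ n.
Proof. by rewrite exprn_ge0//; case/andP: r01. Qed.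

Let K_gt0 : 0 < K. Proof. by rewrite invr_gt0 subr_gt0; case/andP: r01. Qed.

(** The intervals of radius [c * (K * r ^+ n)] around [a n] are nested, because
    [K r^n - K r^(n+1) = r^n]; the limit is the supremum of their left ends. *)
Lemma geometric_real (a : nat -> R) (c : R) :
  (forall n, `|a n.+1 - a n| <= c * r ^+ n) ->
  exists l, forall n, `|l - a n| <= c * (K * r ^+ n).
Proof.
move=> h.
pose lo n := a n - c * (K * r ^+ n); pose up n := a n + c * (K * r ^+ n).
have c0 : 0 <= c by have := h 0%N; rewrite expr0 mulr1; apply: le_trans.
have loS n : lo n <= lo n.+1.
  have := h n; rewrite ler_norml => /andP[+ _].
  by rewrite -(Kr n) /lo; lra.
have upS n : up n.+1 <= up n.
  have := h n; rewrite ler_norml => /andP[_].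
  by rewrite -(Kr n) /up; lra.
have lo_mono n m : lo n <= lo (m + n)%N.
  by elim: m => // m IH; rewrite (le_trans IH)// addSn.
have up_mono n m : up (m + n)%N <= up n.
  by elim: m => // m IH; rewrite addSn (le_trans _ IH).
have loup n m : lo n <= up m.
  have : lo (n + m)%N <= up (n + m)%N.
    by rewrite /lo /up lerD2l ge0_cp// mulr_ge0// mulr_ge0// ltW.
  by have := up_mono m n; have := lo_mono n m; rewrite addnC; lra.
exists (sup (range lo)) => n.
have ub m : ubound (range lo) (up m) by move=> _ [k _ <-].
have h1 : lo n <= sup (range lo).
  by apply: ub_le_sup; [exists (up 0%N)|exists n].
have h2 : sup (range lo) <= up n.
  by apply: ge_sup => //; exists (lo 0%N), 0%N.
by rewrite ler_norml; move: h1 h2; rewrite /lo /up; lra.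
Qed.

Lemma geometric_tends (X : completeNormedModType R[i]) (x : nat -> X) (c : R) :
  (forall n, nrm (x n.+1 - x n) <= c * r ^+ n) ->
  exists l, tends x l /\ forall n, nrm (l - x n) <= c * (K * r ^+ n).
Proof.
move=> h.
have c0 : 0 <= c.
  by have := h 0%N; rewrite expr0 mulr1; apply: le_trans; exact: nrm_ge0.
have hnm n m : nrm (x (m + n)%N - x n) <= c * (K * r ^+ n).
  suff : nrm (x (m + n)%N - x n) <= c * (K * r ^+ n - K * r ^+ (m + n)).
    by move=> /le_trans; apply; rewrite ler_wpM2l// gerBl mulr_ge0// ltW.
  elim: m => [|m IH]; first by rewrite !add0n !subrr nrm0 mulr0.
  rewrite (le_trans (nrm_tri (x (m + n)%N) _ _))// addSn.
  by have := h (m + n)%N; rewrite -(Kr (m + n)); lra.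
have [e e0|l xl] := @cauchy_tends _ _ x.
  have Kc : 0 < 2 * (K * (c + 1)) by rewrite mulr_gt0// mulr_gt0// ltr_wpDl.
  have [N hN] := pow_le_eps r01 (divr_gt0 e0 Kc).
  exists N => n m Nn Nm; rewrite (le_trans (nrm_tri (x N) _ _))//.
  have := hnm N (n - N)%N; have := hnm N (m - N)%N; rewrite !subnK//.
  rewrite [nrm (x m - _)]nrmBC; have := hN N (leqnn _).
  rewrite ler_pdivlMr// => h1 h2 h3; have := rn_ge0 N; have := K_gt0.
  move=> K0 rN; have : 0 <= K * r ^+ N by rewrite mulr_ge0// ltW.
  move: h1 h2 h3; rewrite (_ : r ^+ N * _ = 2 * (c * (K * r ^+ N)) + 2 * (K * r ^+ N)); last ring.
  lra.
exists l; split=> // n.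
apply: (tends_nrm_le (x := fun m => x (m + n)%N - x n)).
  by apply: tendsB; [exact: tends_shift|exact: tends_cst].
by exists 0%N.
Qed.

End Geometric.

(* Sokal's gliding hump: the sign of each term is chosen so that the [n]-th
   partial sum is large for [p n], and the remaining terms cannot undo this. *)
Lemma gliding_hump (R : realType) (E : zmodType) (good : E -> Prop)
    (p : nat -> E -> R) (w : nat -> E) (A : nat -> R) :
  (forall n x y, p n (x + y) <= p n x + p n y) ->
  (forall n x, p n (- x) = p n x) ->
  (forall n, 2 * A n <= p n (w n + w n)) ->
  (forall sg : nat -> bool, exists z, good z /\ forall n,
    p n (z - \sum_(k < n.+1) if sg k then w k else - w k) <= 2 / 3 * A n) ->
  exists z, good z /\ forall n, A n / 3 <= p n z.
Proof.
move=> pD pN pw series.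
pose s := fix s n := if n is n'.+1 then
  (if A n' <= p n' (s n' + w n') then s n' + w n' else s n' - w n') else 0.
pose sg n := A n <= p n (s n + w n).
have sE n : s n = \sum_(k < n) if sg k then w k else - w k.
  elim: n => [|n IH]; first by rewrite big_ord0.
  by rewrite big_ord_recr -IH /= /sg; case: ifP.
(* If adding [w n] does not reach [A n], subtracting it does: the two candidates differ by
   [w n + w n], on which [p n] is at least [2 * A n]. *)
have hump n : A n <= p n (s n.+1).
  rewrite /=; case: ifPn => //; rewrite -ltNge => lt.
  have := pD n (s n + w n) (- (s n - w n)); rewrite pN opprB.
  have -> : s n + w n + (w n - s n) = w n + w n by rewrite addrC addrA subrK.
  by have := pw n; lra.
have [z [gz hz]] := series sg; exists z; split=> // n.
have := pD n z (- (z - s n.+1)); rewrite pN opprB addrC subrK.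
by have := hz n; have := hump n; rewrite sE; lra.
Qed.

(** * Uniform boundedness, and Rosenthal's lemma on matrices *)

Section UniformBoundedness.
Variable R : realType.

Let third : 0 <= (3^-1 : R) < 1. Proof. by apply/andP; split; lra. Qed.
Let p3 n : 0 < (3^-1 : R) ^+ n. Proof. by rewrite exprn_gt0//; lra. Qed.
Let third2 : (1 - 3^-1 : R)^-1 = 3 / 2. Proof. by field. Qed.

(** Banach-Steinhaus on the dual, on which the points of [S] act by evaluation; the dual is complete
    even if [V] is not. The humps are norming functionals of points of [S] with rapidly growing
    norms, weighted by [3^-n] so that every signed series converges. *)
Lemma weakly_bounded (V : normedModType R[i]) (S : set V) :
  (forall phi : {linear V -> R[i]^o}, (exists C : R, forall x, nrm (phi x) <= C * nrm x) ->
     exists M : R, forall x, S x -> nrm (phi x) <= M) ->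
  exists M : R, forall x, S x -> nrm x <= M.
Proof.
move=> wb; apply: contrapT => /forallNP nb.
(* With [A n = 3^-n * nrm (x n)], this growth makes the gain [A n / 3] at least [n]. *)
have big (n : nat) : exists x, S x /\ 3 * (n%:R * 3 ^+ n) <= nrm x.
  have /existsNP[x /not_implyP[Sx /negP]] := nb (3 * (n%:R * 3 ^+ n)).
  by rewrite -ltNge => /ltW h; exists x.
have [x hx] := choice big.
have rn n : exists g : V -> R, [/\ forall x y, g (x + y) = g x + g y,
    forall (r : R) x, g (r%:C *: x) = r * g x,
    forall y, `|g y| <= nrm y & g (x n) = nrm (x n)].
  have [|g [gD gZ gn gx]] := @hahn_banach_real _ V (@nrm R V) (x n).
    by split=> [u v|r u r0]; rewrite ?nrmD// nrmZ nrm_real ger0_norm.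
  exists g; split=> // y; rewrite ler_norml gn andbT lerNl.
  have := gn (- y); rewrite nrmN.
  by rewrite -scaleN1r -(rmorphN1 (@real_complex R)) gZ mulN1r.
have [g hg] := choice rn.
have [|||sg|z [[zD zZ [C zC]] hz]] := @gliding_hump R (V -> R)
  (fun z => [/\ forall x y, z (x + y) = z x + z y,
    forall (r : R) x, z (r%:C *: x) = r * z x &
    exists C : R, forall y, `|z y| <= C * nrm y])
  (fun n z => `|z (x n)|) (fun n y => 3^-1 ^+ n * g n y)
  (fun n => 3^-1 ^+ n * nrm (x n)).
- by move=> n y z; exact: ler_normD.
- by move=> n y; exact: normrN.
- move=> n /=; rewrite -[X in `|X|]/(_ * _ + _ * _).
  case: (hg n) => _ _ _ ->; rewrite ger0_norm; first by lra.
  by rewrite addr_ge0// mulr_ge0 ?nrm_ge0// ltW.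
- pose a n y : R := \sum_(k < n) (if sg k then 1 else -1) * (3^-1 ^+ k * g k y).
  have aS y n : `|a n.+1 y - a n y| <= nrm y * 3^-1 ^+ n.
    rewrite /a big_ord_recr /= addrAC subrr add0r !normrM mulrC.
    rewrite (_ : `|if _ then _ else _| = 1); last by case: ifP; rewrite ?normrN normr1.
    by rewrite mulr1 ger0_norm ?(ltW (p3 n))// mulrC ler_wpM2r ?(ltW (p3 n))//; case: (hg n).
  have [z hz] := choice (fun y => geometric_real third (aS y)).
  have aD n u v : a n (u + v) = a n u + a n v.
    rewrite /a -big_split /=; apply: eq_bigr => k _.
    by case: (hg k) => -> _ _ _; rewrite !mulrDr.
  have aZ n (r : R) u : a n (r%:C *: u) = r * a n u.
    rewrite /a mulr_sumr /=; apply: eq_bigr => k _.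
    by case: (hg k) => _ -> _ _; rewrite [in RHS]mulrCA [in RHS](mulrCA r).
  exists z; split.
    split=> [u v|r u|].
    + apply/eqP; rewrite -subr_eq0 -normr_le0.
      apply: (le_geom (C := 3 / 2 * (nrm (u + v) + nrm u + nrm v)) third) => n.
      have := hz (u + v) n; have := hz u n; have := hz v n.
      rewrite third2 aD !ler_norml; lra.
    + apply/eqP; rewrite -subr_eq0 -normr_le0.
      apply: (le_geom (C := 3 / 2 * (nrm (r%:C *: u) + `|r| * nrm u)) third) => n.
      have -> : z (r%:C *: u) - r * z u =
          z (r%:C *: u) - a n (r%:C *: u) - r * (z u - a n u) by rewrite aZ; ring.
      rewrite (le_trans (ler_normB _ _))// normrM.
      have := hz (r%:C *: u) n.
      have : `|r| * `|z u - a n u| <= `|r| * (nrm u * ((1 - 3^-1)^-1 * 3^-1 ^+ n)).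
        by rewrite ler_wpM2l.
      rewrite third2; lra.
    + exists (3 / 2) => y; have := hz y 0%N.
      by rewrite third2 /a big_ord0 subr0; lra.
  move=> n.
  have -> : (z - \sum_(k < n.+1) (if sg k then fun y => 3^-1 ^+ k * g k y
      else - (fun y => 3^-1 ^+ k * g k y))) (x n) = z (x n) - a n.+1 (x n).
    rewrite -[LHS]/(z (x n) - (\sum_(k < n.+1) _) (x n)) fct_sumE; congr (_ - _).
    by apply: eq_bigr => k _; case: ifP => _; rewrite ?mul1r// mulN1r.
  rewrite (le_trans (hz _ _))// third2 exprS.
  have : 0 <= 3^-1 ^+ n * nrm (x n) by rewrite mulr_ge0 ?nrm_ge0 ?ltW.
  lra.
have [phi [phin phiz]] := @complexify _ _ z C zD zZ
  (fun x => le_trans (ler_norm _) (zC x)).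
have [M hM] : exists M : R, forall x, S x -> nrm (phi x) <= M.
  by apply: wb; exists C.
pose n := (Num.truncn M).+1; have [Sx xbig] := hx n.
have := hM _ Sx; have := nrm_Re (phi (x n)); rewrite phiz.
have := hz n; have : M < n%:R by rewrite truncnS_gt.
suff : n%:R <= 3^-1 ^+ n * nrm (x n) / 3 by lra.
rewrite ler_pdivlMr// exprVn [_^-1 * _]mulrC ler_pdivlMr ?exprn_gt0//; lra.
Qed.

(** [C] is the supremum over the unit ball, almost attained at [v]. The factor 3/4 is fitted to the
    gliding hump: the tail of the series there costs at most [C * 3^-n / 2], exactly two thirds of
    [3^-n * (3 / 4 * C)]. *)
Lemma operator_norm (V W : normedModType R[i]) (g : V -> W) (M : R) :
  (forall (r : R) x, g (r%:C *: x) = r%:C *: g x) ->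
  (forall x, nrm (g x) <= M * nrm x) -> (exists x, 0 < nrm (g x)) ->
  exists C v, [/\ forall x, nrm (g x) <= C * nrm x, nrm v <= 1, 0 < C &
    3 / 4 * C <= nrm (g v)].
Proof.
move=> gZ gM [x0 gx0]; pose S := [set nrm (g v) | v in [set v | nrm v <= 1]].
have x00 : 0 < nrm x0.
  rewrite lt_def nrm_ge0 andbT; apply/eqP => x00.
  by have := gM x0; rewrite x00 mulr0; lra.
have Sx x : 0 < nrm x -> S (nrm (g x) / nrm x).
  move=> x0'; exists ((nrm x)^-1%:C *: x) => /=.
    by rewrite nrmZ nrm_real ger0_norm ?invr_ge0 ?nrm_ge0// mulVf// gt_eqF.
  by rewrite gZ nrmZ nrm_real ger0_norm ?invr_ge0 ?nrm_ge0// mulrC.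
have hS : has_sup S.
  split; first by exists (nrm (g x0) / nrm x0); exact: Sx.
  exists `|M| => _ [v /= v1 <-]; rewrite (le_trans (gM v))//.
  rewrite (le_trans (ler_wpM2r (nrm_ge0 v) (ler_norm M)))//.
  by rewrite -[leRHS]mulr1 ler_wpM2l.
have C0 : 0 < sup S.
  by rewrite (lt_le_trans _ (sup_upper_bound hS (Sx _ x00)))// divr_gt0.
have C4 : 0 < sup S / 4 by lra.
have [_ [v /= v1 <-] hv] := sup_adherent C4 hS.
exists (sup S), v; split=> //; last by lra.
move=> x; have [x0'|] := ltP 0 (nrm x).
  by rewrite -ler_pdivrMr// (sup_upper_bound hS)//; exact: Sx.
move=> x0'; have -> : nrm x = 0 by apply/eqP; rewrite eq_le x0' nrm_ge0.
rewrite mulr0; have := gM x.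
by rewrite (_ : nrm x = 0) ?mulr0//; apply/eqP; rewrite eq_le x0' nrm_ge0.
Qed.

Lemma uniform_boundedness (V : completeNormedModType R[i]) (W : normedModType R[i])
    (J : Type) (T : J -> V -> W) :
  (forall j, linear (T j)) ->
  (forall j, exists M : R, forall x, nrm (T j x) <= M * nrm x) ->
  (forall x, exists M : R, forall j, nrm (T j x) <= M) ->
  exists M : R, forall j x, nrm (T j x) <= M * nrm x.
Proof.
move=> Tlin Tb Tpb; apply: contrapT => /forallNP nb.
have TD j x y : T j (x + y) = T j x + T j y.
  by have := Tlin j 1 x y; rewrite !scale1r.
have T0 j : T j 0 = 0 by have := TD j 0 0; rewrite addr0 -[X in X = _]addr0 => /addrI.
have TZ j (r : R[i]) x : T j (r *: x) = r *: T j x.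
  by have := Tlin j r x 0; rewrite T0 !addr0.
have TN j x : T j (- x) = - T j x by rewrite -scaleN1r TZ scaleN1r.
(* With [A n = 3^-n * (3 / 4 * C n)], this growth makes the gain [A n / 3] at least [n], against the
   pointwise bound at the limit [z]. *)
have big (n : nat) : exists j : J, exists C : R, exists v : V,
    [/\ forall x, nrm (T j x) <= C * nrm x, nrm v <= 1,
        3 / 4 * C <= nrm (T j v) & 4 * (n%:R * 3 ^+ n) <= C].
  have /existsNP[j /existsNP[x /negP]] := nb (4 * (n%:R * 3 ^+ n)).
  rewrite -ltNge => xbig; have [M hM] := Tb j.
  have [||C [v [hC v1 C0 hv]]] := @operator_norm V W (T j) M _ hM.
  - by move=> r y; rewrite TZ.
  - exists x; rewrite (le_lt_trans _ xbig)// ?mulr_ge0 ?nrm_ge0 ?exprn_ge0//.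
  - exists j, C, v; split=> //; rewrite leNgt; apply/negP => /ltW lt.
    have := le_trans (hC x) (ler_wpM2r (nrm_ge0 x) lt).
    by rewrite leNgt xbig.
have [j /choice[C /choice[v hv]]] := choice big.
have [|||sg|z [_ hz]] := @gliding_hump R V (fun=> True) (fun n x => nrm (T (j n) x))
  (fun n => (3^-1 ^+ n)%:C *: v n) (fun n => 3^-1 ^+ n * (3 / 4 * C n)).
- by move=> n x y; rewrite TD nrmD.
- by move=> n x; rewrite TN nrmN.
- move=> n; have -> (u : V) : u + u = 2%:C *: u.
    by rewrite -mulr2n -scaler_nat rmorph_nat.
  rewrite !TZ !nrmZ !nrm_real !ger0_norm ?(ltW (p3 n))//.
  case: (hv n) => _ _ h _.
  by have := ler_wpM2l (ltW (p3 n)) h; lra.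
- pose x n := \sum_(k < n) if sg k then (3^-1 ^+ k)%:C *: v k else - ((3^-1 ^+ k)%:C *: v k).
  have [n|z [_ hz]] := @geometric_tends _ _ third V x 1.
    rewrite /x big_ord_recr /= addrAC subrr add0r mul1r.
    have -> b (y : V) : nrm (if b then y else - y) = nrm y by case: b; rewrite ?nrmN.
    rewrite nrmZ nrm_real ger0_norm ?(ltW (p3 n))//.
    by case: (hv n) => _ v1 _ _; rewrite -[leRHS]mulr1 ler_wpM2l// (ltW (p3 n)).
  exists z; split=> // n; case: (hv n) => Cn _ _ Cb.
  rewrite (le_trans (Cn _))//; have := hz n.+1; rewrite -/(x n.+1) third2 exprS.
  have C0 : 0 <= C n.
    by rewrite (le_trans _ Cb)// ?mulr_ge0 ?exprn_ge0//.
  by move=> /(ler_wpM2l C0); lra.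
have [M hM] := Tpb z; pose n := (Num.truncn M).+1.
have := hz n; have := hM (j n); have : M < n%:R by rewrite truncnS_gt.
case: (hv n) => _ _ _ Cb.
suff : n%:R <= 3^-1 ^+ n * (3 / 4 * C n) / 3 by lra.
rewrite ler_pdivlMr// exprVn [_^-1 * _]mulrC ler_pdivlMr ?exprn_gt0//; lra.
Qed.

End UniformBoundedness.

(* If no class of the partition of [nat] given by [pickle] is good, each class
   [q] contains an index [i q] whose row has mass at least [d] on the rest of
   the class; the rows of the matrix restricted to these indices have lost mass
   [d], and the argument is iterated. *)
Lemma rosenthal (R : realType) (m : nat -> nat -> R) (C d : R) :
  0 < d -> (forall i j, 0 <= m i j) ->
  (forall (i : nat) (l : seq nat), uniq l -> \sum_(j <- l) m i j <= C) ->
  exists s : nat -> nat, injective s /\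
    forall (i : nat) (l : seq nat), uniq l -> i \notin l ->
      \sum_(j <- l) m (s i) (s j) <= d.
Proof.
move=> d0 m0 mC.
(* Each round lowers the bound on the row sums by [d]; after [p] rounds it is nonpositive and the
   identity is a good selection. *)
have [p hp] : exists p : nat, C <= p%:R * d.
  exists (Num.truncn (C / d)).+1; rewrite -ler_pdivrMr// ltW// truncnS_gt//.
elim: p m C m0 mC hp => [|p IH] m C m0 mC hp.
  exists id; split=> // i l /mC /le_trans -> //.
  by rewrite (le_trans hp)// mul0r ltW.
pose s (q r : nat) : nat := pickle (q, r).
have s_inj q r q' r' : s q r = s q' r' -> q = q' /\ r = r'.
  by move/(pcan_inj pickleK) => [-> ->].
have [[q hq]|/forallNP bad] := pselect (exists q, forall i l, uniq l ->
    i \notin l -> \sum_(j <- l) m (s q i) (s q j) <= d).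
  by exists (s q); split => // r r' /s_inj[].
have bad' q : exists r l, [/\ uniq l, r \notin l &
    d < \sum_(j <- l) m (s q r) (s q j)].
  have /existsNP[r /existsNP[l /not_implyP[ul /not_implyP[rl /negP h]]]] := bad q.
  by exists r, l; rewrite ltNge.
have [r /choice[L hL]] := choice bad'.
pose i q := s q (r q).
have i_inj : injective i by move=> q q' /s_inj[].
have [|||t [t_inj ht]] := IH (fun q q' => m (i q) (i q')) (C - d).
- by move=> *; exact: m0.
- move=> q l ul; have [uL rL dL] := hL q.
  rewrite lerBrDr; apply: (le_trans _ (mC (i q) (map i l ++ map (s q) (L q)) _)).
    by rewrite big_cat !big_map /= lerD2l ltW.
  rewrite cat_uniq !map_inj_uniq// ?ul ?uL ?andbT/=; last by move=> ? ? /s_inj[].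
  apply/hasPn => _ /mapP[k kL ->]; apply/negP => /mapP[q' _ /s_inj[qq' kr]].
  by move: rL; rewrite qq' -kr -qq' kL.
- by move: hp; rewrite mulrSr mulrDl mul1r lerBlDr.
exists (i \o t); split; first exact: inj_comp.
by move=> k l ul kl; exact: ht.
Qed.

(** Weakly unconditionally Cauchy series, with a bound [C] common to the whole unit ball of the
    dual. *)
Definition wuc (R : realType) (X : normedModType R[i]) (J : eqType) (x : J -> X)
    (C : R) := forall phi : {linear X -> R[i]^o},
  (forall y, nrm (phi y) <= nrm y) ->
  forall l, uniq l -> \sum_(k <- l) nrm (phi (x k)) <= C.

(** The Cauchy criterion for unconditional convergence over the integers: finite sets of indices far
    from the origin have small sums, whichever indices they omit. *)
Definition sub_cauchy (R : realType) (X : normedModType R[i]) (x : int -> X) :=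
  forall e : R, 0 < e -> exists N, forall l, uniq l ->
    (forall k, k \in l -> (N <= `|k|)%N) -> nrm (\sum_(k <- l) x k) <= e.

(** * A copy of c_0 and the Bessaga-Pelczynski theorem *)

Section C0Copy.
Variables (R : realType) (X : completeNormedModType R[i]).
Variables (z : nat -> X) (C e : R) (psi : nat -> {linear X -> R[i]^o}).
Hypothesis e0 : 0 < e.
Hypothesis zC : wuc z C.
Hypothesis psi1 : forall i y, nrm (psi i y) <= nrm y.
Hypothesis psiz : forall i, e <= nrm (psi i (z i)).
Hypothesis psi_off : forall i l, uniq l -> i \notin l ->
  \sum_(j <- l) nrm (psi i (z j)) <= e / 2.

Let C0 : 0 <= C.
Proof. by have := zC (psi1 0) (l := [::]) isT; rewrite big_nil. Qed.

(** Evaluated at a norming functional, the sum is dominated by [M] times a sum of moduli that [wuc]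
    bounds by [C]. *)
Let zC_scaled (a : nat -> R[i]) (M : R) l : uniq l -> 0 <= M ->
  (forall j, j \in l -> nrm (a j) <= M) ->
  nrm (\sum_(j <- l) a j *: z j) <= C * M.
Proof.
move=> ul M0 aM.
have [phi [phi1 phix]] := complex_norming (\sum_(j <- l) a j *: z j).
have -> : nrm (\sum_(j <- l) a j *: z j) = nrm (phi (\sum_(j <- l) a j *: z j)).
  by rewrite phix nrm_real ger0_norm ?nrm_ge0.
rewrite linear_sum (le_trans (nrm_sum _ _ _))//.
rewrite (@le_trans _ _ (\sum_(j <- l) M * nrm (phi (z j))))//.
  rewrite big_seq_cond [leRHS]big_seq_cond; apply: ler_sum => j /andP[jl _].
  by rewrite linearZ [nrm _]nrmM ler_wpM2r ?nrm_ge0// aM.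
by rewrite -mulr_sumr mulrC ler_wpM2r// zC.
Qed.

Let S (a : nat -> R[i]) n := \sum_(0 <= j < n) a j *: z j.

Let c0_tends (a : nat -> R[i]) : @c0 R a -> forall d : R, 0 < d ->
  exists N, forall n, (N <= n)%N -> nrm (a n) <= d.
Proof.
move=> /(@cvg_tends R R[i]^o) h d /h[N hN]; exists N => n /hN.
by rewrite subr0.
Qed.

Let c0_of (a : nat -> R[i]) : (forall d : R, 0 < d ->
  exists N, forall n, (N <= n)%N -> nrm (a n) <= d) -> @c0 R a.
Proof.
move=> h; apply: (@tends_cvg R R[i]^o) => d /h[N hN]; exists N => n /hN.
by rewrite subr0.
Qed.

Let c0_bounded (a : nat -> R[i]) : @c0 R a -> exists M : R, forall n, nrm (a n) <= M.
Proof.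
move=> /c0_tends/(_ _ ltr01)[N hN].
exists (1 + \sum_(0 <= j < N) nrm (a j)) => n.
have s0 (r : seq nat) : 0 <= \sum_(j <- r) nrm (a j).
  by apply: sumr_ge0 => *; exact: nrm_ge0.
have [/hN h|nN] := leqP N n; first by rewrite (le_trans h)// lerDl.
rewrite (bigD1_seq n) ?iota_uniq ?mem_index_iota//= addrCA lerDl.
by rewrite addr_ge0// sumr_ge0// => *; exact: nrm_ge0.
Qed.

Let c0_norm_ge (a : nat -> R[i]) n : @c0 R a -> nrm (a n) <= c0_norm a.
Proof.
move=> /c0_bounded[M hM]; apply: ub_le_sup; last by exists n.
by exists M => _ [k _ <-]; exact: hM.
Qed.

Let c0_norm_le (a : nat -> R[i]) M : (forall n, nrm (a n) <= M) -> c0_norm a <= M.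
Proof.
move=> h; apply: ge_sup; first by exists (nrm (a 0)), 0.
by move=> _ [k _ <-]; exact: h.
Qed.

Let c0_norm_ge0 (a : nat -> R[i]) : @c0 R a -> 0 <= c0_norm a.
Proof. by move=> /(c0_norm_ge 0); apply: le_trans; exact: nrm_ge0. Qed.

Let S_cvg a : @c0 R a -> exists l, tends (S a) l.
Proof.
move=> a0; apply: cauchy_tends => d d0.
have C1 : 0 < C + 1 by rewrite ltr_wpDl.
have [N hN] := c0_tends a0 (divr_gt0 d0 C1).
suff h n m : (N <= n)%N -> (n <= m)%N -> nrm (S a n - S a m) <= d.
  exists N => n m Nn Nm; have [/h->//|/ltnW mn] := leqP n m.
  by rewrite nrmBC h.
move=> Nn nm; rewrite /S (big_cat_nat (leq0n n) nm)/= opprD addrA subrr sub0r nrmN.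
rewrite (le_trans (zC_scaled (M := d / (C + 1)) _ _ _)) ?iota_uniq//.
- by rewrite divr_ge0// ltW.
- by move=> j; rewrite mem_index_iota => /andP[nj _]; rewrite hN// (leq_trans Nn).
by rewrite mulrA ler_pdivrMr// mulrC ler_wpM2l ?ltW// ltrDl.
Qed.

Let J a := lim (S a n @[n --> \oo]).

Let S_J a : @c0 R a -> tends (S a) (J a).
Proof.
move=> /S_cvg[l al]; suff -> : J a = l by [].
by apply: cvg_lim; [exact: norm_hausdorff|exact: tends_cvg].
Qed.

Let J_linear (c : R[i]) u v : @c0 R u -> @c0 R v ->
  @c0 R (fun n => c * u n + v n) /\ J (fun n => c * u n + v n) = c *: J u + J v.
Proof.
move=> u0 v0; have w0 : @c0 R (fun n => c * u n + v n).
  apply: c0_of => d d0.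
  have nc : 0 < nrm c + 1 by rewrite ltr_wpDl ?nrm_ge0.
  have d2 : 0 < d / 2 by lra.
  have [N hN] := c0_tends u0 (divr_gt0 d2 nc).
  have [N' hN'] := c0_tends v0 d2.
  exists (N + N')%N => n Nn; rewrite (le_trans (nrmD _ _))// nrmM.
  have := hN' n (leq_trans (leq_addl _ _) Nn).
  have := hN n (leq_trans (leq_addr _ _) Nn).
  rewrite ler_pdivlMr//; have := nrm_ge0 (u n); lra.
split=> //; apply: (tends_uniq (S_J w0)).
apply: (@tends_ext _ _ (fun n => c *: S u n + S v n)).
  exists 0 => n _; rewrite /S scaler_sumr -big_split /=.
  by apply: eq_bigr => j _; rewrite scalerDl scalerA.
by apply: tendsD; [apply: tendsZ|]; exact: S_J.
Qed.

Let J_upper a : @c0 R a -> nrm (J a) <= C * c0_norm a.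
Proof.
move=> a0; apply: (tends_nrm_le (S_J a0)); exists 0 => n _.
apply: zC_scaled; rewrite ?iota_uniq ?c0_norm_ge0// => j _; exact: c0_norm_ge.
Qed.

(** [psi i] reads off the coefficient [a i]: the diagonal term has modulus at least [e] times that
    of [a i], and the rest of the row costs at most [e / 2] times the sup norm. After a supremum
    over [i], half of [e] remains, whence [2 / e]. *)
Let J_lower a : @c0 R a -> c0_norm a <= 2 / e * nrm (J a).
Proof.
move=> a0; suff h i : nrm (a i) * e <= nrm (J a) + c0_norm a * (e / 2).
  have : c0_norm a <= (nrm (J a) + c0_norm a * (e / 2)) / e.
    by apply: c0_norm_le => i; rewrite ler_pdivlMr.
  by rewrite ler_pdivlMr// mulrAC ler_pdivlMr//; lra.
apply/ler_addgt0Pr => d d0; have [N hN] := S_J a0 d0.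
pose n := (N + i.+1)%N; have Nn : (N <= n)%N by rewrite leq_addr.
have iin : i \in index_iota 0 n by rewrite mem_index_iota /n; lia.
have : nrm (psi i (a i *: z i)) <= nrm (psi i (S a n)) + c0_norm a * (e / 2).
  rewrite /S (bigD1_seq i)// ?iota_uniq//= linearD.
  set r := \sum_(j <- _ | _) _; set x := psi i (a i *: z i).
  rewrite -lerBlDl (@le_trans _ _ (nrm (psi i r)))//.
    by rewrite lerBlDl -[x in nrm x <= _](addrK (psi i r)) nrmB.
  rewrite /r -big_filter linear_sum (le_trans (nrm_sum _ _ _))//.
  apply: (@le_trans _ _ (\sum_(j <- [seq j <- index_iota 0 n | j != i])
      c0_norm a * nrm (psi i (z j)))).
    apply: ler_sum => j _; rewrite linearZ [nrm _]nrmM ler_wpM2r ?nrm_ge0//.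
    exact: c0_norm_ge.
  rewrite -mulr_sumr ler_wpM2l ?c0_norm_ge0// psi_off ?filter_uniq ?iota_uniq//.
  by rewrite mem_filter eqxx.
rewrite linearZ [nrm (_ *: _)]nrmM.
have := ler_wpM2l (nrm_ge0 (a i)) (psiz i).
have := psi1 i (S a n); have := hN n Nn; have := nrm_ge_sub (S a n) (J a); lra.
Qed.

Let J_sub u v : @c0 R u -> @c0 R v ->
  c0_norm (fun n => -1 * u n + v n) <= 2 / e * nrm (J u - J v).
Proof.
move=> u0 v0; have [w0 wE] := J_linear (-1) u0 v0.
by rewrite (le_trans (J_lower w0))// wE scaleN1r addrC nrmBC.
Qed.

(** A point of the closure is approached at rate [2^-n]. By the lower bound the preimages converge
    at that rate, uniformly over the coordinates, so that their limit is again a null sequence, and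
    the upper bound identifies its image. *)
Let J_closed : closed (J @` @c0 R).
Proof.
move=> y ycl.
have h n : exists u, @c0 R u /\ nrm (J u - y) <= 2^-1 ^+ n.
  have p2 : 0 < (2^-1 : R) ^+ n by rewrite exprn_gt0.
  have [|_ [[u u0 <-] hu]] := ycl (ball y (2^-1 ^+ n)%:C).
    by apply: nbhsx_ballx; rewrite (ltcR 0).
  exists u; split=> //; move: hu; rewrite -ball_normE /= nrmE ltcR nrmBC.
  exact: ltW.
have [u hu] := choice h.
have half : 0 <= (2^-1 : R) < 1 by apply/andP; split; lra.
(* [J (u n)] and [J (u n.+1)] are at most [2^-n + 2^-(n+1) = 3 / 2 * 2^-n] apart. *)
pose K : R := 2 / e * (3 / 2).
have e2 : 0 <= 2 / e by rewrite divr_ge0// ltW.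
have K0 : 0 <= K by rewrite /K mulr_ge0// ?divr_ge0// ltW.
have uS n k : nrm (u n.+1 k - u n k) <= K * 2^-1 ^+ n.
  have [u0 ul] := hu n; have [v0 vl] := hu n.+1.
  have [w0 _] := J_linear (-1) u0 v0.
  have := le_trans (c0_norm_ge k w0) (J_sub u0 v0); rewrite mulN1r addrC.
  move=> /le_trans; apply; rewrite /K -(mulrA (2 / e)) ler_wpM2l//.
  apply: le_trans (nrm_tri y _ _) _; rewrite [nrm (y - _)]nrmBC.
  by move: ul vl; rewrite exprS; lra.
have [re hre] := choice (fun k => geometric_real half (a := fun n => complex.Re (u n k))
  (fun n => le_trans (eq_ind _ (fun x => `|x| <= _) (nrm_Re _) _ (raddfB _ _ _)) (uS n k))).
have [im him] := choice (fun k => geometric_real half (a := fun n => complex.Im (u n k))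
  (fun n => le_trans (eq_ind _ (fun x => `|x| <= _) (nrm_Im _) _ (raddfB _ _ _)) (uS n k))).
pose v k := re k +i* im k.
have uv n k : nrm (v k - u n k) <= 4 * K * 2^-1 ^+ n.
  rewrite (le_trans (nrm_ReIm _))// !raddfB /=.
  have := hre k n; have := him k n; rewrite (_ : (1 - 2^-1)^-1 = 2); last by field.
  lra.
have v0 : @c0 R v.
  apply: c0_of => d d0; have d2 : 0 < d / 2 by lra.
  have K1 : 0 < 4 * K + 1 by lra.
  have [n /(_ _ (leqnn _)) hn] := pow_le_eps half (divr_gt0 d2 K1).
  have [u0 _] := hu n; have [N hN] := c0_tends u0 d2.
  exists N => k Nk; have := nrm_ge_sub (v k) (u n k); have := uv n k.
  have := hN k Nk; have : 0 < (2^-1 : R) ^+ n by rewrite exprn_gt0.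
  by move: hn; rewrite ler_pdivlMr//; lra.
exists v => //; apply/eqP; rewrite -subr_eq0 -nrm_eq0 eq_le nrm_ge0 andbT.
apply: (le_geom (C := C * (4 * K) + 1) half) => n; rewrite add0r.
have [u0 ul] := hu n.
rewrite (le_trans (nrm_tri (J (u n)) _ _))// mulrDl mul1r lerD//.
have [w0 wE] := J_linear (-1) u0 v0.
rewrite scaleN1r addrC in wE; rewrite -wE -mulrA (le_trans (J_upper w0))// ler_wpM2l//.
by apply: c0_norm_le => k; rewrite mulN1r addrC uv.
Qed.

Lemma c0_copy : contains_c0 X.
Proof.
have e2 : 0 <= 2 / e by rewrite divr_ge0// ltW.
exists (J @` @c0 R), J; split=> //.
- split; [by move=> a a0; exists a| |by []].
  move=> u v; rewrite !inE => u0 v0 Juv; apply/funext => n.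
  have [w0 _] := J_linear (-1) u0 v0.
  have := le_trans (c0_norm_ge n w0) (J_sub u0 v0).
  rewrite Juv subrr nrm0 mulr0 mulN1r addrC => h.
  by apply/esym/eqP; rewrite -subr_eq0 -nrm_eq0 eq_le nrm_ge0 h.
- by move=> a u v u0 v0; have [] := J_linear a u0 v0.
- exists (C + 2 / e) => u u0; split.
    by rewrite nrmE lecR (le_trans (J_upper u0))// ler_wpM2r ?c0_norm_ge0// lerDl.
  by rewrite nrmE -rmorphM /= lecR (le_trans (J_lower u0))// ler_wpM2r ?nrm_ge0// lerDr.
Qed.

End C0Copy.

Lemma uniq_flatten_map (S : eqType) (B : nat -> seq S) (l : seq nat) :
  (forall i, uniq (B i)) ->
  (forall i j k, k \in B i -> k \in B j -> i = j) ->
  uniq l -> uniq (flatten (map B l)).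
Proof.
move=> uB dB; elim: l => //= i l IH /andP[il /IH ul].
rewrite cat_uniq uB ul andbT /=; apply/hasPn => k /flatten_mapP[j jl kj].
by apply/negP => ki; move: il; rewrite (dB _ _ _ ki kj) jl.
Qed.

(** A failure of unconditional convergence gives pairwise disjoint finite blocks with sums [y i] of
    norm above [e], still a [wuc] family. Norming functionals [phi i] make the matrix of the
    [nrm (phi i (y j))] large on the diagonal with bounded row sums; Rosenthal's lemma cuts the
    off-diagonal part down to [e / 2]. *)
Theorem bessaga_pelczynski (R : realType) (X : completeNormedModType R[i])
    (x : int -> X) (C : R) :
  ~ contains_c0 X -> wuc x C -> sub_cauchy x.
Proof.
move=> nc0 xC; apply: contrapT => /existsNP[e /not_implyP[e0 /forallNP nsc]].
have bad N : exists l, [/\ uniq l, forall k, k \in l -> (N <= `|k|)%N &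
    e < nrm (\sum_(k <- l) x k)].
  have /existsNP[l /not_implyP[ul /not_implyP[lN /negP h]]] := nsc N.
  by exists l; rewrite ltNge.
have [L hL] := choice bad.
(* The increment exceeds every index occurring in [L N], so the next block starts beyond this
   one. *)
pose step N := (N + (\sum_(k <- L N) `|k|).+1)%N.
pose N i := iter i step 0%N; pose B i := L (N i).
have B_lt i k : k \in B i -> (N i <= `|k| < N i.+1)%N.
  move=> kB; have [_ lN _] := hL (N i); rewrite lN //= /step -/(N i).
  have := kB; rewrite /B => kL; rewrite (big_rem _ kL) /= ; lia.
have N_mono i j : (i <= j)%N -> (N i <= N j)%N.
  move=> /subnK <-; elim: (j - i)%N => // m IH.
  by rewrite addSn (leq_trans IH)// /N /= /step leq_addr.
have B_disj i j k : k \in B i -> k \in B j -> i = j.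
  move=> /B_lt/andP[i1 i2] /B_lt/andP[j1 j2].
  by have [/N_mono|/N_mono|//] := ltngtP i j; lia.
have B_uniq i : uniq (B i) by case: (hL (N i)).
pose y i := \sum_(k <- B i) x k.
have yC : wuc y C.
  move=> phi phi1 l ul; apply: le_trans (xC phi phi1 (flatten (map B l)) _).
    rewrite big_flatten big_map /=; apply: ler_sum => i _.
    by rewrite /y linear_sum nrm_sum.
  exact: uniq_flatten_map.
have [phi hphi] := choice (fun i => complex_norming (y i)).
have [||i l ul|s [s_inj hs]] := @rosenthal R (fun i j => nrm (phi i (y j))) C (e / 2).
- by rewrite divr_gt0.
- by move=> i j; exact: nrm_ge0.
- by apply: yC => //; case: (hphi i).
apply: nc0; apply: (@c0_copy _ _ (y \o s) C e (phi \o s)) => //.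
- move=> psi psi1 l ul; rewrite -(big_map s xpredT (fun j => nrm (psi (y j)))).
  by apply: yC => //; rewrite map_inj_uniq.
- by move=> i; case: (hphi (s i)).
- move=> i /=; case: (hphi (s i)) => _ ->.
  by rewrite nrm_real ger0_norm ?nrm_ge0//; case: (hL (N (s i))) => _ _ /ltW.
Qed.

(** * The mean value inequality and the complex exponential *)

Lemma mean_value_inequality (R : realType) (V : normedModType R[i]) (G : R -> V)
    (a b C : R) : a <= b -> 0 <= C ->
  (forall t, a <= t <= b -> forall e, 0 < e -> exists2 d, 0 < d &
     forall s, a <= s <= b -> `|s - t| < d -> nrm (G s - G t) <= e) ->
  (forall t, a <= t < b -> forall e, 0 < e -> exists2 d, 0 < d &
     forall s, t < s < t + d -> s <= b -> nrm (G s - G t) <= (C + e) * (s - t)) ->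
  nrm (G b - G a) <= C * (b - a).
Proof.
move=> ab C0 Gc Gd.
suff h e : 0 < e -> nrm (G b - G a) <= (C + e) * (b - a).
  apply/ler_addgt0Pr => e e0.
  have ba1 : 0 < b - a + 1 by lra.
  have := h _ (divr_gt0 e0 ba1); rewrite mulrDl => /le_trans; apply.
  by rewrite lerD2l mulrAC ler_pdivrMr// ler_wpM2l ?ltW//; lra.
move=> e0; have Ce : 0 <= C + e by lra.
(* The supremum of [S] is shown to be [b]: continuity puts it in [S], and the estimate on the right
   of it would push it further. Only right-hand estimates are used, which suits semigroup orbits and
   windowed functions. *)
pose S := [set t | a <= t <= b /\ nrm (G t - G a) <= (C + e) * (t - a)].
have Sa : S a by split; rewrite ?lexx// !subrr nrm0 mulr0.
have hS : has_sup S by split; [exists a|exists b => t [/andP[]]].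
have ac : a <= sup S by exact: sup_upper_bound.
have cb : sup S <= b by apply: ge_sup; [exists a|move=> t [/andP[]]].
set c := sup S in ac cb.
have Sc : S c.
  split; first by rewrite ac.
  apply/ler_addgt0Pr => e' e'0.
  have [|d d0 hd] := Gc c _ e' e'0; first by rewrite ac.
  have [t [/andP[at_ tb] ht] ct] := sup_adherent d0 hS.
  have tc : t <= c by apply: sup_upper_bound => //; split=> //; rewrite at_.
  rewrite (le_trans (nrm_tri (G t) _ _))// nrmBC addrC lerD//.
    by rewrite (le_trans ht)// ler_wpM2l//; lra.
  apply: hd; first by rewrite at_.
  by rewrite ler0_norm; rewrite -/c in ct; lra.
have [cb'|bc] := ltP c b; last first.
  by have [_] := Sc; rewrite (_ : c = b)//; apply/eqP; rewrite eq_le cb bc.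
have [|d d0 hd] := Gd c _ e e0; first by rewrite ac.
have [_ Gca] := Sc; pose s := Num.min b (c + d / 2).
have cs : c < s by rewrite /s lt_min cb' /=; lra.
have sb : s <= b by rewrite /s ge_min lexx.
have sd : s < c + d by rewrite /s gt_min; apply/orP; right; lra.
suff /(sup_upper_bound hS) : S s by rewrite -/c; lra.
split; first by rewrite sb andbT; lra.
rewrite (le_trans (nrm_tri (G c) _ _))//.
by have := hd s _ sb; rewrite cs sd => /(_ isT); lra.
Qed.

Section Expi.
Variable R : realType.
Implicit Types t u : R.

Definition expi t : R[i] := cos t +i* sin t.

Lemma expi0 : expi 0 = 1.
Proof. by rewrite /expi cos0 sin0. Qed.

Lemma expiD t u : expi (t + u) = expi t * expi u.
Proof. by rewrite /expi cosD sinD; apply/eqP; rewrite eq_complex /= eqxx addrC eqxx. Qed.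

Lemma expiMn t n : expi (n%:R * t) = expi t ^+ n.
Proof.
elim: n => [|n IH]; first by rewrite mul0r expi0.
by rewrite mulrSr mulrDl mul1r expiD IH exprSr.
Qed.

Lemma nrm_expi t : nrm (expi t) = 1.
Proof. by rewrite /nrm normc_def /= cos2Dsin2 sqrtr1. Qed.

Lemma expi_conj t : Num.conj (expi t) = expi (- t).
Proof. by rewrite /expi cosN sinN. Qed.

Lemma expi_2pi_int (k : int) : expi (2 * pi * k%:~R) = 1.
Proof.
have h (n : nat) : expi (2 * pi * n%:R) = 1.
  by rewrite mulrC expiMn /expi mulr_natl cos2pi sin2pi expr1n.
case: k => n; first exact: h.
by rewrite NegzE mulrNz mulrN -expi_conj h rmorph1.
Qed.

Lemma sin_lip t u : `|sin t - sin u| <= `|t - u|.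
Proof.
wlog ut : t u / u < t.
  move=> h; have [/h//|/h|->] := ltgtP u t; last by rewrite !subrr.
  by rewrite distrC [leRHS]distrC.
have [x _ ->] := MVT ut (fun x _ => is_derive_sin x)
  (continuous_subspaceT (@continuous_sin R)).
by rewrite normrM ler_piMl// ler_norml cos_geN1 cos_le1.
Qed.

Lemma cos_lip t u : `|cos t - cos u| <= `|t - u|.
Proof.
wlog ut : t u / u < t.
  move=> h; have [/h//|/h|->] := ltgtP u t; last by rewrite !subrr.
  by rewrite distrC [leRHS]distrC.
have [x _ ->] := MVT ut (fun x _ => is_derive_cos x)
  (continuous_subspaceT (@continuous_cos R)).
by rewrite normrM ler_piMl// normrN ler_norml sin_geN1 sin_le1.
Qed.

Lemma expi_lip t u : nrm (expi t - expi u) <= 2 * `|t - u|.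
Proof.
rewrite (le_trans (nrm_ReIm _))//= mulrDl !mul1r.
by rewrite lerD ?cos_lip ?sin_lip.
Qed.

Lemma expi_deriv t : nrm (expi t - 1 - 'i * t%:C) <= 2 * t ^+ 2.
Proof.
have e : expi t - 1 - 'i * t%:C = (cos t - 1) +i* (sin t - t).
  by apply/eqP; rewrite eq_complex /=; apply/andP; split; apply/eqP; ring.
have key (x : R) : 0 < x -> `|cos x - 1| + `|sin x - x| <= 2 * x ^+ 2.
  move=> x0.
  have [c /[!in_itv]/= /andP[c0 cx]] := MVT x0 (fun x _ => is_derive_cos x)
    (continuous_subspaceT (@continuous_cos R)).
  rewrite cos0 subr0 => ->.
  have [d /[!in_itv]/= /andP[d0 dx]] := MVT x0 (fun x _ => is_derive_sin x)
    (continuous_subspaceT (@continuous_sin R)).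
  rewrite sin0 !subr0 => ->.
  rewrite -{3}[x]mul1r -mulrBl !normrM (gtr0_norm x0) expr2 normrN.
  have := sin_lip c 0; have := cos_lip d 0; rewrite sin0 cos0 !subr0.
  rewrite (gtr0_norm d0) (gtr0_norm c0) => hc hs.
  have := ler_wpM2r (ltW x0) (le_trans hc (ltW dx)).
  by have := ler_wpM2r (ltW x0) (le_trans hs (ltW cx)); lra.
rewrite e (le_trans (nrm_ReIm _))//=.
have [/key//|t0|<-] := ltgtP 0 t.
  have := key (- t); rewrite oppr_gt0 => /(_ t0).
  by rewrite cosN sinN sqrrN -opprD normrN.
by rewrite cos0 sin0 !subrr normr0 expr0n mulr0 addr0.
Qed.

End Expi.

(** * Semigroups on eigenvectors of the generator *)

Section Eigen.
Variables (R : realType) (X : normedModType R[i]) (T : R -> X -> X).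
Hypothesis sT : C0_semigroup T.

Lemma semigroupDr t x y : 0 <= t -> T t (x + y) = T t x + T t y.
Proof. by move=> t0; have := semigroup_linear sT t0 1 x y; rewrite !scale1r. Qed.

Lemma semigroup_at0 t : 0 <= t -> T t 0 = 0.
Proof.
by move=> t0; have := semigroupDr 0 0 t0; rewrite addr0 -[X in X = _]addr0 => /addrI.
Qed.

Lemma semigroupZ t a x : 0 <= t -> T t (a *: x) = a *: T t x.
Proof.
by move=> t0; have := semigroup_linear sT t0 a x 0; rewrite semigroup_at0// !addr0.
Qed.

Lemma semigroupN t x : 0 <= t -> T t (- x) = - T t x.
Proof. by move=> t0; rewrite -scaleN1r semigroupZ// scaleN1r. Qed.

Lemma semigroupB t x y : 0 <= t -> T t (x - y) = T t x - T t y.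
Proof. by move=> t0; rewrite semigroupDr// semigroupN. Qed.

Lemma semigroup_sum t (J : Type) (l : seq J) (x : J -> X) : 0 <= t ->
  T t (\sum_(k <- l) x k) = \sum_(k <- l) T t (x k).
Proof.
move=> t0; elim: l => [|k l IH]; first by rewrite !big_nil semigroup_at0.
by rewrite !big_cons semigroupDr// IH.
Qed.

Lemma semigroup_bound t : 0 <= t ->
  exists2 M : R, 0 <= M & forall x, nrm (T t x) <= M * nrm x.
Proof.
move=> t0; have [M hM] := semigroup_bounded sT t0.
exists `|M| => // x.
have := hM x; rewrite !nrmE -rmorphM lecR => /le_trans; apply.
by rewrite ler_wpM2r ?nrm_ge0 ?ler_norm.
Qed.

Lemma semigroup_cont x t : 0 <= t -> forall e, 0 < e -> exists2 d, 0 < d &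
  forall s, 0 <= s -> `|s - t| < d -> nrm (T s x - T t x) <= e.
Proof.
move=> t0 e e0; have /cvg_nrm/(_ e e0) := @semigroup_continuous _ _ _ sT x t t0.
move=> /nbhs_ballP[d /= d0 hd]; exists d => // s s0 sd.
by apply: ltW; apply: hd => //; rewrite /ball /= distrC.
Qed.

(** [expi (- (s * w)) *: T s x] has right derivative 0, hence is constant by the mean value
    inequality with [C = 0]. The generator only describes the right quotient at time 0; factoring
    out the bounded operator [T s] carries it to time [s]. *)
Lemma generator_eigen x (w t : R) : generator_domain T x ->
  generator T x = (0 +i* w) *: x -> 0 <= t -> T t x = expi (t * w) *: x.
Proof.
move=> dx gx t0.
pose G s := expi (- (s * w)) *: T s x.
suff : nrm (G t - G 0) <= 0 * (t - 0).
  rewrite mul0r => h; have /eqP : G t - G 0 == 0 by rewrite -nrm_eq0 eq_le h nrm_ge0.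
  rewrite /G mul0r oppr0 expi0 scale1r (semigroup0 sT) => /subr0_eq.
  by move=> E; rewrite -[in RHS]E scalerA -expiD subrr expi0 scale1r.
apply: mean_value_inequality => // s /andP[s0 st] e e0.
  have e2 : 0 < e / 2 by lra.
  have [d d0 hd] := semigroup_cont x s0 e2.
  pose K := 2 * `|w| * nrm (T s x) + 1.
  have K0 : 0 < K by rewrite /K ltr_wpDl// !mulr_ge0 ?nrm_ge0.
  exists (Num.min d (e / 2 / K)); first by rewrite lt_min d0 divr_gt0.
  move=> r /andP[r0 _]; rewrite lt_min ltr_pdivlMr// => /andP[/(hd _ r0) h1 h2].
  have -> : G r - G s = expi (- (r * w)) *: (T r x - T s x) +
      (expi (- (r * w)) - expi (- (s * w))) *: T s x.
    by rewrite scalerBr scalerBl addrA subrK.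
  rewrite (le_trans (nrmD _ _))// !nrmZ nrm_expi mul1r.
  have := expi_lip (- (r * w)) (- (s * w)); 
  rewrite (_ : - (r * w) - - (s * w) = - (r - s) * w) ?normrM ?normrN; last by ring.
  move=> /(ler_wpM2r (nrm_ge0 (T s x))).
  by have := normr_ge0 (r - s); move: h1 h2; rewrite /K; lra.
have [M M0 hM] := semigroup_bound s0.
have e2 : 0 < e / (2 * (M + 1)) by rewrite divr_gt0//; lra.
have dx' : generator_quotient T x h @[h --> 0^'+] --> generator T x := dx.
rewrite gx in dx'.
have {}dx' := (cvg_nrm (at_right_proper_filter 0) _ _).1 dx' _ e2.
have /nbhs_ballP[d /= d0 hd] : nbhs (0 : R) (fun h => 0 < h ->
  nrm (generator_quotient T x h - (0 +i* w) *: x) < e / (2 * (M + 1))) := dx'.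
pose K := 2 * w ^+ 2 * nrm x + 1.
have K0 : 0 < K by rewrite /K ltr_wpDl// mulr_ge0 ?nrm_ge0// mulr_ge0 ?sqr_ge0.
exists (Num.min d (e / (2 * (M + 1)) / K)); first by rewrite lt_min d0 divr_gt0.
move=> r /andP[sr rs] rt; pose h := r - s.
have h0 : 0 < h by rewrite subr_gt0.
have : h < Num.min d (e / (2 * (M + 1)) / K) by rewrite /h; lra.
rewrite lt_min => /andP[hd1 hK].
have -> : G r - G s = expi (- (r * w)) *: T s (T h x - expi (h * w) *: x).
  rewrite semigroupB// (semigroupD sT)// ?(ltW h0)// semigroupZ// scalerBr scalerA.
  rewrite -expiD (_ : s + h = r); last by rewrite /h addrC subrK.
  by rewrite /G; congr (_ - expi _ *: _); rewrite /h; ring.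
rewrite nrmZ nrm_expi mul1r (le_trans (hM _))//.
have -> : T h x - expi (h * w) *: x =
    h%:C *: (generator_quotient T x h - (0 +i* w) *: x)
    - (expi (h * w) - 1 - 'i * (h * w)%:C) *: x.
  rewrite /generator_quotient scalerBr !scalerA -rmorphM /= divff ?gt_eqF//.
  rewrite scale1r !scalerBl scale1r.
  have -> : h%:C * (0 +i* w) = 'i * (h * w)%:C by simpc.
  move: ((_ * _) *: x) => u; rewrite !opprB !addrA subrK.
  by congr (_ - _); rewrite subrK.
rewrite (@le_trans _ _ (M * (h * (e / (2 * (M + 1))) + 2 * (h * w) ^+ 2 * nrm x)))//.
  rewrite ler_wpM2l// (le_trans (nrmB _ _))// !nrmZ lerD//.
    rewrite nrm_real gtr0_norm// ler_wpM2l ?(ltW h0)//.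
    apply: ltW; apply: hd => //=; rewrite /ball /= sub0r normrN gtr0_norm//.
  by rewrite ler_wpM2r ?nrm_ge0// expi_deriv.
have hK' : 2 * (h * w) ^+ 2 * nrm x <= h * (e / (2 * (M + 1))).
  rewrite (_ : 2 * (h * w) ^+ 2 * nrm x = h * (h * (K - 1))); last by rewrite /K; ring.
  rewrite ler_pM2l// (@le_trans _ _ (h * K))//; first by rewrite ler_pM2l//; lra.
  by rewrite -ler_pdivlMr// ltW.
rewrite (@le_trans _ _ (M * (2 * (h * (e / (2 * (M + 1)))))))//.
  by rewrite ler_wpM2l//; lra.
rewrite add0r (_ : M * _ = M / (M + 1) * (e * h)); last first.
  have M1 : M + 1 != 0 by rewrite gt_eqF//; lra.
  by rewrite /h; clear -M1; field.
apply: ler_piMl; first by rewrite mulr_ge0// ltW.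
by rewrite ler_pdivrMr; lra.
Qed.

End Eigen.

(** * Lipschitz bounds from differentiability *)

Definition lipschitz_itv (R : realType) (V : normedModType R[i]) (a b L : R)
    (f : R -> V) :=
  forall s t, a <= s <= b -> a <= t <= b -> nrm (f s - f t) <= L * `|s - t|.

Section DerivativeOn.
Variables (R : realType) (V : normedModType R[i]) (I : set R).
Implicit Types f g : R -> V.

Lemma derivative_onP f g : derivative_on I f g -> forall t, I t ->
  forall e, 0 < e -> exists2 d, 0 < d & forall s, I s -> `|s - t| < d ->
    nrm (f s - f t - (s - t)%:C *: g t) <= e * `|s - t|.
Proof.
move=> fg t It e e0.
have h := (cvg_nrm (within_filter I (dnbhs_filter t)) _ _).1 (fg t It) e e0.
have /nbhs_ballP[d /= d0 hd] : nbhs t (fun s => s != t -> I s ->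
    nrm ((s - t)^-1%:C *: (f s - f t) - g t) < e).
  exact: h.
exists d => // s Is st; have [->|nst] := eqVneq s t.
  by rewrite !subrr scale0r subrr nrm0 normr0 mulr0.
have bs : ball t d s by rewrite /ball /= distrC.
have /ltW hs := hd s bs nst Is.
have st0 : s - t != 0 by rewrite subr_eq0.
have -> : f s - f t - (s - t)%:C *: g t =
    (s - t)%:C *: ((s - t)^-1%:C *: (f s - f t) - g t).
  by rewrite scalerBr scalerA -rmorphM /= divff// scale1r.
by rewrite nrmZ nrm_real mulrC ler_wpM2r.
Qed.

Lemma continuous_bounded f a b : {within I, continuous f} -> a <= b ->
  (forall t, a <= t <= b -> I t) ->
  exists2 C, 0 <= C & forall t, a <= t <= b -> nrm (f t) <= C.
Proof.
move=> fc ab abI.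
have [|c _ hc] := @EVT_max _ (fun t => nrm (f t)) a b ab.
  have abI' : `[a, b]%classic `<=` I by move=> t /=; rewrite in_itv /=; exact: abI.
  have /subspace_continuousP h := continuous_subspaceW abI' fc.
  apply/subspace_continuousP => t /h /cvg_nrm h'.
  apply/cvgrPdist_lt => e /h'; apply: filterS => s /=; apply: le_lt_trans.
  have := nrm_ge_sub (f s) (f t); have := nrm_ge_sub (f t) (f s).
  by rewrite [nrm (f t - _)]nrmBC ler_norml; lra.
by exists (nrm (f c)); rewrite ?nrm_ge0// => t; rewrite -in_itv; exact: hc.
Qed.

Lemma derivative_lipschitz f g a b C : derivative_on I f g ->
  (forall t, a <= t <= b -> I t) -> 0 <= C ->
  (forall t, a <= t <= b -> nrm (g t) <= C) -> lipschitz_itv a b C f.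
Proof.
move=> /derivative_onP fg abI C0 gC s t.
wlog st : s t / s <= t.
  move=> h hs ht; have [st|/ltW ts] := leP s t; first exact: h.
  by rewrite nrmBC distrC h.
move=> /andP[as_ sb] /andP[at_ tb]; rewrite nrmBC distrC ger0_norm ?subr_ge0//.
apply: mean_value_inequality => // r /andP[sr rt] e e0.
  have rab : a <= r <= b by apply/andP; split; lra.
  have [d d0 hd] := fg r (abI r rab) 1 ltr01.
  exists (Num.min d (e / (C + 1))); first by rewrite lt_min d0 divr_gt0//; lra.
  move=> q /andP[sq qt]; rewrite lt_min ltr_pdivlMr; last lra.
  move=> /andP[qd1 qd2].
  have qab : a <= q <= b by apply/andP; split; lra.
  have := hd q (abI q qab) qd1; have := nrm_ge_sub (f q - f r) ((q - r)%:C *: g r).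
  rewrite nrmZ nrm_real.
  have := ler_wpM2l (normr_ge0 (q - r)) (gC r rab); lra.
have rab : a <= r <= b by apply/andP; split; lra.
have [d d0 hd] := fg r (abI r rab) e e0.
exists d => // q /andP[rq qd] qt.
have qab : a <= q <= b by apply/andP; split; lra.
have qr : `|q - r| = q - r by rewrite ger0_norm//; lra.
have := hd q (abI q qab); rewrite qr ltrBlDl => /(_ qd).
have := nrm_ge_sub (f q - f r) ((q - r)%:C *: g r); rewrite nrmZ nrm_real qr.
have qr0 : 0 <= q - r by lra.
have := ler_wpM2l qr0 (gC r rab); lra.
Qed.

Lemma C1_lipschitz f g a b : derivative_on I f g -> {within I, continuous g} ->
  a <= b -> (forall t, a <= t <= b -> I t) ->
  exists2 L, 0 <= L & lipschitz_itv a b L f.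
Proof.
move=> fg gc ab abI; have [C C0 hC] := continuous_bounded gc ab abI.
by exists C => //; apply: derivative_lipschitz fg abI _ _.
Qed.

Lemma derivative_continuous f g : derivative_on I f g -> {within I, continuous f}.
Proof.
move=> fg; apply/subspace_continuousP => t It; apply/cvg_nrm => e e0.
have [d d0 hd] := derivative_onP fg It ltr01.
have g0 := nrm_ge0 (g t).
have dd : 0 < Num.min d (e / (nrm (g t) + 1)) by rewrite lt_min d0 divr_gt0//; lra.
apply/nbhs_ballP; exists (Num.min d (e / (nrm (g t) + 1))) => // s.
rewrite /ball /= distrC lt_min ltr_pdivlMr; last lra.
move=> /andP[sd se] Is; have := hd s Is sd.
by have := nrm_ge_sub (f s - f t) ((s - t)%:C *: g t); rewrite nrmZ nrm_real; lra.
Qed.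

End DerivativeOn.

Lemma bounded_linear_continuous (R : realType) (V W : normedModType R[i])
    (phi : {linear V -> W}) (C : R) :
  (forall x, nrm (phi x) <= C * nrm x) -> continuous phi.
Proof.
move=> phiC x; apply/cvg_nrm => e e0.
have C0 : 0 < `|C| + 1 by rewrite ltr_wpDl.
have ec : 0 < e / (`|C| + 1) by rewrite divr_gt0.
have : x @[x --> x] --> x by [].
move=> /cvg_nrm/(_ _ ec); apply: filterS => y /=.
rewrite ltr_pdivlMr// mulrC => h; rewrite -linearB (le_lt_trans (phiC _))//.
apply: le_lt_trans h; rewrite ler_wpM2r ?nrm_ge0// (le_trans (ler_norm _))//.
by rewrite lerDl.
Qed.

(** Each functional is bounded on the difference quotients of [f] over the compact interval, so the
    set of these quotients is bounded in norm. *)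
Lemma weakly_C1_lipschitz (R : realType) (V : normedModType R[i]) (I : set R)
    (f : R -> V) (a b : R) :
  (forall phi : {linear V -> R[i]^o}, continuous phi ->
     C_on 1 I (fun t => phi (f t))) ->
  a <= b -> (forall t, a <= t <= b -> I t) ->
  exists2 L, 0 <= L & lipschitz_itv a b L f.
Proof.
move=> fC1 ab abI.
have [phi [C hC]|M hM] := @weakly_bounded _ V
  [set x | exists s t, [/\ a <= s <= b, a <= t <= b, s != t &
    x = (s - t)^-1%:C *: (f s - f t)]].
  have [g [fg gc]] := fC1 phi (bounded_linear_continuous hC).
  have [L L0 hL] := C1_lipschitz fg gc ab abI.
  exists L => _ [s [t [sab tab st ->]]].
  have st0 : 0 < `|s - t| by rewrite normr_gt0 subr_eq0.
  rewrite linearZ linearB [nrm _]nrmM nrm_real normfV mulrC ler_pdivrMr//.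
  exact: hL.
exists `|M| => // s t sab tab; have [->|st] := eqVneq s t.
  by rewrite !subrr nrm0 normr0 mulr0.
have st0 : 0 < `|s - t| by rewrite normr_gt0 subr_eq0.
have : nrm ((s - t)^-1%:C *: (f s - f t)) <= M by apply: hM; exists s, t.
rewrite nrmZ nrm_real normfV mulrC ler_pdivrMr// => /le_trans; apply.
by rewrite ler_wpM2r ?ler_norm.
Qed.

(** Orbits are continuous, hence bounded on [[0, a]], and uniform boundedness applies. The resulting
    constant turns estimates at multiples of [2 * pi] into estimates at all times. *)
Lemma semigroup_locally_bounded (R : realType) (X : completeNormedModType R[i])
    (T : R -> X -> X) (a : R) : C0_semigroup T -> 0 <= a ->
  exists2 M, 0 <= M & forall t x, 0 <= t <= a -> nrm (T t x) <= M * nrm x.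
Proof.
move=> sT a0.
have [||x|M hM] := @uniform_boundedness R X X {t : R | 0 <= t <= a}
    (fun t => T (sval t)).
- by move=> [t /= /andP[t0 _]]; exact: semigroup_linear.
- move=> [t /= /andP[t0 _]]; have [M _ hM] := semigroup_bound sT t0.
  by exists M.
- have [|||C C0 hC] := @continuous_bounded _ _ [set t | 0 <= t] (T^~ x) 0 a.
  + by apply/subspace_continuousP => t t0; exact: semigroup_continuous.
  + by [].
  + by move=> t /andP[].
  by exists C => -[t /= /hC].
exists `|M| => // t x t0a; have := hM (exist _ t t0a) x => /le_trans; apply.
by rewrite ler_wpM2r ?nrm_ge0 ?ler_norm.
Qed.

(** * Dyadic blocks of frequencies and Bessel's inequality *)

Section DyadicBlocks.
Variable R : realType.

(** One shift length, [2^-(j+2)], serves all frequencies of block [j]. Frequency 0 is also put in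
    block 0, although no shift detects it; hence the hypotheses [k != 0]. *)
Definition block (k : int) : nat := trunc_log 2 `|k|.

Lemma blockP k : k != 0 -> (2 ^ block k <= `|k| < 2 ^ (block k).+1)%N.
Proof. by move=> k0; rewrite trunc_logP ?trunc_log_ltn ?absz_gt0. Qed.

Lemma sum_subset (J : eqType) (l l' : seq J) (w : J -> R) :
  uniq l -> uniq l' -> {subset l <= l'} -> (forall k, 0 <= w k) ->
  \sum_(k <- l) w k <= \sum_(k <- l') w k.
Proof.
move=> ul ul' ll' w0.
have pm : perm_eq l [seq k <- l' | k \in l].
  apply: uniq_perm => //; first exact: filter_uniq.
  by move=> k; rewrite mem_filter andb_idr//; exact: ll'.
by rewrite (perm_big _ pm) big_filter [leRHS](bigID (mem l))/= lerDl sumr_ge0.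
Qed.

(** Block [j] consists of [2^j] integers of weight [3^-j], and the powers of 2/3 sum to 3. Likewise
    the powers of 3/4 give the factor 4 in [sum_block_weighted]. *)
Lemma sum_block_nat (l : seq nat) : uniq l -> 0%N \notin l ->
  \sum_(n <- l) (3^-1 : R) ^+ trunc_log 2 n <= 3.
Proof.
move=> ul l0; pose J := (\sum_(n <- l) n).+1.
have w0 n : 0 <= (3^-1 : R) ^+ n by rewrite exprn_ge0//; lra.
apply: (@le_trans _ _ (\sum_(1 <= n < 2 ^ J) (3^-1 : R) ^+ trunc_log 2 n)).
  apply: sum_subset; rewrite ?iota_uniq// => n nl.
  rewrite mem_index_iota lt0n; apply/andP; split.
    by apply: contra l0 => /eqP <-.
  apply: ltn_trans (ltn_expl J _) => //; rewrite ltnS (big_rem n)//=.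
  exact: leq_addr.
suff : \sum_(1 <= n < 2 ^ J) (3^-1 : R) ^+ trunc_log 2 n <= 3 - 3 * (2 / 3) ^+ J.
  have : 0 <= (2 / 3 : R) ^+ J by rewrite exprn_ge0//; lra.
  lra.
elim: J => [|J IH]; first by rewrite expn0 big_geq// expr0; lra.
rewrite (@big_cat_nat _ _ _ (2 ^ J))/= ?expn_gt0 ?leq_exp2l//.
have -> : \sum_(2 ^ J <= n < 2 ^ J.+1) (3^-1 : R) ^+ trunc_log 2 n = (2 / 3) ^+ J.
  rewrite (eq_big_nat _ _ (F2 := fun=> (3^-1) ^+ J)).
    rewrite big_const_nat iter_addr addr0 expnS mul2n -addnn addnK.
    by rewrite -[LHS]mulr_natl natrX -exprMn.
  by move=> n n12; congr (_ ^+ _); apply: trunc_log_eq.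
by rewrite exprS; lra.
Qed.

Lemma sum_block (l : seq int) : uniq l -> 0 \notin l ->
  \sum_(k <- l) (3^-1 : R) ^+ block k <= 6.
Proof.
move=> ul l0; rewrite (bigID (fun k : int => 0 < k))/= -!(big_filter l).
have h (P : pred int) : {in [seq k <- l | P k] &, injective absz} ->
    \sum_(k <- [seq k <- l | P k]) (3^-1 : R) ^+ block k <= 3.
  move=> absI; rewrite -(big_map absz xpredT (fun n => (3^-1 : R) ^+ trunc_log 2 n)).
  apply: sum_block_nat; first by rewrite map_inj_in_uniq// filter_uniq.
  apply/negP => /mapP[k]; rewrite mem_filter => /andP[_ kl] /esym/eqP.
  by rewrite absz_eq0 => /eqP k0; move: l0; rewrite -k0 kl.
have -> : 6 = 3 + 3 :> R by lra.
by apply: lerD; apply: h => -[] n [] m; rewrite !mem_filter /=; lia.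
Qed.

Lemma sum_block_weighted (l : seq int) (a : int -> R) (D : R) : 0 <= D ->
  (forall j, \sum_(k <- l | block k == j) a k <= D * 4^-1 ^+ j) ->
  \sum_(k <- l) 3 ^+ block k * a k <= 4 * D.
Proof.
move=> D0 aD; pose J := (\sum_(k <- l) block k).+1.
have -> : \sum_(k <- l) 3 ^+ block k * a k =
    \sum_(k <- l | (block k < J)%N) 3 ^+ block k * a k.
  rewrite big_seq [RHS]big_seq_cond; apply: eq_bigl => k.
  case: (boolP (k \in l)) => //= kl; apply/esym.
  by rewrite ltnS (big_rem k)//= leq_addr.
suff : \sum_(k <- l | (block k < J)%N) 3 ^+ block k * a k <=
    D * (4 - 4 * (3 / 4) ^+ J).
  have : 0 <= D * (3 / 4 : R) ^+ J by rewrite mulr_ge0// exprn_ge0//; lra.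
  lra.
elim: J => [|J IH].
  by rewrite big_pred0 ?expr0//; first by rewrite mulr1 subrr mulr0.
rewrite (bigID (fun k => block k == J))/=.
rewrite (eq_bigl (fun k => block k == J)); last first.
  by move=> k; case: eqP => [->|]; rewrite ?ltnSn ?andbF.
rewrite [X in _ + X](eq_bigl (fun k => block k < J)%N); last first.
  by move=> k; rewrite ltnS; lia.
have -> : \sum_(k <- l | block k == J) 3 ^+ block k * a k =
    3 ^+ J * \sum_(k <- l | block k == J) a k.
  by rewrite mulr_sumr; apply: eq_bigr => k /eqP ->.
have e : 3 ^+ J * (D * 4^-1 ^+ J) = D * (3 / 4) ^+ J.
  by rewrite exprMn; ring.
have p3 : 0 <= (3 : R) ^+ J by rewrite exprn_ge0.
have := ler_wpM2l p3 (aD J); rewrite e exprS; lra.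
Qed.

End DyadicBlocks.

(** The sum of the squared moduli of [x m - P m] is nonnegative, where [P] is the projection of [x]
    on the conjugates of the [e k]. The two cross sums and the square sum of [P] are all equal to
    [n] times the sum of the squared moduli of the coefficients [S k]. *)
Lemma bessel (R : realType) (J : eqType) (l : seq J) (n : nat) (e : J -> nat -> R[i])
    (x : nat -> R[i]) : (0 < n)%N -> uniq l ->
  (forall k k', k \in l -> k' \in l ->
     \sum_(0 <= m < n) Num.conj (e k m) * e k' m = (n * (k == k'))%:R) ->
  \sum_(k <- l) nrm (n%:R^-1 * \sum_(0 <= m < n) e k m * x m) ^+ 2 <=
  n%:R^-1 * \sum_(0 <= m < n) nrm (x m) ^+ 2.
Proof.
move=> n0 ul orth.
have nn : (n%:R : R[i]) != 0 by rewrite pnatr_eq0 -lt0n.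
pose S k := n%:R^-1 * \sum_(0 <= m < n) e k m * x m.
pose P m := \sum_(k <- l) S k * Num.conj (e k m).
have SE k : \sum_(0 <= m < n) e k m * x m = n%:R * S k by rewrite mulVKf.
have xP : \sum_(0 <= m < n) x m * Num.conj (P m) =
    n%:R * \sum_(k <- l) S k * Num.conj (S k).
  under eq_bigr do rewrite rmorph_sum mulr_sumr.
  rewrite exchange_big mulr_sumr /=; apply: eq_bigr => k _.
  rewrite mulrA -SE mulr_suml; apply: eq_bigr => m _.
  by rewrite rmorphM /= conjCK; ring.
have PP : \sum_(0 <= m < n) P m * Num.conj (P m) =
    n%:R * \sum_(k <- l) S k * Num.conj (S k).
  under eq_bigr do rewrite {1}/P mulr_suml.
  rewrite exchange_big mulr_sumr /=; apply: eq_big_seq => k kl.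
  transitivity (\sum_(k' <- l) S k * Num.conj (S k') *
      \sum_(0 <= m < n) Num.conj (e k m) * e k' m).
    under [RHS]eq_bigr do rewrite mulr_sumr.
    rewrite exchange_big /=; apply: eq_bigr => m _.
    rewrite rmorph_sum mulr_sumr; apply: eq_bigr => k' _.
    by rewrite rmorphM /= conjCK; ring.
  rewrite (big_rem k)//= orth// eqxx muln1 big_seq big1; first by ring.
  move=> k' k'l; rewrite orth//; last exact: mem_rem k'l.
  have kk' : (k == k') = false.
    by apply/eqP => kk'; move: k'l; rewrite kk' mem_rem_uniqF.
  by rewrite kk' muln0 mulr0.
have Px : \sum_(0 <= m < n) P m * Num.conj (x m) =
    n%:R * \sum_(k <- l) S k * Num.conj (S k).
  rewrite -[LHS]conjCK rmorph_sum.
  under eq_bigr do rewrite rmorphM /= conjCK mulrC.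
  rewrite xP rmorphM rmorph_nat rmorph_sum /=; congr (_ * _).
  by apply: eq_bigr => k _; rewrite rmorphM /= conjCK mulrC.
have nz z : (nrm z ^+ 2)%:C = z * Num.conj z :> R[i].
  by rewrite rmorphXn /= -nrmE normCK.
have key : n%:R * \sum_(k <- l) S k * Num.conj (S k) <=
    \sum_(0 <= m < n) x m * Num.conj (x m).
  have : 0 <= \sum_(0 <= m < n) (x m - P m) * Num.conj (x m - P m).
    by apply: sumr_ge0 => m _; rewrite -normCK exprn_ge0.
  rewrite (eq_bigr (fun m => x m * Num.conj (x m) - x m * Num.conj (P m)
    - P m * Num.conj (x m) + P m * Num.conj (P m))); last first.
    by move=> m _; rewrite rmorphB /=; ring.
  by rewrite big_split !sumrB /= xP Px PP subrK subr_ge0.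
rewrite mulrC ler_pdivlMr ?ltr0n// -lecR rmorphM rmorph_nat !rmorph_sum /= mulrC.
under eq_bigr do rewrite nz.
by under [leRHS]eq_bigr do rewrite nz.
Qed.

(** * Characters and dyadic grids *)

Section Character.
Variable R : realType.
Implicit Types (k : int) (t : R).

Definition char k t : R[i] := expi (2 * pi * (k%:~R * t)).

Lemma charD k t u : char k (t + u) = char k t * char k u.
Proof. by rewrite /char -expiD -!mulrDr. Qed.

Lemma charDl k k' t : char (k + k') t = char k t * char k' t.
Proof. by rewrite /char -expiD -mulrDr -mulrDl -rmorphD. Qed.

Lemma nrm_char k t : nrm (char k t) = 1.
Proof. exact: nrm_expi. Qed.

Lemma char_conj k t : Num.conj (char k t) = char (- k) t.
Proof. by rewrite /char expi_conj rmorphN /= mulNr mulrN. Qed.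

Lemma char_int k (m : int) : char k m%:~R = 1.
Proof. by rewrite /char -rmorphM expi_2pi_int. Qed.

Lemma char_pow k t n : char k (n%:R * t) = char k t ^+ n.
Proof. by rewrite /char -expiMn; congr expi; ring. Qed.

Lemma char_lip k t u : nrm (char k t - char k u) <= 4 * pi * `|k%:~R| * `|t - u|.
Proof.
rewrite (le_trans (expi_lip _ _))// -!mulrBr !normrM.
rewrite (gtr0_norm (pi_gt0 R)) (ger0_norm (ler0n _ 2)).
by rewrite le_eqVlt; apply/orP; left; apply/eqP; ring.
Qed.

Lemma nrm_1Bexpi t : nrm (expi t - 1) ^+ 2 = 2 - 2 * cos t.
Proof.
rewrite nrm_sqr /= subr0; have := cos2Dsin2 t; lra.
Qed.

Lemma expi_neq1 t : 0 < t < 2 * pi -> expi t != 1.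
Proof.
move=> /andP[t0 tpi]; apply/eqP => t1.
have : cos t = 1 by rewrite -[cos t]/(complex.Re (expi t)) t1.
have s0 : 0 < sin (t / 2) by apply: sin_gt0_pi; apply/andP; split; lra.
have -> : t = (t / 2) *+ 2 by rewrite mulr2n; lra.
rewrite cos_mulr2n => h; have : sin (t / 2) ^+ 2 = 0.
  by have := cos2Dsin2 (t / 2); lra.
by move/eqP; rewrite sqrf_eq0 gt_eqF.
Qed.

Lemma char_root_neq1 k (n : nat) : k != 0 -> (`|k| < n)%N -> char k n%:R^-1 != 1.
Proof.
move=> k0 kn.
have n0 : 0 < n%:R :> R by rewrite ltr0n; lia.
wlog kp : k k0 kn / 0 < k.
  move=> h; have [kp|kle] := ltP 0 k; first exact: h.
  have := h (- k); rewrite oppr_eq0 abszN oppr_gt0 lt_neqAle k0 kle.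
  move=> /(_ isT kn isT); apply: contra => /eqP.
  by rewrite -char_conj => ->; rewrite rmorph1.
apply: expi_neq1; have p0 := pi_gt0 R.
have k1 : 0 < k%:~R :> R by rewrite ltr0z.
rewrite mulr_gt0 ?mulr_gt0 ?invr_gt0//=.
rewrite -[ltRHS]mulr1 ltr_pM2l ?mulr_gt0// ltr_pdivrMr// mul1r.
by rewrite -[k]gtz0_abs// -pmulrn ltr_nat.
Qed.

(* [2 ^ block k <= |k|] makes [k h] an angle of at least a quarter turn. *)
Lemma char_block k : k != 0 ->
  2 <= nrm (char k (- (2^-1) ^+ (block k + 2)) - 1) ^+ 2.
Proof.
move=> k0; rewrite nrm_1Bexpi mulrN mulrN cosN.
set h := _ ^+ _.
have h0 : 0 < h by rewrite exprn_gt0.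
have p0 := pi_gt0 R.
suff c0 (x : R) : 4^-1 <= x <= 2^-1 -> cos (2 * pi * x) <= 0.
  have -> : cos (2 * pi * (k%:~R * h)) = cos (2 * pi * (`|k|%:R * h)).
    case: k k0 @h h0 => n k0 h h0; first by rewrite -pmulrn.
    by rewrite NegzE mulrNz mulNr mulrN cosN -pmulrn abszN.
  suff /c0 : 4^-1 <= `|k|%:R * h <= 2^-1 by lra.
  have /andP[k1 k2] := blockP k0.
  have hp : h * 2 ^+ block k * 4 = 1.
    rewrite /h exprD [X in X * 4]mulrAC -exprMn mulVf// expr1n; lra.
  have : (2 : R) ^+ block k <= `|k|%:R by rewrite -natrX ler_nat.
  have : `|k|%:R <= (2 : R) ^+ (block k).+1 by rewrite -natrX ler_nat ltnW.
  move=> /(ler_wpM2r (ltW h0)) a /(ler_wpM2r (ltW h0)) b; move: a b.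
  by rewrite exprS => a b; apply/andP; split; lra.
move=> /andP[x1 x2].
have -> : 2 * pi * x = (2 * pi * x - pi / 2) + pi / 2 by lra.
have q1 := ler_wpM2l (ltW p0) x1; have q2 := ler_wpM2l (ltW p0) x2.
rewrite cosDpihalf oppr_le0; apply: sin_ge0_pi; apply/andP; split; lra.
Qed.

(** Dyadic meshes refine by doubling, and a shift by [2^-(j+2)] is a whole number of mesh steps as
    soon as [j + 2 <= N]. *)
Definition grid (c : R) N m := c + m%:R / (2 ^ N)%N%:R.

(** There is no aliasing: [|k' - k| < 2^N], so for distinct frequencies [char (k' - k)] at [2^-N] is
    a root of unity other than 1, whose powers sum to 0. *)
Lemma grid_orth c N k k' : (`|k| * 2 < 2 ^ N)%N -> (`|k'| * 2 < 2 ^ N)%N ->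
  \sum_(0 <= m < 2 ^ N) Num.conj (char k (grid c N m)) * char k' (grid c N m)
    = (2 ^ N * (k == k'))%:R.
Proof.
move=> kN k'N.
have e m : Num.conj (char k (grid c N m)) * char k' (grid c N m) =
    char (k' - k) c * char (k' - k) (2 ^ N)%N%:R^-1 ^+ m.
  by rewrite char_conj -charDl addrC /grid charD char_pow.
under eq_bigr do rewrite e.
rewrite -mulr_sumr big_mkord; have [->|kk'] := eqVneq k k'.
  have char0 t : char 0 t = 1 by rewrite /char mul0r mulr0 expi0.
  rewrite subrr !char0 mul1r muln1 (eq_bigr (fun=> 1)).
    by rewrite sumr_const card_ord.
  by move=> i _; rewrite expr1n.
rewrite muln0; set z := char _ _^-1.
have z1 : z != 1 by apply: char_root_neq1; rewrite ?subr_eq0 1?eq_sym//; lia.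
have : z ^+ (2 ^ N) - 1 = 0.
  rewrite -char_pow divff ?pnatr_eq0 -?lt0n ?expn_gt0//.
  by rewrite (char_int _ 1) subrr.
rewrite subrX1 => /eqP; rewrite mulf_eq0 subr_eq0 (negbTE z1) /= => /eqP ->.
by rewrite mulr0.
Qed.

End Character.

Lemma nrm_natV (R : realType) (n : nat) : nrm (n%:R^-1 : R[i]) = n%:R^-1.
Proof.
by rewrite -(rmorph_nat (@real_complex R)) -fmorphV nrm_real ger0_norm ?invr_ge0.
Qed.

(** * Riemann sums of Fourier integrals *)

Section RiemannSums.
Variables (R : realType) (c : R) (V : normedModType R[i]).
Implicit Types (g F : R -> V) (k : int).

Definition mean g N : V :=
  (2 ^ N)%N%:R^-1 *: \sum_(0 <= m < 2 ^ N) g (grid c N m).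

(** With this sign in the exponent, multiplying [F] by [char 1] raises the frequency by one, which
    is the direction of the orbit. *)
Definition fourier F k N := mean (fun t => char k t *: F t) N.

Let pow_neq0 (K : numFieldType) N : (2 ^ N)%N%:R != 0 :> K.
Proof. by rewrite pnatr_eq0 -lt0n expn_gt0. Qed.

Let pow_gt0 N : 0 < (2 ^ N)%N%:R :> R.
Proof. by rewrite ltr0n expn_gt0. Qed.

Lemma nrm_mean g N : nrm (mean g N) <=
  (2 ^ N)%N%:R^-1 * \sum_(0 <= m < 2 ^ N) nrm (g (grid c N m)).
Proof.
by rewrite nrmZ nrm_natV ler_wpM2l ?invr_ge0// nrm_sum.
Qed.

Lemma nrm_mean_le g N (B : R) : (forall t, nrm (g t) <= B) -> nrm (mean g N) <= B.
Proof.
move=> gB; rewrite (le_trans (nrm_mean _ _))// mulrC ler_pdivrMr//.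
rewrite (le_trans (ler_sum _ (fun m _ => gB (grid c N m))))//.
by rewrite big_const_nat iter_addr addr0 subn0 mulr_natr.
Qed.

Lemma meanB g g' N : mean (fun t => g t - g' t) N = mean g N - mean g' N.
Proof. by rewrite /mean sumrB scalerBr. Qed.

Lemma meanZ (a : R[i]) g N : mean (fun t => a *: g t) N = a *: mean g N.
Proof. by rewrite /mean -scaler_sumr !scalerA mulrC. Qed.

(** The finer grid gives each point a neighbour at distance [2^-(N+1)], and the difference of the
    two means averages the increments of [g] between neighbours. The geometric rate yields
    convergence of the means. *)
Lemma mean_step g (L : R) N : (forall s t, nrm (g s - g t) <= L * `|s - t|) ->
  nrm (mean g N.+1 - mean g N) <= L * 2^-1 ^+ N.
Proof.
move=> gL.
have L0 : 0 <= L.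
  by have := gL 1 0; rewrite subr0 normr1 mulr1; apply: le_trans; exact: nrm_ge0.
pose n := (2 ^ N)%N; have double (x : nat -> V) m :
    \sum_(0 <= i < m * 2) x i = \sum_(0 <= i < m) (x (i * 2)%N + x (i * 2).+1).
  elim: m => [|m IH]; first by rewrite !big_geq.
  by rewrite mulSn !addSn add0n !big_nat_recr//= IH addrA.
pose d : R := (n * 2)%:R^-1.
have e0 m : grid c N.+1 (m * 2) = grid c N m.
  by rewrite /grid expnSr !natrM -mulf_div divff// mulr1.
have e1 m : grid c N.+1 (m * 2).+1 = grid c N m + d.
  by rewrite -e0 /grid -natr1 mulrDl addrA /d expnSr mul1r.
have -> : mean g N.+1 - mean g N =
    (n * 2)%:R^-1 *: \sum_(0 <= m < n) (g (grid c N m + d) - g (grid c N m)).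
  rewrite /mean expnSr -/n double.
  have -> : n%:R^-1 = (n * 2)%:R^-1 * 2 :> R[i].
    by rewrite natrM invfM -mulrA mulVf ?mulr1.
  rewrite -scalerA -scalerBr scaler_sumr -sumrB; congr (_ *: _).
  apply: eq_bigr => m _; rewrite e0 e1 scaler_nat mulr2n opprD addrACA subrr add0r //.
rewrite nrmZ nrm_natV -/d.
have d0 : 0 <= d by rewrite /d invr_ge0.
apply: (@le_trans _ _ (d * (L * d *+ n))).
  rewrite ler_wpM2l// (le_trans (nrm_sum _ _ _))//.
  rewrite (@le_trans _ _ (\sum_(0 <= m < n) L * d))//.
    apply: ler_sum => m _; rewrite (le_trans (gL _ _))// addrAC subrr add0r.
    by rewrite ger0_norm.
  by rewrite big_const_nat iter_addr addr0 subn0.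
have dn : d * n%:R = 2^-1 by rewrite /d natrM invfM mulrAC mulVf ?pow_neq0 ?mul1r.
have -> : d * (L * d *+ n) = L * d * 2^-1 by rewrite -mulr_natr -dn; ring.
have -> : d = 2^-1 ^+ N * 2^-1 by rewrite /d natrM invfM /n natrX exprVn.
rewrite -!mulrA ler_wpM2l// ler_piMr ?exprn_ge0//; lra.
Qed.

Lemma fourier_integrand_lip F k (L B : R) : (forall t, nrm (F t) <= B) ->
  (forall s t, nrm (F s - F t) <= L * `|s - t|) ->
  forall s t, nrm (char k s *: F s - char k t *: F t) <=
    (L + 4 * pi * `|k%:~R| * B) * `|s - t|.
Proof.
move=> FB FL s t.
have -> : char k s *: F s - char k t *: F t =
    char k s *: (F s - F t) + (char k s - char k t) *: F t.
  by rewrite scalerBr scalerBl addrA subrK.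
rewrite (le_trans (nrmD _ _))// !nrmZ nrm_char mul1r mulrDl lerD//.
rewrite mulrAC ler_pM ?nrm_ge0//; exact: char_lip.
Qed.

Lemma grid_ge (c' : R) N m (p : nat) : (p * 2 ^ N <= m)%N -> c' + p%:R <= grid c' N m.
Proof. by move=> mp; rewrite lerD2l ler_pdivlMr// -natrM ler_nat. Qed.

(** The shift is at most a quarter period and a whole number of mesh steps; as [g] vanishes on the
    first quarter and from [c + 1] on, only zero terms enter or leave the sum. *)
Lemma mean_shift g j N : (j + 2 <= N)%N ->
  (forall t, t < c + 4^-1 \/ c + 1 <= t -> g t = 0) ->
  mean (fun t => g (t + 2^-1 ^+ (j + 2))) N = mean g N.
Proof.
move=> jN g0; set h := _ ^+ _; pose n := (2 ^ N)%N; pose p := (2 ^ (N - (j + 2)))%N.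
have np : (p * 2 ^ (j + 2) = n)%N by rewrite -expnD subnK.
have hp : h = p%:R / n%:R.
  rewrite -np natrM invfM mulrA divff ?pow_neq0// mul1r /h exprVn natrX //.
have p4 : (p * 4 <= n)%N.
  by rewrite -np leq_mul2l expnD leq_pmull ?expn_gt0// orbT.
have shift m : grid c N m + h = grid c N (m + p).
  by rewrite /grid hp -/n natrD mulrDl addrA.
rewrite /mean -/n; congr (_ *: _).
under eq_bigr do rewrite shift.
have <- : \sum_(0 <= m < n + p) g (grid c N m) = \sum_(0 <= m < n) g (grid c N m).
  rewrite (big_cat_nat (n := n)) ?leq_addr//= [X in _ + X]big1_seq ?addr0//.
  move=> m /andP[_]; rewrite mem_index_iota => /andP[nm _]; apply: g0; right.
  by have := @grid_ge c N m 1; rewrite mul1n => /(_ nm).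
rewrite [RHS](big_cat_nat (n := p)) ?leq_addl//= [X in X + _]big1_seq ?add0r.
  by have := big_addn 0 (n + p) p xpredT (fun m => g (grid c N m)) (op := +%R) (idx := 0 : V); rewrite add0n addnK.
move=> m /andP[_]; rewrite mem_index_iota => /andP[_ mp]; apply: g0; left.
rewrite /grid ltrD2l ltr_pdivrMr// -/n mulrC ltr_pdivlMr// -natrM.
rewrite ltr_nat; lia.
Qed.

Lemma fourier_shift F k j N : (j + 2 <= N)%N ->
  (forall t, t < c + 4^-1 \/ c + 1 <= t -> F t = 0) ->
  fourier (fun t => F (t + 2^-1 ^+ (j + 2)) - F t) k N =
  (char k (- (2^-1 ^+ (j + 2))) - 1) *: fourier F k N.
Proof.
move=> jN F0; set h := _ ^+ _.
have E : char k (- h) *: fourier F k N = fourier (fun t => F (t + h)) k N.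
  rewrite /fourier -(@mean_shift (fun t => char k t *: F t) _ _ jN); last first.
    by move=> t /F0 ->; rewrite scaler0.
  rewrite -meanZ /mean; congr (_ *: _); apply: eq_bigr => m _.
  by rewrite scalerA -charD -/h (addrC (- h)) addrK.
rewrite scalerBl scale1r E -meanB /fourier /mean; congr (_ *: _).
by apply: eq_bigr => m _; rewrite scalerBr.
Qed.

(** Differencing twice multiplies the coefficient by [(char k (- h) - 1) ^+ 2], of modulus at least
    2, while the second difference is at most [C * h ^+ 2]. Each difference extends the support to
    the left by [h <= 1/4], so [F] has to vanish up to [c + 1/2]. *)
Lemma fourier_second_difference F k (C : R) N : k != 0 -> (block k + 2 <= N)%N ->
  (forall t, t < c + 2^-1 \/ c + 1 <= t -> F t = 0) ->
  (forall t h, 0 < h -> h <= 4^-1 ->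
     nrm (F (t + h + h) - F (t + h) - (F (t + h) - F t)) <= C * h ^+ 2) ->
  nrm (fourier F k N) <= C * 4^-1 ^+ block k.
Proof.
move=> k0 kN F0 FC; pose h : R := 2^-1 ^+ (block k + 2).
have h0 : 0 < h by rewrite exprn_gt0.
have h4 : h <= 4^-1.
  rewrite /h exprD -[leRHS]mul1r (_ : 2^-1 ^+ 2 = 4^-1); last by field.
  by rewrite ler_wpM2r ?exprn_ile1//; lra.
have hh : h ^+ 2 = 4^-1 ^+ block k / 16.
  by rewrite /h -exprM mulnDl exprD mulnC exprM; congr (_ ^+ _ * _); field.
pose G t := F (t + h) - F t.
have G0 t : t < c + 4^-1 \/ c + 1 <= t -> G t = 0.
  by move=> ht; rewrite /G !F0 ?subrr//; lra.
have F0' t : t < c + 4^-1 \/ c + 1 <= t -> F t = 0.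
  by move=> ht; rewrite F0//; lra.
have E : fourier (fun t => G (t + h) - G t) k N =
    (char k (- h) - 1) ^+ 2 *: fourier F k N.
  by rewrite fourier_shift// /G fourier_shift// scalerA -expr2.
have : nrm (fourier (fun t => G (t + h) - G t) k N) <= C * h ^+ 2.
  by apply: nrm_mean_le => t; rewrite nrmZ nrm_char mul1r FC.
rewrite E nrmZ expr2 nrmM -expr2 hh.
have := ler_wpM2r (nrm_ge0 (fourier F k N)) (char_block R k0).
have : 0 <= 4^-1 ^+ block k :> R by rewrite exprn_ge0.
have C0 : 0 <= C.
  have := FC 0 4^-1 _ (lexx _); rewrite invr_gt0 => /(_ (ltr0n _ 4)).
  by move=> /(le_trans (nrm_ge0 _)); rewrite pmulr_lge0// exprn_gt0// invr_gt0.
move=> q0; have : 0 <= C * 4^-1 ^+ block k by rewrite mulr_ge0.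
by rewrite -/h; lra.
Qed.

End RiemannSums.

(** * Bernstein's bound for Lipschitz functions *)

Section Bernstein.
Variables (R : realType) (c : R).

(** The bound must not depend on [l], but the level [N0] may: it prevents aliasing among the
    frequencies of [l]. On block [j], Bessel's inequality for increments of step [2^-(j+2)] bounds
    the sum of squares by [L^2 4^-j]. The weighted sums are then at most [4 L^2] and 6, and half
    their total is the bound. *)
Lemma fourier_bernstein (g : R -> R[i]^o) (L : R) (l : seq int) :
  uniq l -> 0 \notin l -> 0 <= L ->
  (forall t, t < c + 4^-1 \/ c + 1 <= t -> g t = 0) ->
  (forall s t, nrm (g s - g t) <= L * `|s - t|) ->
  exists N0, forall N, (N0 <= N)%N ->
    \sum_(k <- l) nrm (fourier c g k N) <= 2 * L ^+ 2 + 3.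
Proof.
move=> ul l0 L0 g0 gL; pose N0 := (\sum_(k <- l) `|k| * 4)%N.
exists N0 => N NN.
have lk k : k \in l -> (`|k| * 4 < 2 ^ N)%N.
  move=> kl; apply: leq_ltn_trans (ltn_expl N _) => //; apply: leq_trans NN.
  by rewrite /N0 (big_rem k)//= leq_addr.
have ln0 k : k \in l -> k != 0 by apply: contraTneq => ->.
have lb k : k \in l -> (block k + 2 <= N)%N.
  move=> kl; have /andP[kb _] := blockP (ln0 _ kl).
  rewrite ltnW// -(ltn_exp2l _ _ (ltnSn 1)) expnD.
  by apply: leq_ltn_trans (lk k kl); rewrite leq_mul2r kb orbT.
have L20 : 0 <= L ^+ 2 by rewrite sqr_ge0.
have key j : \sum_(k <- l | block k == j) nrm (fourier c g k N) ^+ 2 <=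
    L ^+ 2 * 4^-1 ^+ j.
  pose lj := [seq k <- l | block k == j].
  have [|nlj] := eqVneq lj [::].
    by rewrite -big_filter -/lj => ->; rewrite big_nil mulr_ge0// exprn_ge0.
  have jN : (j + 2 <= N)%N.
    move: nlj; case E : lj => [//|k s] _.
    have : k \in lj by rewrite E mem_head.
    by rewrite mem_filter => /andP[/eqP <- /lb].
  pose h : R := 2^-1 ^+ (j + 2); have h0 : 0 <= h by rewrite exprn_ge0.
  pose x m := g (grid c N m + h) - g (grid c N m).
  have orth k k' : k \in lj -> k' \in lj ->
      \sum_(0 <= m < 2 ^ N) Num.conj (char k (grid c N m)) * char k' (grid c N m)
        = (2 ^ N * (k == k'))%:R.
    rewrite !mem_filter => /andP[_ /lk kN] /andP[_ /lk k'N].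
    by apply: grid_orth; lia.
  have n0 : (0 < 2 ^ N)%N by rewrite expn_gt0.
  have xh m : nrm (x m) ^+ 2 <= L ^+ 2 * h ^+ 2.
    rewrite -exprMn ler_pXn2r ?nnegrE ?mulr_ge0 ?nrm_ge0//.
    by rewrite (le_trans (gL _ _))// addrAC subrr add0r ger0_norm.
  have hh : h ^+ 2 = 4^-1 ^+ j / 16.
    by rewrite /h -exprM mulnDl exprD mulnC exprM; congr (_ ^+ _ * _); field.
  have mx : (2 ^ N)%N%:R^-1 * \sum_(0 <= m < 2 ^ N) nrm (x m) ^+ 2 <= L ^+ 2 * h ^+ 2.
    rewrite mulrC ler_pdivrMr ?ltr0n ?expn_gt0//.
    rewrite (le_trans (ler_sum _ (fun m _ => xh m)))//.
    by rewrite big_const_nat iter_addr addr0 subn0 mulr_natr.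
  have := le_trans (bessel x n0 (filter_uniq _ ul) orth) mx; rewrite hh => le1.
  have : \sum_(k <- lj) 2 * nrm (fourier c g k N) ^+ 2 <= L ^+ 2 * (4^-1 ^+ j / 16).
    apply: le_trans le1; rewrite big_seq_cond [leRHS]big_seq_cond.
    apply: ler_sum => k /andP[]; rewrite mem_filter => /andP[/eqP kj kl] _.
    rewrite -[leRHS]/(nrm (fourier c (fun t => g (t + h) - g t) k N) ^+ 2).
    rewrite fourier_shift// [in leRHS]nrmZ exprMn ler_wpM2r ?sqr_ge0//.
    by have := char_block R (ln0 _ kl); rewrite kj.
  rewrite -mulr_sumr big_filter.
  have : 0 <= L ^+ 2 * 4^-1 ^+ j by rewrite mulr_ge0// exprn_ge0.
  lra.
have := sum_block_weighted L20 key; have := sum_block R ul l0.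
suff : 2 * \sum_(k <- l) nrm (fourier c g k N) <=
    \sum_(k <- l) 3 ^+ block k * nrm (fourier c g k N) ^+ 2 +
    \sum_(k <- l) 3^-1 ^+ block k by lra.
(* AM-GM, with weights between the growth 2^j of the blocks and the decay 4^-j
   of the sums of squares over them. *)
rewrite mulr_sumr -big_split; apply: ler_sum => k _ /=.
set w := 3 ^+ _; set s := nrm _; rewrite exprVn -/w.
have w0 : 0 < w by rewrite exprn_gt0.
have : 0 <= w^-1 * (w * s - 1) ^+ 2 by rewrite mulr_ge0 ?sqr_ge0// invr_ge0 ltW.
rewrite (_ : w^-1 * _ = w * s ^+ 2 + w^-1 - 2 * s); first by lra.
by field; rewrite gt_eqF.
Qed.

End Bernstein.

(** * The quartic window and its second differences *)

Lemma lipschitz_itv_scale (R : realType) (V : normedModType R[i]) (p : R -> R)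
    (f : R -> V) (a b P Lp B L : R) :
  (forall t, a <= t <= b -> `|p t| <= P) ->
  (forall s t, a <= s <= b -> a <= t <= b -> `|p s - p t| <= Lp * `|s - t|) ->
  (forall t, a <= t <= b -> nrm (f t) <= B) -> lipschitz_itv a b L f ->
  lipschitz_itv a b (P * L + Lp * B) (fun t => (p t)%:C *: f t).
Proof.
move=> pP pL fB fL s t sab tab.
have -> : (p s)%:C *: f s - (p t)%:C *: f t =
    (p s)%:C *: (f s - f t) + (p s - p t)%:C *: f t.
  by rewrite scalerBr rmorphB /= scalerBl addrA subrK.
rewrite (le_trans (nrmD _ _))// !nrmZ !nrm_real mulrDl lerD//.
  by rewrite -mulrA ler_pM ?nrm_ge0 ?pP ?fL.
by rewrite mulrAC ler_pM ?nrm_ge0 ?pL ?fB.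
Qed.

Section Window.
Variables (R : realType) (a b : R).
Hypothesis ab : a < b.
Hypothesis ab4 : b - a <= 4^-1.

(** Composition with the projection onto [[a, b]] extends functions to the whole line without
    evaluating [f] outside the interval where it is controlled. *)
Definition clamp t := Num.max a (Num.min b t).

Lemma clamp_in t : a <= clamp t <= b.
Proof.
by rewrite /clamp le_max lexx /= ge_max (ltW ab) ge_min lexx.
Qed.

Lemma clamp_id t : a <= t <= b -> clamp t = t.
Proof. by rewrite /clamp => /andP[at_ tb]; rewrite min_r// max_r. Qed.

Lemma clamp_lo t : t <= a -> clamp t = a.
Proof. by move=> ta; rewrite /clamp max_l// ge_min ta orbT. Qed.

Lemma clamp_hi t : b <= t -> clamp t = b.
Proof. by move=> bt; rewrite /clamp min_l// max_r// ltW. Qed.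

Lemma clamp_lip s t : `|clamp s - clamp t| <= `|s - t|.
Proof.
wlog st : s t / s <= t.
  move=> h; have [/h//|/ltW/h] := leP s t.
  by rewrite distrC [leRHS]distrC.
rewrite distrC [leRHS]distrC [leRHS]ger0_norm ?subr_ge0// ler_norml.
have cP u : [\/ u <= a /\ clamp u = a, [/\ a <= u, u <= b & clamp u = u] |
    b <= u /\ clamp u = b].
  have [ua|au] := leP u a; first by apply: Or31; rewrite clamp_lo.
  have [ub|bu] := leP u b; first by apply: Or32; rewrite clamp_id// ?ub ltW.
  by apply: Or33; rewrite clamp_hi (ltW bu).
case: (cP s) => [[s1 ->]|[s1 s2 ->]|[s1 ->]];
  case: (cP t) => [[t1 ->]|[t1 t2 ->]|[t1 ->]]; apply/andP; split;
  move: ab; lra.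
Qed.

(** The simplest bump with double zeros at both ends: extended by 0 it has a Lipschitz derivative,
    which is the smoothness needed for second differences of order [h^2]. *)
Definition quartic t : R := ((t - a) * (b - t)) ^+ 2.

Definition quartic' t : R := 2 * ((t - a) * (b - t)) * (a + b - 2 * t).

Lemma quartic_ge0 t : 0 <= quartic t. Proof. exact: sqr_ge0. Qed.

Let factor t : a <= t <= b -> 0 <= (t - a) * (b - t) <= 1.
Proof. by move=> /andP[at_ tb]; apply/andP; split; move: ab ab4; nra. Qed.

Let factor_lip s t : a <= s <= b -> a <= t <= b ->
  `|(s - a) * (b - s) - (t - a) * (b - t)| <= `|s - t|.
Proof.
move=> /andP[as_ sb] /andP[at_ tb].
have -> : (s - a) * (b - s) - (t - a) * (b - t) = (s - t) * (a + b - s - t) by ring.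
by rewrite normrM ler_piMr// ler_norml; apply/andP; split; move: ab ab4; lra.
Qed.

Lemma quartic_le1 t : a <= t <= b -> `|quartic t| <= 1.
Proof.
by move=> /factor/andP[r0 r1]; rewrite ger0_norm ?quartic_ge0// /quartic expr_le1.
Qed.

Lemma quartic_lip s t : a <= s <= b -> a <= t <= b -> `|quartic s - quartic t| <= 2 * `|s - t|.
Proof.
move=> hs ht; have := factor_lip hs ht; rewrite /quartic.
have /andP[] := factor hs; have /andP[] := factor ht.
set x := (s - a) * _; set y := (t - a) * _ => y0 y1 x0 x1 xy.
rewrite subr_sqr normrM mulrC ler_pM// ger0_norm; move: ab ab4; lra.
Qed.

Lemma quartic'_le2 t : a <= t <= b -> `|quartic' t| <= 2.
Proof.
move=> ht; have /andP[r0 r1] := factor ht; have /andP[at_ tb] := ht.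
rewrite /quartic' normrM -[leRHS]mulr1 ler_pM//.
  by rewrite normrM ger0_norm// ger0_norm//; move: ab ab4; lra.
by rewrite ler_norml; apply/andP; split; move: ab ab4; lra.
Qed.

Lemma quartic'_lip s t : a <= s <= b -> a <= t <= b ->
  `|quartic' s - quartic' t| <= 6 * `|s - t|.
Proof.
move=> hs ht; have := factor_lip hs ht; rewrite /quartic'.
have /andP[] := factor hs; have /andP[] := factor ht.
have /andP[at_ tb] := ht.
set x := (s - a) * _; set y := (t - a) * _ => y0 y1 x0 x1 xy.
have -> : 2 * x * (a + b - 2 * s) - 2 * y * (a + b - 2 * t) =
  2 * ((x - y) * (a + b - 2 * t)) - 4 * (x * (s - t)) by ring.
clearbody x y; rewrite (le_trans (ler_normB _ _))// !normrM !(ger0_norm (ler0n _ _)) (ger0_norm x0).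
have h1 : `|x - y| * `|a + b - 2 * t| <= `|s - t| * 1.
  by rewrite ler_pM// ler_norml; apply/andP; split; move: ab ab4; lra.
have h2 : x * `|s - t| <= 1 * `|s - t| by rewrite ler_wpM2r.
move: ab ab4; lra.
Qed.

Lemma quartic_deriv s t : a <= s <= b -> a <= t <= b ->
  `|quartic s - quartic t - (s - t) * quartic' t| <= 6 * `|s - t| ^+ 2.
Proof.
move=> hs ht; have /andP[r0 r1] := factor ht.
have /andP[as_ sb] := hs; have /andP[at_ tb] := ht.
rewrite /quartic /quartic'; set y := (t - a) * (b - t) in r0 r1 *; pose m := a + b - 2 * t.
have -> : ((s - a) * (b - s)) ^+ 2 - y ^+ 2 - (s - t) * (2 * y * (a + b - 2 * t)) =
    (s - t) ^+ 2 * (m ^+ 2 + (s - t) ^+ 2 - 2 * y - 2 * (s - t) * m).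
  by rewrite /y /m; ring.
rewrite normrM normrX mulrC ler_wpM2r ?sqr_ge0// ler_norml /m.
by apply/andP; split; move: ab ab4; nra.
Qed.

Lemma quartic_ends t : t = a \/ t = b -> quartic t = 0 /\ quartic' t = 0.
Proof.
by case=> ->; rewrite /quartic /quartic' !subrr ?mulr0 ?mul0r ?mulr0 ?mul0r ?expr0n.
Qed.

Section Windowed.
Variables (V : normedModType R[i]) (f : R -> V) (L B : R).
Hypothesis fL : lipschitz_itv a b L f.
Hypothesis fB : forall t, a <= t <= b -> nrm (f t) <= B.

Definition windowed t := (quartic (clamp t))%:C *: f (clamp t).

(** The period [[c, c + 1]] is placed so that [a] is its midpoint: the half before [a] absorbs two
    shifts of at most 1/4 each, and [b <= c + 3/4]. *)
Let c := a - 2^-1.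

Lemma windowed_supp t : t < c + 2^-1 \/ c + 1 <= t -> windowed t = 0.
Proof.
move=> ht; rewrite /windowed.
have [|-> _] := @quartic_ends (clamp t); last by rewrite scale0r.
by case: ht => ht; [left; rewrite clamp_lo//|right; rewrite clamp_hi//]; rewrite /c in ht; move: ab ab4; lra.
Qed.

Lemma windowed_lip s t : nrm (windowed s - windowed t) <= (L + 2 * B) * `|s - t|.
Proof.
have LB : 0 <= L + 2 * B.
  have ba : 0 < b - a by rewrite subr_gt0.
  have ia : a <= a <= b by rewrite lexx ltW.
  have ib : a <= b <= b by rewrite lexx ltW.
  have := le_trans (nrm_ge0 _) (fL ib ia); rewrite gtr0_norm// pmulr_lge0// => L0.
  have := le_trans (nrm_ge0 _) (fB ia); move: ab ab4; lra.
have := lipschitz_itv_scale quartic_le1 quartic_lip fB fL (clamp_in s) (clamp_in t).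
by rewrite mul1r => /le_trans; apply; rewrite ler_wpM2l// clamp_lip.
Qed.

Lemma windowed_bound t : nrm (windowed t) <= B.
Proof.
rewrite nrmZ nrm_real; have := fB (clamp_in t); apply: le_trans.
by rewrite ler_piMl ?nrm_ge0// quartic_le1// clamp_in.
Qed.

Section SecondDifference.
Variables (I : set R) (f1 : R -> V) (L1 B1 : R).
Hypothesis abI : forall t, a <= t <= b -> I t.
Hypothesis ff1 : derivative_on I f f1.
Hypothesis f1L : lipschitz_itv a b L1 f1.
Hypothesis f1B : forall t, a <= t <= b -> nrm (f1 t) <= B1.

Let dw t := (quartic' t)%:C *: f t + (quartic t)%:C *: f1 t.

Let dw_lip : lipschitz_itv a b (2 * L + 6 * B + (L1 + 2 * B1)) dw.
Proof.
move=> s t hs ht; rewrite /dw opprD addrACA (le_trans (nrmD _ _))// mulrDl lerD//.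
  exact: (lipschitz_itv_scale quartic'_le2 quartic'_lip fB fL hs ht).
rewrite -[X in _ <= (X + _) * _]mul1r.
exact: (lipschitz_itv_scale quartic_le1 quartic_lip f1B f1L hs ht).
Qed.

Let dw_ends t : t = a \/ t = b -> dw t = 0.
Proof. by move=> /quartic_ends[h h']; rewrite /dw h h' !scale0r addr0. Qed.

(** Outside [[a, b)] the windowed function is 0 immediately to the right and [dw] vanishes at the
    clamped point. Inside, the product rule is split into the first-order errors of [f] and of
    [quartic], and a cross term of second order. *)
Let windowed_derivr t e : 0 < e -> exists2 d, 0 < d & forall s, t < s < t + d ->
  nrm (windowed s - windowed t - (s - t)%:C *: dw (clamp t)) <= e * (s - t).
Proof.
move=> e0; have [ta|ta] := ltP t a.
  exists (a - t); first lra; move=> s /andP[ts sa].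
  rewrite /windowed !clamp_lo; [|move: ab ab4; lra|move: ab ab4; lra].
  have [h _] := @quartic_ends a (or_introl erefl).
  rewrite dw_ends ?h; last by left.
  by rewrite !scale0r scaler0 !subr0 nrm0 mulr_ge0 ?ltW//; move: ab ab4; lra.
have [tb|bt] := ltP t b; last first.
  exists 1 => // s /andP[ts _]; rewrite /windowed !clamp_hi; [|move: ab ab4; lra|move: ab ab4; lra].
  have [h _] := @quartic_ends b (or_intror erefl).
  rewrite dw_ends ?h; last by right.
  by rewrite !scale0r scaler0 !subr0 nrm0 mulr_ge0 ?ltW//; move: ab ab4; lra.
have tab : a <= t <= b by rewrite ta ltW.
have e2 : 0 < e / 2 by lra.
have [d d0 hd] := derivative_onP ff1 (abI tab) e2.
pose K := 6 * B + 2 * B1 + 1.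
have K0 : 0 < K.
  have := le_trans (nrm_ge0 _) (fB tab); have := le_trans (nrm_ge0 _) (f1B tab).
  by rewrite /K; move: ab ab4; lra.
exists (Num.min d (Num.min (b - t) (e / 2 / K))).
  by rewrite !lt_min d0 subr_gt0 tb divr_gt0.
move=> s /andP[ts sd]; have : s - t < Num.min d (Num.min (b - t) (e / 2 / K)) by lra.
rewrite !lt_min ltr_pdivlMr// => /and3P[sd1 sb sK].
have sab : a <= s <= b by apply/andP; split; move: ab ab4; lra.
have st : `|s - t| = s - t by rewrite ger0_norm//; move: ab ab4; lra.
rewrite /windowed !clamp_id// /dw.
have -> : (quartic s)%:C *: f s - (quartic t)%:C *: f t -
    (s - t)%:C *: ((quartic' t)%:C *: f t + (quartic t)%:C *: f1 t) =
    (quartic s)%:C *: (f s - f t - (s - t)%:C *: f1 t) +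
    (quartic s - quartic t - (s - t) * quartic' t)%:C *: f t +
    ((s - t) * (quartic s - quartic t))%:C *: f1 t.
  have lhs (x y z : V) (p q q' r : R[i]) : p *: x - q *: y - r *: (q' *: y + q *: z) =
      p *: x + (- q - r * q') *: y + (- (r * q)) *: z.
    by rewrite scalerDr !scalerA opprD -!scaleNr addrA -(addrA (p *: x)) -scalerDl.
  have rhs (x y z : V) (p l h r : R[i]) : p *: (x - y - r *: z) + l *: y + h *: z =
      p *: x + (- p + l) *: y + (- (p * r) + h) *: z.
    rewrite !scalerBr scalerA -!scaleNr !scalerDl !addrA; congr (_ + _).
    by rewrite addrAC.
  by rewrite lhs rhs; congr (_ + _ *: _ + _ *: _); rewrite !(rmorphB, rmorphM) /=; ring.
rewrite (le_trans (nrmD _ _))//.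
rewrite (le_trans (lerD (nrmD _ _) (lexx _)))// !nrmZ !nrm_real (normrM (s - t)) st.
have := hd s (abI sab); rewrite st => /(_ sd1) h1.
have h2 := ler_pM (normr_ge0 _) (nrm_ge0 _) (quartic_le1 sab) h1.
have h3 := ler_pM (normr_ge0 _) (nrm_ge0 _) (quartic_deriv sab tab) (fB tab).
have h4 := ler_pM (normr_ge0 _) (nrm_ge0 _) (quartic_lip sab tab) (f1B tab).
rewrite st in h3 h4.
have st0 : 0 <= s - t by lra.
have := ler_wpM2l st0 h4; have := ler_wpM2l st0 (ltW sK).
rewrite /K; move: h2 h3; rewrite expr2; have : 0 <= (s - t) * (s - t) by rewrite mulr_ge0.
move: ab ab4; lra.
Qed.

(** The mean value inequality is applied to the increment [G s] over a step [h]: its right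
    derivative is a difference of values of [dw], at most [K * h] because [dw] is Lipschitz and
    [clamp] is a contraction. *)
Lemma windowed_second_difference t h : 0 < h ->
  nrm (windowed (t + h + h) - windowed (t + h) - (windowed (t + h) - windowed t)) <=
  (2 * L + 6 * B + (L1 + 2 * B1)) * h ^+ 2.
Proof.
move=> h0; set K := 2 * L + 6 * B + _.
have K0 : 0 <= K.
  have ba : 0 < b - a by rewrite subr_gt0.
  have ia : a <= a <= b by rewrite lexx ltW.
  have ib : a <= b <= b by rewrite lexx ltW.
  by have := le_trans (nrm_ge0 _) (dw_lip ib ia); rewrite gtr0_norm// pmulr_lge0.
pose G s := windowed (s + h) - windowed s.
have -> : K * h ^+ 2 = (K * h) * (t + h - t) by ring.
rewrite -[X in nrm X]/(G (t + h) - G t).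
have th : t <= t + h by lra.
have Kh : 0 <= K * h by rewrite mulr_ge0// ltW.
apply: (mean_value_inequality th Kh).
  move=> s _ e e0; pose M := 2 * (L + 2 * B).
  have M0 : 0 <= M.
    have := le_trans (nrm_ge0 _) (windowed_lip 1 0).
    by rewrite subr0 normr1 mulr1 /M; move: ab ab4; lra.
  exists (e / (M + 1)); first by rewrite divr_gt0//; move: ab ab4; lra.
  move=> r _; rewrite ltr_pdivlMr; last lra; move=> hr.
  have -> : G r - G s = windowed (r + h) - windowed (s + h) - (windowed r - windowed s).
    by rewrite /G !opprB addrACA [RHS]addrACA; congr (_ + _); rewrite addrC.
  rewrite (le_trans (nrmB _ _))//.
  have := windowed_lip r s; have := windowed_lip (r + h) (s + h).
  rewrite (_ : r + h - (s + h) = r - s); last by ring.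
  by rewrite /M in hr; have := normr_ge0 (r - s); lra.
move=> s _ e e0; have e2 : 0 < e / 2 by lra.
have [d d0 hd] := windowed_derivr (s + h) e2.
have [d' d'0 hd'] := windowed_derivr s e2.
exists (Num.min d d'); first by rewrite lt_min d0.
move=> r /andP[sr rd] _.
have : r - s < Num.min d d' by lra.
rewrite lt_min => /andP[rd1 rd2].
have -> : G r - G s =
  (windowed (r + h) - windowed (s + h) - (r + h - (s + h))%:C *: dw (clamp (s + h)))
  - (windowed r - windowed s - (r - s)%:C *: dw (clamp s))
  + (r - s)%:C *: (dw (clamp (s + h)) - dw (clamp s)).
  have subrACA (x y z u : V) : x - y - (z - u) = x - z - (y - u).
    by rewrite !opprB addrACA [RHS]addrACA; congr (_ + _); rewrite addrC.
  have cancel (x y z u : V) : x - z - (y - u) + (z - u) = x - y.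
    by rewrite addrA (addrAC (x - z)) subrK -addrA -opprD subrK.
  have -> : r + h - (s + h) = r - s by ring.
  by rewrite [(r - s)%:C *: (_ - _)]scalerBr cancel /G subrACA.
rewrite (le_trans (nrmD _ _))// (le_trans (lerD (nrmB _ _) (lexx _)))// nrmZ nrm_real.
have rs0 : 0 < r - s by lra.
have h1 := hd (r + h) _; have h2 := hd' r _.
rewrite (_ : r + h - (s + h) = r - s) in h1 *; last by ring.
have {}h1 : nrm (windowed (r + h) - windowed (s + h) - (r - s)%:C *: dw (clamp (s + h)))
    <= e / 2 * (r - s) by apply: h1; apply/andP; split; move: ab ab4; lra.
have {}h2 : nrm (windowed r - windowed s - (r - s)%:C *: dw (clamp s))
    <= e / 2 * (r - s) by apply: h2; apply/andP; split; move: ab ab4; lra.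
have := le_trans (dw_lip (clamp_in (s + h)) (clamp_in s))
  (ler_wpM2l K0 (clamp_lip (s + h) s)).
rewrite (_ : s + h - s = h); last by ring.
rewrite (gtr0_norm h0) -/K (gtr0_norm rs0) => /(ler_wpM2l (ltW rs0)); move: ab ab4; lra.
Qed.

End SecondDifference.
End Windowed.
End Window.

(** [T (2 * pi)] need not be invertible, so the backward half of the orbit is part of the data. *)
Definition tame_orbit (R : realType) (X : normedModType R[i]) (T : R -> X -> X)
    (u : int -> X) :=
  (forall k, T (2 * pi) (u k) = u (k + 1)) /\ sub_cauchy u.

(** * Tame orbits from Fourier coefficients *)

Section SubCauchy.
Variables (R : realType) (X : normedModType R[i]).

(** [4^-j = (3/4)^j 3^-j]: the second factor is summable over all nonzero frequencies, and the first
    is small far from the origin. *)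
Lemma sub_cauchy_decay (u : int -> X) (C : R) :
  (forall k, k != 0 -> nrm (u k) <= C * 4^-1 ^+ block k) -> sub_cauchy u.
Proof.
move=> uC e e0.
have C0 : 0 <= C.
  have := le_trans (nrm_ge0 _) (uC 1 isT); rewrite pmulr_lge0// exprn_gt0 ?invr_gt0//.

have q01 : 0 <= (3 / 4 : R) < 1 by apply/andP; split; lra.
have C1 : 0 < C * 6 + 1 by lra.
have [J /(_ J (leqnn _)) hJ] := pow_le_eps q01 (divr_gt0 e0 C1).
exists (2 ^ J)%N => l ul lJ.
have l0 : 0 \notin l.
  by apply/negP => /lJ; rewrite absz0 leqNgt expn_gt0.
have q0 n : 0 <= (3 / 4 : R) ^+ n by rewrite exprn_ge0//; lra.
rewrite (le_trans (nrm_sum _ _ _))//.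
apply: (@le_trans _ _ (\sum_(k <- l) C * (3 / 4) ^+ J * 3^-1 ^+ block k)).
  rewrite big_seq [leRHS]big_seq; apply: ler_sum => k kl.
  have k0 : k != 0 by apply: contraNneq l0 => <-.
  rewrite (le_trans (uC k k0))// -mulrA ler_wpM2l//.
  have -> : (4^-1 : R) ^+ block k = (3 / 4) ^+ block k * 3^-1 ^+ block k.
    by rewrite -exprMn; congr (_ ^+ _); field.
  rewrite ler_wpM2r ?exprn_ge0//; apply: ler_wiXn2l; [lra|lra|].
  have /andP[_ kb] := blockP k0.
  by rewrite -ltnS -(ltn_exp2l _ _ (ltnSn 1)) (leq_ltn_trans (lJ _ kl)).
rewrite -mulr_sumr; have := ler_wpM2l (mulr_ge0 C0 (q0 J)) (sum_block R ul l0).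
by move: hJ; rewrite ler_pdivlMr//; have := q0 J; lra.
Qed.

(** The Fourier estimates leave out frequency 0; replacing that one term by 0 does not affect the
    tails. *)
Lemma sub_cauchy_wuc (u : int -> X) (C : R) :
  (forall phi : {linear X -> R[i]^o}, (forall y, nrm (phi y) <= nrm y) ->
     forall l, uniq l -> 0 \notin l -> \sum_(k <- l) nrm (phi (u k)) <= C) ->
  (forall x : int -> X, wuc x C -> sub_cauchy x) -> sub_cauchy u.
Proof.
move=> uC wsc; pose x k := if k == 0 then 0 else u k.
have /wsc xc : wuc x C.
  move=> phi phi1 l ul.
  have -> : \sum_(k <- l) nrm (phi (x k)) =
      \sum_(k <- [seq k <- l | k != 0]) nrm (phi (u k)).
    rewrite big_filter [LHS](bigID (fun k => k != 0))/= [X in _ + X]big1 ?addr0.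
      by apply: eq_bigr => k k0; rewrite /x (negbTE k0).
    by move=> k /negPn k0; rewrite /x k0 linear0 nrm0.
  by apply: uC; rewrite ?filter_uniq// mem_filter eqxx.
move=> e /xc[N hN]; exists N.+1 => l ul lN.
have -> : \sum_(k <- l) u k = \sum_(k <- l) x k.
  apply: eq_big_seq => k /lN; rewrite /x; case: eqP => // ->.
  by rewrite absz0.
by apply: hN => // k /lN /ltnW.
Qed.

Lemma sub_cauchyZD (a : R[i]) (u v : int -> X) :
  sub_cauchy u -> sub_cauchy v -> sub_cauchy (fun k => a *: u k + v k).
Proof.
move=> uc vc e e0; have a0 : 0 < nrm a + 1 by rewrite ltr_wpDl ?nrm_ge0.
have e2 : 0 < e / 2 by lra.
have [N hN] := uc _ (divr_gt0 e2 a0); have [N' hN'] := vc _ e2.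
exists (N + N')%N => l ul lN; rewrite big_split -scaler_sumr (le_trans (nrmD _ _))//.
have := hN l ul (fun k kl => leq_trans (leq_addr _ _) (lN k kl)).
have := hN' l ul (fun k kl => leq_trans (leq_addl _ _) (lN k kl)).
rewrite nrmZ (ler_pdivlMr _ _ a0); have := nrm_ge0 (\sum_(k <- l) u k); lra.
Qed.

End SubCauchy.

Section Orbits.
Variables (R : realType) (X : completeNormedModType R[i]) (T : R -> X -> X).
Hypothesis sT : C0_semigroup T.

Let tau0 : 0 <= 2 * pi :> R. Proof. by rewrite mulr_ge0// pi_ge0. Qed.

Lemma orbit0 : tame_orbit T (fun=> 0).
Proof.
split=> [k|e e0]; first by rewrite semigroup_at0.
by exists 0%N => l _ _; rewrite big1// nrm0 ltW.
Qed.

Lemma orbitZD (a : R[i]) u v : tame_orbit T u -> tame_orbit T v ->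
  tame_orbit T (fun k => a *: u k + v k).
Proof.
move=> [uT uc] [vT vc]; split; last exact: sub_cauchyZD.
by move=> k; rewrite semigroupDr// semigroupZ// uT vT.
Qed.

Section Window.
Variables (a b L B : R) (f : R -> X).
Hypothesis ab : a < b.
Hypothesis ab4 : b - a <= 4^-1.
Hypothesis fL : lipschitz_itv a b L f.
Hypothesis fB : forall t, a <= t <= b -> nrm (f t) <= B.
Hypothesis fT : forall t, a <= t <= b -> T (2 * pi) (f t) = char 1 t *: f t.

Let c := a - 2^-1.
Let F := windowed a b f.

(** [T (2 * pi)] multiplies the windowed function by [char 1] at every time, since that function is
    0 off [[a, b]]. The orbit relation thus holds exactly between Riemann sums, and boundedness of
    [T (2 * pi)] passes it to the limits. *)
Lemma window_orbit : exists u : int -> X, (forall k, tends (fourier c F k) (u k)) /\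
  forall k, T (2 * pi) (u k) = u (k + 1).
Proof.
have half : 0 <= (2^-1 : R) < 1 by apply/andP; split; lra.
have Fc k : exists u, tends (fourier c F k) u.
  have [|u [hu _]] := @geometric_tends R _ half X (fourier c F k)
    (L + 2 * B + 4 * pi * `|k%:~R| * B); last by exists u.
  move=> N; apply: mean_step => s t.
  apply: fourier_integrand_lip => [r|r q]; first exact: windowed_bound.
  exact: windowed_lip.
have [u hu] := choice Fc; exists u; split=> // k.
have [M M0 hM] := semigroup_bound sT tau0.
have TF t : T (2 * pi) (F t) = char 1 t *: F t.
  rewrite /F /windowed semigroupZ//.
  have [ta|ta] := ltP t a.
    rewrite clamp_lo ?ltW//; have [-> _] := @quartic_ends _ a b a (or_introl erefl).
    by rewrite !scale0r scaler0.
  have [bt|tb] := ltP b t.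
    rewrite clamp_hi ?ltW//; have [-> _] := @quartic_ends _ a b b (or_intror erefl).
    by rewrite !scale0r scaler0.
  by rewrite clamp_id ?ta// fT ?ta// scalerA mulrC -scalerA.
have Tk N : T (2 * pi) (fourier c F k N) = fourier c F (k + 1) N.
  rewrite /fourier /mean semigroupZ// semigroup_sum//; congr (_ *: _).
  by apply: eq_bigr => m _; rewrite semigroupZ// TF scalerA -charDl.
apply: tends_uniq (hu (k + 1)); apply: (@tends_ext _ _ (fun N => T (2 * pi) (fourier c F k N))).
  by exists 0%N => N _; rewrite Tk.
by apply: (tends_lip (C := M)) (hu k) => x y; rewrite -semigroupB.
Qed.

Lemma window_orbit_C2 (u : int -> X) (I : set R) (f1 f2 : R -> X) :
  (forall t, a <= t <= b -> I t) ->
  derivative_on I f f1 -> derivative_on I f1 f2 -> {within I, continuous f2} ->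
  (forall k, tends (fourier c F k) (u k)) -> sub_cauchy u.
Proof.
move=> abI ff1 ff2 f2c hu.
have [L1 _ hL1] := C1_lipschitz ff2 f2c (ltW ab) abI.
have [B1 _ hB1] := continuous_bounded (derivative_continuous ff2) (ltW ab) abI.
apply: (@sub_cauchy_decay _ _ _ (2 * L + 6 * B + (L1 + 2 * B1))) => k k0.
apply: (tends_nrm_le (hu k)); exists (block k + 2)%N => N kN.
apply: fourier_second_difference => //; first exact: windowed_supp.
by move=> t h h0 _; exact: (windowed_second_difference ab ab4 fL fB abI ff1 hL1 hB1).
Qed.

(** All functionals of the unit ball give functions with the same Lipschitz constant [K], so the
    Bernstein bound is uniform in [phi]. *)
Lemma window_orbit_wuc (u : int -> X) : ~ contains_c0 X ->
  (forall k, tends (fourier c F k) (u k)) -> sub_cauchy u.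
Proof.
move=> nc0 hu; pose K := L + 2 * B.
have K0 : 0 <= K.
  have := le_trans (nrm_ge0 _) (windowed_lip ab ab4 fL fB 1 0).
  by rewrite subr0 normr1 mulr1.
apply: (@sub_cauchy_wuc _ _ _ (2 * K ^+ 2 + 3)); last first.
  by move=> x; exact: bessaga_pelczynski.
move=> phi phi1 l ul l0.
apply: (tends_nrm_sum (x := fun k N => phi (fourier c F k N) : R[i]^o)).
  move=> k; apply: (tends_lip (C := 1)) (hu k) => x y.
  by rewrite -linearB mul1r.
have [t ht|s t|N0 hN0] := @fourier_bernstein _ c (fun t => phi (F t)) K l ul l0 K0.
- by rewrite /F windowed_supp ?linear0//; rewrite /c in ht; lra.
- rewrite -linearB (le_trans (phi1 _))//; exact: windowed_lip.
exists N0 => N /hN0; apply: le_trans; apply: ler_sum => k _.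
rewrite le_eqVlt; apply/orP; left; apply/eqP; congr nrm.
rewrite /fourier /mean linearZ linear_sum; congr (_ *: _).
by apply: eq_bigr => m _; rewrite linearZ.
Qed.

(** [u 0] is the integral of [f] against the weight [quartic], and [f] varies by at most
    [L * (b - a)] on the window. Dividing by a Riemann sum [q N] of the weight suffices, provided
    [q N] is bounded below independently of [N]. *)
Lemma window_orbit_approx (u : int -> X) (j : nat) (t0 e : R) :
  b = a + 4 * 2^-1 ^+ j -> (4 <= j)%N -> a <= t0 <= b -> 0 <= L -> 0 < e ->
  (forall k, tends (fourier c F k) (u k)) ->
  exists r : R, nrm (r%:C *: u 0 - f t0) <= e + L * (b - a).
Proof.
move=> bE j4 t0ab L0 e0 hu; set h := _ ^+ _ in bE.
have h0 : 0 < h by rewrite exprn_gt0.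
pose q N : R := (2 ^ N)%N%:R^-1 * \sum_(0 <= m < 2 ^ N) quartic a b (clamp a b (grid c N m)).
have n0 N : 0 < (2 ^ N)%N%:R :> R by rewrite ltr0n expn_gt0.
(* Only the grid points between [a + h] and [a + 2 h] are kept: they make up a proportion [h] of the
   grid, and [quartic] is at least [h ^+ 4] there. *)
have q_ge N : (j <= N)%N -> h ^+ 5 <= q N.
  move=> jN; rewrite /q mulrC ler_pdivlMr//.
  (* [n1] is the index of the grid point [a], the midpoint of the period, and [p] is the number of
     mesh steps in [h]. *)
  pose p := (2 ^ (N - j))%N; pose n1 := (2 ^ N.-1)%N.
  have n2 : (2 ^ N = 2 * n1)%N by rewrite -expnS prednK//; lia.
  have pn : (p * 2 ^ j = 2 ^ N)%N by rewrite -expnD subnK.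
  have p16 : (p * 16 <= 2 ^ N)%N 
    by rewrite -pn leq_mul// (@leq_trans (2 ^ 4))// leq_exp2l.
  have hp : h * (2 ^ N)%N%:R = p%:R.
    by rewrite -pn natrM natrX /h mulrCA -exprMn mulVf// expr1n mulr1.
  rewrite (big_cat_nat (n := n1 + p)%N)//=; last by rewrite n2 in p16 *; lia.
  rewrite [X in _ + X](big_cat_nat (n := n1 + 2 * p)%N)//=; last 2 first.
  - by rewrite leq_add2l; lia.
  - by rewrite n2 in p16 *; lia.
  rewrite (@le_trans _ _ (\sum_(n1 + p <= m < n1 + 2 * p) h ^+ 4))//.
    rewrite (exprSr h 4) -(mulrA (h ^+ 4)) hp big_const_nat iter_addr addr0.
    by rewrite (_ : n1 + 2 * p - (n1 + p) = p)%N ?mulr_natr//; lia.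
  rewrite -[leLHS]addr0 -[leLHS]add0r; apply: lerD.
    by apply: sumr_ge0 => m _; exact: quartic_ge0.
  apply: lerD; last by apply: sumr_ge0 => m _; exact: quartic_ge0.
  apply: ler_sum_nat => m /andP[m1 m2].
  have g : grid c N m = a + (m%:R / (2 ^ N)%N%:R - 2^-1) by rewrite /grid /c; lra.
  have nh : n1%:R / (2 ^ N)%N%:R = 2^-1 :> R.
    rewrite n2 natrM invfM mulrCA divff ?mulr1// pnatr_eq0; lia.
  have ph : p%:R / (2 ^ N)%N%:R = h by rewrite -hp mulfK// gt_eqF.
  have g1 : h <= m%:R / (2 ^ N)%N%:R - 2^-1.
    by rewrite lerBrDr -nh -ph -mulrDl ler_wpM2r ?invr_ge0// -natrD ler_nat addnC.
  have g2 : m%:R / (2 ^ N)%N%:R - 2^-1 <= 2 * h.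
    rewrite lerBlDr -nh -ph mulrA -mulrDl ler_wpM2r ?invr_ge0//.
    by rewrite -[2]/(2%:R) -natrM -natrD ler_nat; lia.
  rewrite g; move: (_ - _) g1 g2 => x x1 x2.
  rewrite clamp_id; last by apply/andP; split; lra.
  rewrite /quartic (_ : 4 = 2 * 2)%N// exprM ler_pXn2r ?nnegrE ?sqr_ge0//; last first.
    by rewrite mulr_ge0//; lra.
  by rewrite expr2 ler_pM//; lra.
have q0 N : 0 <= q N.
  by rewrite mulr_ge0 ?invr_ge0// sumr_ge0// => m _; exact: quartic_ge0.
have k0 : 0 < h ^+ 5 by rewrite exprn_gt0.
have [N1 hN1] := hu 0 _ (mulr_gt0 k0 e0); pose N := (N1 + j)%N.
have qN : h ^+ 5 <= q N by rewrite q_ge// leq_addl.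
have qN0 : 0 < q N by rewrite (lt_le_trans k0).
exists (q N)^-1.
have -> : (q N)^-1%:C *: u 0 - f t0 = (q N)^-1%:C *: (u 0 - (q N)%:C *: f t0).
  by rewrite scalerBr scalerA -rmorphM /= mulVf ?scale1r ?gt_eqF.
rewrite nrmZ nrm_real ger0_norm ?invr_ge0// mulrC ler_pdivrMr//.
rewrite (le_trans (nrm_tri (fourier c F 0 N) _ _))// nrmBC mulrDl lerD//.
  by rewrite (le_trans (hN1 N (leq_addr _ _)))// mulrC ler_wpM2l// ltW.
have -> : fourier c F 0 N - (q N)%:C *: f t0 =
    mean c (fun t => F t - (quartic a b (clamp a b t))%:C *: f t0) N.
  rewrite meanB /fourier; congr (_ - _).
    by rewrite /mean; congr (_ *: _); apply: eq_bigr => m _; rewrite /char mul0r mulr0 expi0 scale1r.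
  rewrite /mean /q rmorphM fmorphV rmorph_nat /= -scalerA; congr (_ *: _).
  by rewrite rmorph_sum scaler_suml.
rewrite (le_trans (nrm_mean _ _ _))// /q [leRHS]mulrC -[leRHS]mulrA ler_wpM2l ?invr_ge0//.
rewrite mulr_suml; apply: ler_sum => m _; rewrite /F /windowed -scalerBr nrmZ nrm_real.
rewrite ger0_norm ?quartic_ge0// ler_wpM2l ?quartic_ge0//.
have ct := clamp_in ab (grid c N m).
rewrite (le_trans (fL ct t0ab))// ler_wpM2l//.
by have /andP[? ?] := ct; have /andP[? ?] := t0ab; rewrite ler_norml; apply/andP; split; lra.
Qed.

End Window.

Lemma orbit_near (f : R -> X) (I : set R) (t e : R) : nondegenerate_interval I ->
  (forall r, I r -> generator_domain T (f r)) ->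
  (forall r, I r -> generator T (f r) = (0 +i* r) *: f r) ->
  C_on 2 I f \/ (~ contains_c0 X /\
    forall phi : {linear X -> R[i]^o}, continuous phi -> C_on 1 I (fun r => phi (f r))) ->
  I t -> 0 < e -> exists v, tame_orbit T v /\ nrm (v 0 - f t) <= e.
Proof.
move=> [itvI [x [y [Ix Iy xy]]]] fdom feig reg It e0.
(* [t] may be an endpoint of [I]; a second point [d] decides on which side of [t] the window
   lies. *)
have [d Id td] : exists2 d, I d & d != t.
  have [xt|xt] := eqVneq x t; last by exists x.
  by exists y; rewrite // -xt gt_eqF.
pose lo := Num.min d t; pose hi := Num.max d t.
have lohi : lo <= hi by rewrite /lo /hi ge_min le_max lexx.
have Ilohi r : lo <= r <= hi -> I r.
  rewrite /lo /hi; have [dt|/ltW dt] := leP d t => /andP[r1 r2].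
    by apply: (itvI d t) => //; rewrite r1.
  by apply: (itvI t d) => //; rewrite r1.
have [L L0 fL] : exists2 L, 0 <= L & lipschitz_itv lo hi L f.
  case: reg => [[f1 [ff1 [f2 [ff2 f2c]]]]|[_ wC1]].
    exact: C1_lipschitz ff1 (derivative_continuous ff2) lohi Ilohi.
  exact: weakly_C1_lipschitz wC1 lohi Ilohi.
have dt0 : 0 < `|d - t| by rewrite normr_gt0 subr_eq0.
have half : 0 <= (2^-1 : R) < 1 by apply/andP; split; lra.
have L1 : 0 < L + 1 by lra.
(* The width [4 h] must fit between [d] and [t] and satisfy [4 h L <= e / 2]; adding 4 to [j0] makes
   it at most 1/4. *)
have m0 : 0 < Num.min (`|d - t| / 4) (e / 8 / (L + 1)).
  by rewrite lt_min !divr_gt0.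
have [j0 hj0] := pow_le_eps half m0; pose j := (j0 + 4)%N.
have j4 : (4 <= j)%N by rewrite leq_addl.
have := hj0 j (leq_addr _ _); rewrite le_min ler_pdivlMr// => /andP[].
set h := _ ^+ _ => hd; rewrite ler_pdivlMr// => hL.
have h0 : 0 < h by rewrite exprn_gt0.
have h16 : h <= 16^-1.
  rewrite /h /j exprD -[leRHS]mul1r (_ : 2^-1 ^+ 4 = 16^-1); last by field.
  by rewrite ler_wpM2r ?exprn_ile1//; lra.
have [a [ta at_ alo ahi]] : exists a, [/\ a <= t, t <= a + 4 * h, lo <= a & a + 4 * h <= hi].
  move: hd; rewrite /lo /hi; have [dt|dt] := leP d t.
    by rewrite ler0_norm ?subr_le0// => hd; exists (t - 4 * h); split; lra.
  by rewrite gtr0_norm ?subr_gt0// => hd; exists t; split; lra.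
pose b := a + 4 * h.
have ab : a < b by rewrite /b; lra.
have ab4 : b - a <= 4^-1 by rewrite /b; lra.
have abI r : a <= r <= b -> lo <= r <= hi.
  by rewrite /b => /andP[r1 r2]; apply/andP; split; lra.
have {}fL : lipschitz_itv a b L f by move=> r s /abI r1 /abI r2; exact: fL.
have {}abI r : a <= r <= b -> I r by move=> /abI /Ilohi.
have tab : a <= t <= b by rewrite ta.
have fB r : a <= r <= b -> nrm (f r) <= nrm (f t) + L.
  move=> rab; have := nrm_ge_sub (f r) (f t); have := fL _ _ rab tab.
  have : L * `|r - t| <= L * 1.
    move: rab tab => /andP[? ?] /andP[? ?].
    by rewrite ler_wpM2l// ler_norml; apply/andP; split; lra.
  lra.
have fT r : a <= r <= b -> T (2 * pi) (f r) = char 1 r *: f r.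
  move=> /abI Ir; rewrite (generator_eigen sT (fdom _ Ir) (feig _ Ir) tau0).
  by rewrite /char mul1r.
have [u [hu uT]] := window_orbit ab ab4 fL fB fT.
have uc : sub_cauchy u.
  case: reg => [[f1 [ff1 [f2 [ff2 f2c]]]]|[nc0 _]].
    exact: (window_orbit_C2 ab ab4 fL fB abI ff1 ff2 f2c hu).
  exact: (window_orbit_wuc ab ab4 fL fB nc0 hu).
have e2 : 0 < e / 2 by lra.
have [r hr] := window_orbit_approx ab ab4 fL erefl j4 tab L0 e2 hu.
exists (fun k => r%:C *: u k + 0); split; first exact: (orbitZD _ (conj uT uc) orbit0).
rewrite addr0 (le_trans hr)// (_ : a + 4 * h - a = 4 * h); last by ring.
by move: hL; have := h0; lra.
Qed.

Definition orbit_limit : set X :=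
  [set x | forall e : R, 0 < e -> exists v, tame_orbit T v /\ nrm (v 0 - x) <= e].

Lemma orbit_limitZD (a : R[i]) x y :
  orbit_limit x -> orbit_limit y -> orbit_limit (a *: x + y).
Proof.
move=> hx hy e e0; have a0 : 0 < nrm a + 1 by rewrite ltr_wpDl ?nrm_ge0.
have e2 : 0 < e / 2 by lra.
have [u [uo ux]] := hx _ (divr_gt0 e2 a0); have [v [vo vy]] := hy _ e2.
exists (fun k => a *: u k + v k); split; first exact: orbitZD.
rewrite opprD addrACA -scalerBr (le_trans (nrmD _ _))// nrmZ.
by move: ux; rewrite (ler_pdivlMr _ _ a0); have := nrm_ge0 (u 0 - x); lra.
Qed.

Lemma orbit_limit0 : orbit_limit 0.
Proof.
by move=> e e0; exists (fun=> 0); split; [exact: orbit0|rewrite subrr nrm0 ltW].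
Qed.

Lemma orbit_limit_span (S : set X) : S `<=` orbit_limit ->
  dense (linear_span S) -> forall x, orbit_limit x.
Proof.
move=> SO dS x e e0; have e2 : 0 < e / 2 by lra.
have [||y [xy [n [c [v [Sv yE]]]]]] := dS (ball x (e / 2)%:C).
- by exists x; apply: ballxx; rewrite (ltcR 0).
- by apply: ball_open; rewrite (ltcR 0).
move: xy; rewrite -ball_normE /= nrmE ltcR => xy.
have /(_ _ e2) [w [wo wy]] : orbit_limit y.
  rewrite yE; elim/big_rec: _ => [|i z _ hz]; first exact: orbit_limit0.
  by apply: orbit_limitZD => //; exact: SO.
exists w; split=> //; rewrite (le_trans (nrm_tri y _ _))// [nrm (y - _)]nrmBC; lra.
Qed.

(** Letter 0 is a blank: it fills the gaps of words and puts 0 in the first set. The other letters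
    enumerate approximations, within every [2^-p], of a countable dense set. *)
Lemma orbit_sequence : separable X -> (forall x, orbit_limit x) ->
  exists v : nat -> int -> X, [/\ v 0 = (fun=> 0), forall m, tame_orbit T (v m) &
    forall x (e : R), 0 < e -> exists m, nrm (v m 0 - x) <= e].
Proof.
move=> [D [Dc Dd]] lim.
have [g g_inj] := countable_injP _ Dc.
have [d hd] : exists d : nat -> X, forall n, (exists2 x, D x & g x = n) -> g (d n) = n /\ D (d n).
  have h n : exists x, (exists2 x, D x & g x = n) -> g x = n /\ D x.
    have [[x Dx gx]|no] := pselect (exists2 x, D x & g x = n); first by exists x.
    by exists 0 => /no.
  by have [d hd] := choice h; exists d.
have near (p : nat * nat) : exists w, tame_orbit T w /\ nrm (w 0 - d p.1) <= 2^-1 ^+ p.2.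
  by apply: lim; rewrite exprn_gt0.
have [w hw] := choice near.
exists (fun m => if m is m'.+1 then if unpickle m' is Some p then w p else (fun=> 0)
  else (fun=> 0)); split=> // [[|m]|x e e0]; first exact: orbit0.
  by case: unpickle => [p|]; [case: (hw p)|exact: orbit0].
have e2 : 0 < e / 2 by lra.
have [||y [xy Dy]] := Dd (ball x (e / 2)%:C).
- by exists x; apply: ballxx; rewrite (ltcR 0).
- by apply: ball_open; rewrite (ltcR 0).
move: xy; rewrite -ball_normE /= nrmE ltcR => xy.
have [gd Ddy] := hd (g y) (ex_intro2 _ _ y Dy erefl).
have dy : d (g y) = y by apply: g_inj; rewrite ?inE.
have half : 0 <= (2^-1 : R) < 1 by apply/andP; split; lra.
have [p /(_ p (leqnn _)) hp] := pow_le_eps half e2.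
exists (pickle (g y, p)).+1; rewrite pickleK.
have [_ /=] := hw (g y, p); rewrite dy => wy.
by rewrite (le_trans (nrm_tri y _ _))// [nrm (y - _)]nrmBC; lra.
Qed.

End Orbits.

(** * Unordered sums over the integers *)

Section HasSum.
Variables (R : realType) (X : normedModType R[i]).
Implicit Types (g : int -> X) (x : X).

(** Convergence along all large finite sets rather than along boxes, so that shifting the index
    preserves the sum. *)
Definition has_sum g x := forall e : R, 0 < e -> exists N, forall l, uniq l ->
  (forall k : int, (`|k| < N)%N -> k \in l) -> nrm (\sum_(k <- l) g k - x) <= e.

(** The integers from [- N] to [N - 1]; the missing endpoint [N] is why [mem_box] is strict and
    [box_le] is not. *)
Definition box N : seq int := [seq n%:Z - N%:Z | n <- iota 0 (N + N)].

Lemma box_uniq N : uniq (box N).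
Proof. by rewrite map_inj_uniq ?iota_uniq// => n m; lia. Qed.

Lemma mem_box N (k : int) : (`|k| < N)%N -> k \in box N.
Proof.
move=> kN; apply/mapP; exists (absz (k + N%:Z)%R); last by lia.
by rewrite mem_iota; lia.
Qed.

Lemma box_le N k : k \in box N -> (`|k| <= N)%N.
Proof. by move=> /mapP[n]; rewrite mem_iota => hn ->; lia. Qed.

Lemma box_sub N M : (N <= M)%N -> {subset box N <= box M}.
Proof.
move=> NM k /mapP[n]; rewrite mem_iota => hn ->.
by apply/mapP; exists (n + (M - N))%N; rewrite ?mem_iota; lia.
Qed.

Lemma sum_box_split g N l : uniq l -> {subset box N <= l} ->
  \sum_(k <- l) g k = \sum_(k <- box N) g k + \sum_(k <- l | k \notin box N) g k.
Proof.
move=> ul bl; rewrite [LHS](bigID (mem (box N)))/= -[X in X + _]big_filter.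
congr (_ + _); apply: perm_big; apply: uniq_perm; rewrite ?box_uniq ?filter_uniq//.
by move=> k; rewrite mem_filter andb_idr//; exact: bl.
Qed.

Lemma has_sum_near g x (N : nat) (e : R) : has_sum g x -> 0 < e ->
  exists N', forall M, (N' <= M)%N -> {subset box N <= box M} /\
    nrm (\sum_(k <- box M) g k - x) <= e.
Proof.
move=> gx e0; have [N' hN'] := gx _ e0; exists (N + N' + 1)%N => M NM; split.
  by apply: box_sub; rewrite (leq_trans _ NM)// -addnA leq_addr.
by apply: hN' => [|k kN]; [exact: box_uniq|apply: mem_box; lia].
Qed.

Lemma has_sum_uniq g x y : has_sum g x -> has_sum g y -> x = y.
Proof.
move=> gx gy; apply/eqP; rewrite -subr_eq0; apply/eqP/nrm_small_eq0 => e e0.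
have e2 : 0 < e / 2 by lra.
have [N hN] := has_sum_near 0 gx e2; have [N' hN'] := has_sum_near 0 gy e2.
have [_ h] := hN (N + N')%N (leq_addr _ _); have [_ h'] := hN' (N + N')%N (leq_addl _ _).
rewrite (le_trans (nrm_tri (\sum_(k <- box (N + N')) g k) _ _))// nrmBC; lra.
Qed.

Lemma has_sum_shift g x : has_sum g x -> has_sum (fun k => g (k - 1)) x.
Proof.
move=> gx e /gx[N hN]; exists N.+1 => l ul lN.
rewrite -(big_map (fun k => k - 1) xpredT g); apply: hN.
  by rewrite map_inj_uniq//; exact: addIr.
move=> k kN; apply/mapP; exists (k + 1); last by rewrite addrK.
by apply: lN; lia.
Qed.

Lemma has_sum_delta m x : has_sum (fun k => if k == m then x else 0) x.
Proof.
move=> e e0; exists (`|m|.+1)%N => l ul lN.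
rewrite (big_rem m) ?lN//= eqxx big_seq big1 ?addr0 ?subrr ?nrm0 ?ltW//.
by move=> k kl; case: eqP => // km; move: kl; rewrite km mem_rem_uniqF.
Qed.

(** The parts over [box N] cancel, and each of the two tails costs [e]. *)
Lemma has_sum_close g g' x x' (N : nat) (e : R) : has_sum g x -> has_sum g' x' ->
  (forall k : int, (`|k| <= N)%N -> g k = g' k) ->
  (forall l, uniq l -> (forall k, k \in l -> (N <= `|k|)%N) ->
     nrm (\sum_(k <- l) g k) <= e) ->
  (forall l, uniq l -> (forall k, k \in l -> (N <= `|k|)%N) ->
     nrm (\sum_(k <- l) g' k) <= e) ->
  nrm (x - x') <= 2 * e.
Proof.
move=> gx gx' gg' ge ge'; apply/ler_addgt0Pr => d d0.
have d2 : 0 < d / 2 by lra.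
have [M hM] := has_sum_near N gx d2; have [M' hM'] := has_sum_near N gx' d2.
have [bb h] := hM (M + M')%N (leq_addr _ _); have [_ h'] := hM' (M + M')%N (leq_addl _ _).
move: h h'; rewrite !(sum_box_split _ (box_uniq _) bb).
have -> : \sum_(k <- box N) g k = \sum_(k <- box N) g' k.
  by apply: eq_big_seq => k /box_le; exact: gg'.
set s := \sum_(k <- box N) _; rewrite -!(big_filter (box (M + M'))); set l := [seq k <- _ | _] => h h'.
have lN k : k \in l -> (N <= `|k|)%N.
  by rewrite mem_filter leqNgt => /andP[kb _]; apply: contra kb; exact: mem_box.
have ul : uniq l by rewrite filter_uniq ?box_uniq.
have := ge l ul lN; have := ge' l ul lN.
move: h h'; set t := \sum_(k <- l) _; set t' := \sum_(k <- l) _ => h h' he' he.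
have := nrm_tri (s + t) x x'; have := nrm_tri (s + t') (s + t) x'.
have -> : s + t - (s + t') = t - t' by rewrite opprD addrACA subrr add0r.
by rewrite [nrm (x - (s + t))]nrmBC; have := nrmB t t'; lra.
Qed.

End HasSum.

Lemma sub_cauchy_has_sum (R : realType) (X : completeNormedModType R[i])
    (g : int -> X) : sub_cauchy g -> exists x, has_sum g x.
Proof.
move=> gc.
have key e : 0 < e -> exists N, forall l l', uniq l -> uniq l' ->
    {subset box N <= l} -> {subset box N <= l'} ->
    nrm (\sum_(k <- l) g k - \sum_(k <- l') g k) <= e.
  move=> e0; have e2 : 0 < e / 2 by lra.
  have [N hN] := gc _ e2; exists N => l l' ul ul' bl bl'.
  rewrite (sum_box_split _ ul bl) (sum_box_split _ ul' bl') opprD addrACA subrr add0r.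
  rewrite (le_trans (nrmB _ _))// -(big_filter l) -(big_filter l').
  have h s : uniq s -> nrm (\sum_(k <- [seq k <- s | k \notin box N]) g k) <= e / 2.
    move=> us; apply: hN; first exact: filter_uniq.
    by move=> k; rewrite mem_filter leqNgt => /andP[kb _]; apply: contra kb; exact: mem_box.
  by have := h l ul; have := h l' ul'; lra.
have [e e0|x hx] := @cauchy_tends _ _ (fun N => \sum_(k <- box N) g k).
  have [N hN] := key e e0; exists N => n m Nn Nm.
  by apply: hN; rewrite ?box_uniq//; exact: box_sub.
exists x => e e0; have e2 : 0 < e / 2 by lra.
have [N hN] := key _ e2; have [M hM] := hx _ e2.
exists N.+1 => l ul lN.
rewrite (le_trans (nrm_tri (\sum_(k <- box (N + M)) g k) _ _))//.
have := hM (N + M)%N (leq_addl _ _).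
have bl : {subset box N <= l}.
  by move=> k /box_le kN; apply: lN; rewrite ltnS.
have := hN l (box (N + M)) ul (box_uniq _) bl (box_sub (leq_addr _ _)); lra.
Qed.

Lemma has_sum_semigroup (R : realType) (X : normedModType R[i]) (T : R -> X -> X)
    (t : R) (g : int -> X) (x : X) : C0_semigroup T -> 0 <= t ->
  has_sum g x -> has_sum (fun k => T t (g k)) (T t x).
Proof.
move=> sT t0 gx e e0; have [M M0 hM] := semigroup_bound sT t0.
have M1 : 0 < M + 1 by lra.
have [N hN] := gx _ (divr_gt0 e0 M1); exists N => l ul lN.
rewrite -semigroup_sum// -semigroupB// (le_trans (hM _))//.
have := hN l ul lN; rewrite ler_pdivlMr//; set u := nrm _.
by have u0 : 0 <= u := nrm_ge0 _; lra.
Qed.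

(** * Words in the orbits and their sums *)

Section Words.
Variables (R : realType) (X : completeNormedModType R[i]) (T : R -> X -> X).
Hypothesis sT : C0_semigroup T.
Variable v : nat -> int -> X.
Hypothesis v0 : v 0 = (fun=> 0).
Hypothesis vo : forall m, tame_orbit T (v m).

Let tau : R := 2 * pi.
Let tau_gt0 : 0 < tau. Proof. by rewrite mulr_gt0// pi_gt0. Qed.

(* A letter [w k] at position [k] contributes the [k]-th point of the orbit
   [v (w k)], so that [T tau] acts on words as a shift. *)
Definition spells (w : int -> nat) x := has_sum (fun k => v (w k) k) x.

Definition words n : set X := [set x | exists2 w, (forall k, (w k <= n)%N) & spells w x].

Lemma words_tail n (e : R) : 0 < e -> exists N, forall w, (forall k, (w k <= n)%N) ->
  forall l, uniq l -> (forall k, k \in l -> (N <= `|k|)%N) ->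
  nrm (\sum_(k <- l) v (w k) k) <= e.
Proof.
elim: n e => [|n IH] e e0.
  exists 0%N => w w0 l _ _; rewrite big1 ?nrm0 ?ltW// => k _.
  by have := w0 k; rewrite leqn0 => /eqP->; rewrite v0.
have e2 : 0 < e / 2 by lra.
have [N hN] := IH _ e2; have [N' hN'] := (vo n.+1).2 _ e2.
exists (N + N')%N => w wn l ul lN.
pose w' k := if w k == n.+1 then 0%N else w k.
have -> : \sum_(k <- l) v (w k) k = \sum_(k <- l) v (w' k) k +
    \sum_(k <- [seq k <- l | w k == n.+1]) v n.+1 k.
  rewrite big_filter [X in _ + X]big_mkcond -big_split /=; apply: eq_bigr => k _.
  by rewrite /w'; case: eqP => [->|]; rewrite ?v0 ?add0r ?addr0.
rewrite (le_trans (nrmD _ _))//.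
have : nrm (\sum_(k <- l) v (w' k) k) <= e / 2.
  apply: hN => // [k|k /lN]; last by apply: leq_trans; exact: leq_addr.
  by rewrite /w'; case: eqP => // /eqP kn; rewrite -ltnS ltn_neqAle kn wn.
have : nrm (\sum_(k <- [seq k <- l | w k == n.+1]) v n.+1 k) <= e / 2.
  apply: hN' => [|k]; first exact: filter_uniq.
  by rewrite mem_filter => /andP[_ /lN]; apply: leq_trans; exact: leq_addl.
lra.
Qed.

Lemma spells_ex n w : (forall k, (w k <= n)%N) -> exists x, spells w x.
Proof.
move=> wn; apply: sub_cauchy_has_sum => e /(words_tail n)[N hN].
by exists N => l; exact: hN.
Qed.

Lemma spells_shift w x (p : nat) : spells w x ->
  spells (fun k => w (k - p%:Z)) (T (p%:R * tau) x).
Proof.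
move=> wx; elim: p => [|p IH].
  rewrite mul0r (semigroup0 sT) /spells.
  by have -> : (fun k => v (w (k - 0%:Z)) k) = (fun k => v (w k) k)
    by apply/funext => k; rewrite subr0.
have -> : T (p.+1%:R * tau) x = T tau (T (p%:R * tau) x).
  rewrite (semigroupD sT) ?(ltW tau_gt0)//; last by rewrite mulr_ge0// ltW.
  by congr T; rewrite -natr1; ring.
have := has_sum_shift (has_sum_semigroup sT (ltW tau_gt0) IH).
rewrite /spells; set g := (g in has_sum g _ -> _); set g' := (g in _ -> has_sum g _).
suff -> : g = g' by [].
apply/funext => k; rewrite /g /g' (vo _).1 subrK.
by congr (v (w _) _); lia.
Qed.

Lemma words_sub n : words n `<=` words n.+1.
Proof. by move=> x [w wn wx]; exists w => // k; rewrite (leq_trans (wn k)). Qed.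

Lemma words_letter m : words m (v m 0).
Proof.
exists (fun k => if k == 0 then m else 0%N); first by move=> k; case: ifP.
rewrite /spells (_ : (fun k => _) = (fun k => if k == 0 then v m 0 else 0)).
  exact: has_sum_delta.
by apply/funext => k; case: eqP => [->//|_]; rewrite v0.
Qed.

Lemma words_invariant n : T tau @` words n `<=` words n.
Proof.
move=> _ [x [w wn wx] <-]; exists (fun k => w (k - 1%:Z)) => //.
by have := spells_shift 1 wx; rewrite mul1r.
Qed.

End Words.

(** * Periodic gluing of finitely many words *)

Section Glue.
Variables (s N P : nat) (p q : nat -> nat) (w : nat -> int -> nat).
Hypothesis s_gt0 : (0 < s)%N.
Hypothesis pq : forall r, (r < s)%N -> (p r <= q r)%N.
Hypothesis qp : forall r, (r.+1 < s)%N -> (q r + 2 * N + 3 <= p r.+1)%N.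
Hypothesis qP : (q s.-1 + 2 * N + 3 <= P)%N.

(* [T tau ^ j] brings position [- j] to the origin, so the letters at positions
   [- j] with [p r - N <= j <= q r + N] govern the window [p r, q r] of times. *)
Definition glue (k : int) : nat :=
  (* The offset [N] turns the range from [p r - N] to [q r + N] into residues from [p r] to
     [q r + 2 * N], so a window starting at time 0 does not wrap around. *)
  let j := ((N%:Z - k) %% P%:Z)%Z in
  let r := find (fun r => j <= (q r + 2 * N)%:Z) (iota 0 s) in
  if (r < s)%N then w r (N%:Z - j) else 0%N.

Lemma glue_le n : (forall r, (r < s)%N -> forall k, (w r k <= n)%N) ->
  forall k, (glue k <= n)%N.
Proof. by move=> wn k; rewrite /glue; case: ifP => // /wn. Qed.

Lemma glue_periodic k : glue (k - P%:Z) = glue k.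
Proof.
rewrite /glue (_ : N%:Z - (k - P%:Z) = 1 * P%:Z + (N%:Z - k)); last by lia.
by rewrite modzMDl.
Qed.

Let q_p r r' : (r < r')%N -> (r' < s)%N -> (q r + 2 * N + 3 <= p r')%N.
Proof.
elim: r' => // r' IH; rewrite ltnS leq_eqVlt => /predU1P[->|rr'] rs; first exact: qp.
by have := IH rr' (ltnW rs); have := qp rs; have := pq (ltnW rs); lia.
Qed.

(** The windows widened by [N] on both sides are disjoint and fit into one period, so the residue is
    not reduced and [find] stops exactly at [r]. *)
Lemma glue_window r (t : nat) (k : int) : (r < s)%N -> (p r <= t <= q r)%N ->
  (`|k| <= N)%N -> glue (k - t%:Z) = w r (k - t%:Z).
Proof.
move=> rs /andP[pt tq] kN.
have qs : (q r <= q s.-1)%N.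
  have [rs1|] := ltnP r s.-1; last by move=> sr; rewrite (_ : r = s.-1)//; lia.
  have s1 : (s.-1 < s)%N by rewrite prednK.
  by have := q_p rs1 s1; have := pq s1; lia.
have jE : ((N%:Z - (k - t%:Z)) %% P%:Z)%Z = N%:Z - (k - t%:Z).
  by rewrite modz_small//; lia.
rewrite /glue jE.
have -> : find (fun r => N%:Z - (k - t%:Z) <= (q r + 2 * N)%:Z) (iota 0 s) = r.
  rewrite -(subnKC (ltnW rs)) iotaD find_cat add0n.
  rewrite (_ : has _ _ = false); last first.
    apply/hasPn => r'; rewrite mem_iota add0n => /andP[_ rr'].
    by have := q_p rr' rs; lia.
  rewrite size_iota -(prednK (n := s - r)) ?subn_gt0//=.
  by rewrite (_ : _ <= _ = true) ?addn0//; lia.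
by rewrite rs; congr (w r); lia.
Qed.

End Glue.

(** * Specification for points spelled by words *)

Section Specification.
Variables (R : realType) (X : completeNormedModType R[i]) (T : R -> X -> X).
Hypothesis sT : C0_semigroup T.
Variable v : nat -> int -> X.
Hypothesis v0 : v 0 = (fun=> 0).
Hypothesis vo : forall m, tame_orbit T (v m).

Let tau : R := 2 * pi.
Let tau_gt0 : 0 < tau. Proof. by rewrite mulr_gt0// pi_gt0. Qed.

Lemma words_specification n (delta : R) : 0 < delta ->
  exists2 M : R, tau < M & forall (s : nat) (y : nat -> X) (a b : nat -> R),
    (2 <= s)%N -> (forall r, (r < s)%N -> words v n (y r)) -> a 0%N = 0 ->
    (forall r, (r < s)%N -> a r <= b r) ->
    (forall r, (r.+1 < s)%N -> M <= a r.+1 - b r) ->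
    exists x : X, [/\ words v n x,
      forall r t, (r < s)%N -> a r <= t <= b r -> nrm (T t x - T t (y r)) < delta
      & exists2 k : nat, M + b s.-1 <= k%:R * tau < M + b s.-1 + tau &
          T (k%:R * tau) x = x].
Proof.
move=> delta0.
have [C C0 hC] := semigroup_locally_bounded sT (ltW tau_gt0).
(* Two tails cost [2 * e] at multiples of [tau], and the remaining time in [[0, tau]] costs the
   factor [C], which leaves less than [delta]. *)
pose e := delta / (4 * (C + 1)).
have e0 : 0 < e by rewrite divr_gt0//; lra.
have [N hN] := words_tail v0 vo n e0.
have N0 : 0 <= N%:R :> R by [].
have tau0 : 0 < tau := tau_gt0.
(* [2 * N] periods separate the widened windows; the surplus 3 keeps them disjoint after rounding
   and makes [M] exceed [tau] even for [N = 0]. *)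
pose M : R := (2 * N + 3)%N%:R * tau.
exists M.
  by rewrite -[ltLHS]mul1r ltr_pM2r// ltr1n; lia.
move=> s y a b s2 yK a0 ab gap.
have M0 : 0 < M by rewrite mulr_gt0// ltr0n; lia.
have a_ge0 r : (r < s)%N -> 0 <= a r.
  elim: r => [|r IH] rs; first by rewrite a0.
  by have := IH (ltnW rs); have := gap r rs; have := ab r (ltnW rs); lra.
(* Times are rounded down to whole periods: for [t] in [[a r, b r]] the integer part of [t / tau]
   lies between [p r] and [q r], and the remainder is less than one period. *)
pose p r := Num.truncn (a r / tau); pose q r := Num.truncn (b r / tau).
have divt_ge0 t : 0 <= t -> 0 <= t / tau by move=> ?; rewrite divr_ge0// ltW.
have le_div t t' : t <= t' -> t / tau <= t' / tau.
  by move=> ?; rewrite ler_pM2r ?invr_gt0.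
have pq r : (r < s)%N -> (p r <= q r)%N.
  by move=> rs; rewrite le_truncn// le_div// ab.
have b_ge r : (r < s)%N -> (q r)%:R * tau <= b r.
  move=> rs; rewrite -ler_pdivlMr//.
  by have /andP[] := truncn_itv (divt_ge0 _ (le_trans (a_ge0 r rs) (ab r rs))).
have qp r : (r.+1 < s)%N -> (q r + 2 * N + 3 <= p r.+1)%N.
  move=> rs; rewrite truncn_ge_nat ?divt_ge0 ?a_ge0// ler_pdivlMr//.
  have := gap r rs; have := b_ge r (ltnW rs); rewrite /M -addnA natrD mulrDl; lra.
have s1 : (s.-1 < s)%N by lia.
have b0 : 0 <= b s.-1 by rewrite (le_trans (a_ge0 _ s1))// ab.
(* [P] is the ceiling of [(M + b s.-1) / tau], the only integer whose multiple of [tau] lies in the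
   prescribed half-open interval. *)
have [P /andP[P1 P2]] : exists P : nat, M + b s.-1 <= P%:R * tau < M + b s.-1 + tau.
  have z0 : 0 <= (M + b s.-1) / tau by rewrite divt_ge0//; lra.
  have := ceil_itv ((M + b s.-1) / tau).
  have : 0 <= Num.ceil ((M + b s.-1) / tau) by rewrite -(@ler_int R) (le_trans z0)// ceil_ge.
  case: (Num.ceil _) => // P _; rewrite intrB /= => /andP[c1 c2]; exists P.
  by move: c1 c2; rewrite ltr_pdivlMr// ler_pdivrMr// -pmulrn mulrBl mul1r => c1 c2;
    apply/andP; split; lra.
have qP : (q s.-1 + 2 * N + 3 <= P)%N.
  rewrite -(@ler_nat R) -(ler_pM2r tau0) (le_trans _ P1)//.
  have := b_ge _ s1; rewrite /M -addnA natrD mulrDl; lra.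
have [w hw] : exists w : nat -> int -> nat, forall r, (r < s)%N ->
    (forall k, (w r k <= n)%N) /\ spells v (w r) (y r).
  have h r : exists w : int -> nat, (r < s)%N ->
      (forall k, (w k <= n)%N) /\ spells v w (y r).
    have [/yK [w wn wy]|_] := ltnP r s; first by exists w.
    by exists (fun=> 0%N).
  by have [w hw] := choice h; exists w.
have s0 : (0 < s)%N by lia.
pose g := glue s N P q w.
have gn k : (g k <= n)%N by apply: glue_le => r /hw[].
have [x gx] := spells_ex v0 vo gn.
exists x; split.
- by exists g.
- move=> r t rs /andP[at_ tb]; have t0 : 0 <= t by rewrite (le_trans (a_ge0 r rs)).
  pose m := Num.truncn (t / tau); have /andP[m1 m2] := truncn_itv (divt_ge0 _ t0).
  have pm : (p r <= m <= q r)%N by rewrite !le_truncn ?le_div.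
  pose th := t - m%:R * tau.
  have th_itv : 0 <= th <= tau.
    move: m1 m2; rewrite ler_pdivlMr// ltr_pdivrMr// -natr1 mulrDl mul1r -/m /th => m1 m2.
    by apply/andP; split; lra.
  have mt0 : 0 <= m%:R * tau by rewrite mulr_ge0// ltW.
  have th0 : 0 <= th by case/andP: th_itv.
  have tE z : T t z = T th (T (m%:R * tau) z).
    by rewrite (semigroupD sT)// /th subrK.
  rewrite !tE -semigroupB// (le_lt_trans (hC _ _ th_itv))//.
  have [wn wy] := hw r rs.
  have close : nrm (T (m%:R * tau) x - T (m%:R * tau) (y r)) <= 2 * e.
    apply: (has_sum_close (N := N) (spells_shift sT vo m gx) (spells_shift sT vo m wy)).
    + by move=> k kN; rewrite /g (glue_window w s0 pq qp qP rs pm kN).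
    + by move=> l; apply: hN => k; exact: gn.
    + by move=> l; apply: hN.
  rewrite (le_lt_trans (ler_wpM2l C0 close))// /e.
  rewrite (_ : C * _ = delta * (C / (2 * (C + 1)))); last by field; rewrite gt_eqF//; lra.
  rewrite gtr_pMr// ltr_pdivrMr; lra.
exists P; first by rewrite P1.
(* The word has period [P], so shifting by [P] positions spells the same point. *)
apply: has_sum_uniq (gx).
have := spells_shift sT vo P gx; rewrite /spells.
suff -> : (fun k => v (g (k - P%:Z)) k) = (fun k => v (g k) k) by [].
by apply/funext => k; rewrite /g glue_periodic.
Qed.

End Specification.

Theorem proposition12 (R : realType) (X : completeNormedModType R[i])
  (T : R -> X -> X) (Gamma : Type) (I : Gamma -> set R) (f : Gamma -> R -> X)
  (sepX : separable X)
  (semigroupT : C0_semigroup T)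
  (intervalI : forall j, nondegenerate_interval (I j))
  (locally_bounded_f : forall j, locally_bounded_on (I j) (f j))
  (measurable_f : forall j, Lebesgue_measurable_on (I j) (f j))
  (domain_f : forall j t, I j t -> generator_domain T (f j t))
  (eigen_f : forall j t, I j t ->
     generator T (f j t) = (0 +i* t) *: f j t)
  (dense_span : dense (linear_span [set x | exists j t, I j t /\ x = f j t]))
  (regularity :
     (forall j, C_on 2 (I j) (f j)) \/
     (~ contains_c0 X /\
      forall (phi : {linear X -> R[i]^o}) j, continuous phi ->
        C_on 1 (I j) (fun t => phi (f j t)))) :
  SgSP T.
Proof.
have lim : forall x, orbit_limit T x.
  apply: (orbit_limit_span semigroupT _ dense_span) => _ [j [t [It ->]]] e e0.
  apply: (orbit_near semigroupT (intervalI j) (domain_f j) (eigen_f j) _ It e0).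
  by case: regularity => [reg|[nc0 reg]]; [left|right; split=> // phi; exact: reg].
have [v [v0 vo vd]] := orbit_sequence semigroupT sepX lim.
exists (words v), (2 * pi); split.
- exact: words_sub.
- by have := words_letter v0 0; rewrite v0.
- apply/seteqP; split=> // x _ U /nbhs_ballP[e /= e0 eU].
  have e1 : 0 < complex.Re e / 2.
    by move: e0; rewrite ltcE /= => /andP[_ ?]; rewrite divr_gt0.
  have [m hm] := vd x _ e1; exists (v m 0); split.
    by exists m => //; exact: words_letter.
  apply: eU; rewrite -ball_normE /= nrmE nrmBC.
  have -> : e = (complex.Re e)%:C.
    by move: e0; case: (e) => c d; rewrite ltcE /= => /andP[/eqP-> _].
  by rewrite ltcR (le_lt_trans hm)//; lra.
- by rewrite mulr_gt0// pi_gt0.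
- move=> n; split; first exact: (words_invariant semigroupT vo).
  move=> delta delta0.
  have [M tauM hM] := words_specification semigroupT v0 vo n delta0.
  exists M => // s y a b s2 yK a0 ab _ gap.
  have [x [xK hx per]] := hM s y a b s2 yK a0 ab gap.
  exists x; split=> // r t rs rt.
  by rewrite nrmE ltcR hx.
Qed.
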